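(* Let $K>0$ and let $\psi\in L^2(\mathbb{R})\cap L^1(\mathbb{R})$ be real-valued with $\|\psi\|_2=1$, with Fourier transform $\hat\psi$ supported in $[-K,K]$, and with $\|\psi\|_1<\sqrt{2/K}$. For each $d$ let $\varphi(\mathbf{x})=\prod_{j=1}^d\psi(x_j)$, $\mathbf{x}\in\mathbb{R}^d$. For each $d$ let $r_d\in\mathbb{R}$, $\mathbf{w}_d,\mathbf{v}_d\in\mathbb{R}^d$ and $$f^{(d)}(\mathbf{x})=\exp\left(2\pi i\, r_d\,(\mathbf{v}_d^T\mathbf{x}+\mathbf{w}_d^T\mathbf{x}_+)\right),\qquad \mathbf{x}\in\mathbb{R}^d .$$ Fix $\gamma>0$ and define $$\tau_d=\sup_{S\subseteq[d]}\|\mathbf{v}_d+\mathbf{w}_{d,S}\|_\infty,\qquad \Omega_d=\{j\in[d]: r_d|w_{d,j}|\ge\gamma d^2\},\qquad \eta_d=\frac{|\Omega_d|}{d},$$ where $\mathbf{w}_{d,S}\in\mathbb{R}^d$ has entries $w_{d,i}$ for $i\in S$ and $0$ for $i\notin S$. Assume that (i) $\tau_d\cdot r_d=\Theta(d^k)$ as $d\to\infty$ for some constant $k>0$; (ii) $\eta_d\ge\eta$ for all $d$, for some $\eta>0$ independent of $d$; (iii) $2K\|\psi\|_1^2<2^{2\eta}$. Then there exists a constant $\alpha\in(0,1)$, independent of $d$, such that $$\inf_{f_N\in\mathcal{F}_N}\|f^{(d)}-f_N\|_{\varphi^2,2}^2\ \ge\ 1-N\cdot\alpha^d\cdot O(d^{k+1}),$$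 where the constant implied by $O(\cdot)$ does not depend on $d$ or $N$ (and there is no restriction on the size of the weights of $f_N$).
   Context: $[d]=\{1,\dots,d\}$. $\mathbf{x}_+$ denotes the component-wise positive part, $(\mathbf{x}_+)_j=\max(0,x_j)$. The Fourier transform is $\hat\psi(\xi)=\int\psi(x)e^{-2\pi i x\xi}\,dx$. $\|g\|_{\varphi^2,2}^2=\int_{\mathbb{R}^d}|g(\mathbf{x})|^2\varphi(\mathbf{x})^2\,d\mathbf{x}$ (which may be $+\infty$); $\varphi^2$ is a probability density since $\|\psi\|_2=1$. $\mathcal{F}_N$ is the set of one-hidden-layer networks with $N$ units on $\mathbb{R}^d$: functions $\mathbf{x}\mapsto\sum_{k=1}^N u_k\,\sigma_k(\mathbf{a}_k^T\mathbf{x})$ with $u_k\in\mathbb{C}$, $\mathbf{a}_k\in\mathbb{R}^d$ and $\sigma_k:\mathbb{R}\to\mathbb{R}$ arbitrary 1-Lipschitz functions (possibly different for different $k$). *)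

(* Defs.v *)
From HB Require Import structures.
From mathcomp Require Import all_boot all_order all_algebra.
From mathcomp Require Import complex.
From mathcomp Require Import all_classical all_reals all_analysis.

Set Implicit Arguments.
Unset Strict Implicit.
Unset Printing Implicit Defensive.
Import Order.TTheory GRing.Theory Num.Theory.
Import numFieldNormedType.Exports.

Local Open Scope classical_set_scope.
Local Open Scope ring_scope.
Local Open Scope complex_scope.

Section lebesgue_cons.
Context {R : realType} (d : nat).
Local Notation T := (measurableTypeR R).
Variable mu : {sigma_finite_measure set (d.-tuple T) -> \bar R}.

Definition tuple_cons (p : T * d.-tuple T) : d.+1.-tuple T :=
  [tuple of p.1 :: p.2].

Lemma measurable_tuple_cons : measurable_fun [set: T * d.-tuple T] tuple_cons.
Proof. exact: measurable_cons. Qed.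

Definition lebesgue_cons : set (d.+1.-tuple T) -> \bar R :=
  pushforward (lebesgue_measure \x mu)%E tuple_cons.

Let measurable_preim A : measurable A -> measurable (tuple_cons @^-1` A).
Proof.
by move=> mA; rewrite -[X in measurable X]setTI; exact: measurable_tuple_cons.
Qed.

Let lebesgue_cons0 : lebesgue_cons set0 = 0%E.
Proof. by rewrite /lebesgue_cons /pushforward preimage_set0 measure0. Qed.

Let lebesgue_cons_ge0 A : (0 <= lebesgue_cons A)%E.
Proof. by rewrite /lebesgue_cons /pushforward measure_ge0. Qed.

Let lebesgue_cons_sigma_additive : semi_sigma_additive lebesgue_cons.
Proof.
move=> F mF tF mUF; rewrite /lebesgue_cons /pushforward preimage_bigcup.
apply: measure_semi_sigma_additive.
- by move=> n; exact: measurable_preim.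
- apply/trivIsetP => i j _ _ ij; rewrite -preimage_setI.
  by move/trivIsetP : tF => /(_ _ _ _ _ ij) ->//; rewrite preimage_set0.
- by rewrite -preimage_bigcup; exact: measurable_preim.
Qed.

HB.instance Definition _ := isMeasure.Build _ _ _ lebesgue_cons
  lebesgue_cons0 lebesgue_cons_ge0 lebesgue_cons_sigma_additive.

Let lebesgue_cons_sigma_finite : sigma_finite [set: d.+1.-tuple T] lebesgue_cons.
Proof.
have /sigma_finiteP[F [FT ndF Foo]] := sigma_finiteT (@lebesgue_measure R).
have /sigma_finiteP[G [GT ndG Goo]] := sigma_finiteT mu.
have mth : measurable_fun [set: d.+1.-tuple T] (fun t => tnth t ord0).
  exact: measurable_tnth.
pose bh (t : d.+1.-tuple T) : d.-tuple T := [tuple of behead t].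
have mbh : measurable_fun [set: d.+1.-tuple T] bh by exact: measurable_behead.
have bhK x t : bh (tuple_cons (x, t)) = t by exact: val_inj.
exists (fun n => (fun t => tnth t ord0) @^-1` F n `&`
                 bh @^-1` G n).
  apply/seteqP; split => // t _.
  have [n _ Fn] : (\bigcup_n F n) (tnth t ord0) by rewrite -FT.
  have [m _ Gm] : (\bigcup_n G n) (bh t) by rewrite -GT.
  exists (maxn n m) => //; split => /=.
    by move: Fn; exact/subsetPset/ndF/leq_maxl.
  by move: Gm; exact/subsetPset/ndG/leq_maxr.
move=> n; have [mF Fn] := Foo n; have [mG Gn] := Goo n; split.
  apply: measurableI; rewrite -[X in measurable X]setTI.
    exact: mth.
  exact: mbh.
rewrite /lebesgue_cons /pushforward.
have -> : tuple_cons @^-1` ((fun t => tnth t ord0) @^-1` F n `&`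
    bh @^-1` G n) = F n `*` G n.
  by apply/seteqP; split => -[x t] /=; rewrite tnth0 bhK.
by rewrite product_measure1E// lte_mul_pinfty// ge0_fin_numE.
Qed.

HB.instance Definition _ := Measure_isSigmaFinite.Build _ _ _ lebesgue_cons
  lebesgue_cons_sigma_finite.

End lebesgue_cons.

(* The Lebesgue measure on the Borel sets of R^d: the d-fold product of the
   one-dimensional one (the unit mass at the only point when d = 0). *)
Fixpoint lebesgue_tuple (R : realType) (d : nat) :
    {sigma_finite_measure set (d.-tuple (measurableTypeR R)) -> \bar R} :=
  match d return
    {sigma_finite_measure set (d.-tuple (measurableTypeR R)) -> \bar R} with
  | 0 => \d_([tuple] : 0.-tuple (measurableTypeR R))
  | d'.+1 => lebesgue_cons (lebesgue_tuple R d')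
  end.

Lemma lebesgue_tuple_box (R : realType) (d : nat)
    (A : 'I_d -> set (measurableTypeR R)) :
  (forall i, measurable (A i)) ->
  lebesgue_tuple R d [set t | forall i, A i (tnth t i)] =
  (\prod_(i < d) lebesgue_measure (A i))%E.
Proof.
elim: d A => [|d IH] A mA.
  rewrite big_ord0 /= diracE mem_set//= => -[]//.
rewrite big_ord_recl /= /lebesgue_cons /pushforward.
have -> : @tuple_cons R d @^-1` [set t | forall i, A i (tnth t i)] =
    A ord0 `*` [set t | forall i, A (lift ord0 i) (tnth t i)].
  apply/seteqP; split => [[x t] /= H|[x t] /= [Ax H] i].
    split; first by have := H ord0; rewrite tnth0.
    by move=> i; have := H (lift ord0 i); rewrite tnthS.
  by case: (unliftP ord0 i) => [j ->|->]; rewrite ?tnthS ?tnth0.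
have mB : measurable [set t : d.-tuple (measurableTypeR R) |
    forall i, A (lift ord0 i) (tnth t i)].
  rewrite (_ : [set _ | _] = \bigcap_(i in [set: 'I_d])
      ((fun t => tnth t i) @^-1` A (lift ord0 i))).
    apply: fin_bigcap_measurable => [|i _]; first exact: finite_finset.
    by rewrite -[X in measurable X]setTI; exact: measurable_tnth.
  by apply/seteqP; split => [t /= H i _|t /= H i]; exact: H.
rewrite product_measure1E//; congr (_ * _)%E; exact: (IH (fun i => A (lift ord0 i))).
Qed.

Section definitions.
Context {R : realType}.

Definition dot (d : nat) (a x : 'rV[R]_d) : R :=
  \sum_(j < d) a ord0 j * x ord0 j.

Definition pos_part (d : nat) (x : 'rV[R]_d) : 'rV[R]_d :=
  \row_j Num.max 0 (x ord0 j).

Definition restr_vec (d : nat) (S : {set 'I_d}) (w : 'rV[R]_d) : 'rV[R]_d :=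
  \row_j (if j \in S then w ord0 j else 0).

Definition cexpi (t : R) : R[i] := cos t +i* sin t.

Definition fourier (psi : R -> R) (xi : R) : R[i] :=
  let F x := (psi x)%:C * cexpi (- (2 * pi * x * xi)) in
  (\int[lebesgue_measure]_x complex.Re (F x)) +i* (\int[lebesgue_measure]_x complex.Im (F x)).

Definition phi (psi : R -> R) (d : nat) (x : 'rV[R]_d) : R :=
  \prod_(j < d) psi (x ord0 j).

(* The value is allowed to be +oo. *)
Definition sqnorm (psi : R -> R) (d : nat) (g : 'rV[R]_d -> R[i]) : \bar R :=
  (\int[lebesgue_tuple R d]_t
     let x : 'rV[R]_d := \row_j tnth t j in
     (Normc.normc (g x) ^+ 2 * phi psi x ^+ 2)%:E)%E.

Definition networks (N d : nat) : set ('rV[R]_d -> R[i]) :=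
  [set g | exists (u : 'I_N -> R[i]) (a : 'I_N -> 'rV[R]_d)
                  (sigma : 'I_N -> R -> R),
     (forall k, 1.-lipschitz (sigma k)) /\
     g = fun x => \sum_(k < N) u k * (sigma k (dot (a k) x))%:C].

Definition target (d : nat) (r : R) (v w : 'rV[R]_d) (x : 'rV[R]_d) : R[i] :=
  cexpi (2 * pi * r * (dot v x + dot w (pos_part x))).

(* The norm on row vectors is the max-norm. *)
Definition tau (d : nat) (v w : 'rV[R]_d) : R :=
  \big[Num.max/0]_(S : {set 'I_d}) `|v + restr_vec S w|.

Definition Omega (gamma : R) (d : nat) (r : R) (w : 'rV[R]_d) : {set 'I_d} :=
  [set j : 'I_d | gamma * d%:R ^+ 2 <= r * `|w ord0 j|].

Definition eta_ratio (gamma : R) (d : nat) (r : R) (w : 'rV[R]_d) : R :=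
  #|Omega gamma r w|%:R / d%:R.

End definitions.

Arguments networks R N d : clear implicits.

(* Main.v *)
(** A band-limited [psi] makes [x |-> sigma (a . x) * phi x] spectrally supported in a tube
    around the line [R a], whatever the Lipschitz function [sigma]. Cut a large frequency
    interval into small cells and, for a choice [Q] of one cell per coordinate, let [B_Q] be
    the product of the normalised Fourier transforms of the cells. The [B_Q] satisfy
    Bessel's inequality, the coefficients of [f * phi] against them factor over the
    coordinates and have square sum close to 1, and a unit with direction [a] is orthogonal
    to every [B_Q] whose frequency is far from the line [R a]. Hence the squared distance is
    at least 1 minus the mass of [f * phi] in [N] tubes. In a tube, the coordinate where
    [|a_j|] is largest determines every other coordinate up to a window of length [O(K)].
    Since [psi] cannot vanish on a half-line, the pieces of [psi] on both sides of 0 have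
    mass less than 1; for [j] in [Omega] the oscillation of [f] moves their spectra far
    apart, so that a window contains at most a fraction [c < 1] of the mass in that
    coordinate. A tube thus has mass at most [c ^ (|Omega| - 1)], and [alpha = c `^ eta]. *)
From HB Require Import structures.
Require Import Defs.
From mathcomp Require Import all_boot all_order all_algebra.
From mathcomp Require Import complex.
From mathcomp Require Import all_classical all_reals all_analysis.
From mathcomp Require Import measurable_realfun.
From mathcomp Require Import ring lra zify.

Set Implicit Arguments.
Unset Strict Implicit.
Unset Printing Implicit Defensive.
Import Order.TTheory GRing.Theory Num.Theory.
Import numFieldNormedType.Exports.

Local Open Scope classical_set_scope.
Local Open Scope ring_scope.

(** A Lipschitz [sigma] may grow linearly, so [sigma (a . x) * phi x] need not be integrable and has
    a spectrum only in the sense of distributions. No distribution is used: only pairings with the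
    [B_Q] occur, whose factors decay like [1 / (1 + |x|)], and one such factor per coordinate
    absorbs the growth of [sigma]. To see that a pairing vanishes, all coordinates but two are
    frozen and the integral is taken along the lines where [a_i x + a_j y] is constant. There
    [sigma] is constant, and what remains is the transform at frequency 0 of a product of
    band-limited functions. Taking [|a_i|] maximal keeps the slope [rho = a_j / a_i] in [-1, 1], so
    no band is stretched. A [B_Q] outside all tubes is orthogonal to every unit, so the size of the
    weights never enters. The window constant has to be uniform in the position and in both
    frequencies; this holds because the two pieces of each coordinate factor have as spectra
    translates of two fixed functions. The range and the width of the cells are chosen last, for an
    arbitrary error, and leave no trace in the bound. *)

Notation Re := complex.Re.
Notation Im := complex.Im.
Import Normc.
Notation conjc := complex.conjc.

(** * Complex numbers by components, and the unit circle *)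

Section complex_numbers.
Local Open Scope complex_scope.
Context {R : realType}.
Implicit Types (x y z : R[i]) (a b t : R).

Lemma RecD x y : Re (x + y) = Re x + Re y. Proof. by case: x y => [? ?] []. Qed.
Lemma ImcD x y : Im (x + y) = Im x + Im y. Proof. by case: x y => [? ?] []. Qed.
Lemma RecN x : Re (- x) = - Re x. Proof. by case: x. Qed.
Lemma ImcN x : Im (- x) = - Im x. Proof. by case: x. Qed.
Lemma RecM x y : Re (x * y) = Re x * Re y - Im x * Im y.
Proof. by case: x y => [? ?] []. Qed.
Lemma ImcM x y : Im (x * y) = Re x * Im y + Im x * Re y.
Proof. by case: x y => [a b] [c d] /=; rewrite addrC; congr (_ + _); rewrite mulrC. Qed.
Lemma ReJ x : Re (conjc x) = Re x. Proof. by case: x. Qed.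
Lemma ImJ x : Im (conjc x) = - Im x. Proof. by case: x. Qed.

Lemma complex_eq x y : Re x = Re y -> Im x = Im y -> x = y.
Proof. by case: x y => [a b] [c d] /= -> ->. Qed.

Lemma normc_ge0 x : 0 <= normc x.
Proof. by case: x => a b; rewrite sqrtr_ge0. Qed.

Lemma normc_sq x : normc x ^+ 2 = Re x ^+ 2 + Im x ^+ 2.
Proof. by case: x => a b /=; rewrite sqr_sqrtr// addr_ge0 ?sqr_ge0. Qed.

Lemma conjcM x y : conjc (x * y) = conjc x * conjc y.
Proof. exact: rmorphM. Qed.

Lemma normcJ x : normc (conjc x) = normc x.
Proof. by case: x => a b /=; rewrite sqrrN. Qed.

Lemma normc_real a : normc a%:C = `|a|.
Proof. by rewrite /= expr0n /= addr0 sqrtr_sqr. Qed.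

Lemma Re_le_normc x : `|Re x| <= normc x.
Proof.
rewrite -(@ler_pXn2r _ 2%N) ?nnegrE ?normc_ge0//.
by rewrite normc_sq real_normK ?num_real// lerDl sqr_ge0.
Qed.

Lemma Im_le_normc x : `|Im x| <= normc x.
Proof.
rewrite -(@ler_pXn2r _ 2%N) ?nnegrE ?normc_ge0//.
by rewrite normc_sq real_normK ?num_real// lerDr sqr_ge0.
Qed.

Lemma normc_le_ReIm x : normc x <= `|Re x| + `|Im x|.
Proof.
rewrite -(@ler_pXn2r _ 2%N) ?nnegrE ?normc_ge0 ?addr_ge0//.
rewrite normc_sq sqrrD !real_normK ?num_real// -addrA lerD2l lerDr.
by rewrite mulrn_wge0// mulr_ge0.
Qed.

Lemma le_normcB x y : normc (x - y) <= normc x + normc y.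
Proof. by rewrite (le_trans (le_normcD _ _))// normcN. Qed.

Lemma normc_prod (I : Type) (s : seq I) (P : pred I) (F : I -> R[i]) :
  normc (\prod_(i <- s | P i) F i) = \prod_(i <- s | P i) normc (F i).
Proof. by apply: (big_morph _ (@normcM R)); rewrite normc1. Qed.

Lemma normcX x n : normc (x ^+ n) = normc x ^+ n.
Proof. by elim: n => [|n ih]; rewrite ?expr0 ?normc1// !exprS normcM ih. Qed.

Lemma mulcJ x : x * conjc x = (normc x ^+ 2)%:C.
Proof.
rewrite normc_sq; case: x => a b; apply: complex_eq; rewrite ?RecM ?ImcM /=; ring.
Qed.

Lemma cexpi0 : cexpi 0 = 1 :> R[i].
Proof. by rewrite /cexpi cos0 sin0. Qed.

Lemma cexpiD a b : cexpi (a + b) = cexpi a * cexpi b.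
Proof. by apply: complex_eq; rewrite ?RecM ?ImcM /= ?cosD ?sinD; ring. Qed.

Lemma cexpiN t : cexpi (- t) = conjc (cexpi t).
Proof. by rewrite /cexpi cosN sinN. Qed.

Lemma normc_cexpi t : normc (cexpi t) = 1.
Proof. by rewrite /= cos2Dsin2 sqrtr1. Qed.

Lemma sin_le_norm t : `|sin t| <= `|t|.
Proof.
wlog t0 : t / 0 <= t => [h|].
  have [/h//|/ltW t0] := leP 0 t.
  by rewrite -normrN -sinN -(normrN t) h// oppr_ge0.
have [->|tN0] := eqVneq t 0; first by rewrite sin0.
have {t0 tN0}t0 : 0 < t by rewrite lt_neqAle eq_sym tN0.
have [|c _] := @MVT R sin cos 0 t t0.
  by apply: continuous_subspaceT => x; exact: continuous_sin.
rewrite sin0 !subr0 => ->; rewrite normrM ler_piMl// ler_norml cos_geN1 cos_le1//.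
Qed.

(** A chord is at most its arc: after a rotation the squared chord is [4 sin^2 (t / 2)] with
    [t = a - b]. *)
Lemma cexpi_lip a b : normc (cexpi a - cexpi b) <= `|a - b|.
Proof.
have -> : cexpi a - cexpi b = cexpi b * (cexpi (a - b) - 1).
  by rewrite mulrBr -cexpiD mulr1 (addrC b) subrK.
rewrite normcM normc_cexpi mul1r; set t := a - b.
rewrite -(@ler_pXn2r _ 2%N) ?nnegrE ?normc_ge0// normc_sq.
rewrite RecD ImcD RecN ImcN /= subr0.
have -> : t = (t / 2) *+ 2 by rewrite mulr2n -splitr.
have h : sin (t / 2) ^+ 2 <= (t / 2) ^+ 2.
  rewrite -[leLHS]real_normK ?num_real// -[leRHS]real_normK ?num_real//.
  by rewrite ler_pXn2r ?nnegrE// sin_le_norm.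
rewrite [leRHS]real_normK ?num_real//.
rewrite cos_mulr2n sin_mulr2n.
have := cos2Dsin2 (t / 2); move: h; set c := cos (t / 2); set s := sin (t / 2) => h cs.
have {}cs : c ^+ 2 = 1 - s ^+ 2 by rewrite -cs addrK.
have -> : (c ^+ 2 *+ 2 - 1 - 1) ^+ 2 + ((c * s) *+ 2) ^+ 2 = 4 * s ^+ 2.
  transitivity ((c ^+ 2 *+ 2 - 2) ^+ 2 + 4 * (c ^+ 2 * s ^+ 2)); first by ring.
  by rewrite cs; ring.
rewrite (_ : (t / 2 *+ 2) ^+ 2 = 4 * (t / 2) ^+ 2); last by ring.
by apply: ler_wpM2l.
Qed.

End complex_numbers.

(** * Complex-valued integrals *)

Section real_integrals.
Context d1 d2 (T1 : measurableType d1) (T2 : measurableType d2) (R : realType).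
Variables (m1 : {sigma_finite_measure set T1 -> \bar R})
          (m2 : {sigma_finite_measure set T2 -> \bar R}).

(** The partial integrals are finite only almost everywhere. On the exceptional null set [fine]
    returns 0, so the real and the extended versions agree a.e., which is what the integral sees. *)
Let ae_fineF (F : T1 * T2 -> R) :
  (m1 \x m2)%E.-integrable setT (EFin \o F) ->
  measurable_fun setT (fun x => \int[m2]_y F (x, y)) /\
  ae_eq m1 setT (fun x => (\int[m2]_y F (x, y))%:E)
    (fubini_F m2 (EFin \o F)).
Proof.
move=> iF; split.
  exact: (measurableT_comp (@fine_measurable R setT measurableT) (measurable_fubini_F iF)).
apply: filterS (ae_integrable1 iF) => x ix _ /=.
by rewrite fineK//; exact: integrable_fin_num ix.
Qed.

Let ae_fineG (F : T1 * T2 -> R) :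
  (m1 \x m2)%E.-integrable setT (EFin \o F) ->
  measurable_fun setT (fun y => \int[m1]_x F (x, y)) /\
  ae_eq m2 setT (fun y => (\int[m1]_x F (x, y))%:E)
    (fubini_G m1 (EFin \o F)).
Proof.
move=> iF; split.
  exact: (measurableT_comp (@fine_measurable R setT measurableT) (measurable_fubini_G iF)).
apply: filterS (ae_integrable2 iF) => x ix _ /=.
by rewrite fineK//; exact: integrable_fin_num ix.
Qed.

Lemma Rintegral12 (F : T1 * T2 -> R) :
  (m1 \x m2)%E.-integrable setT (EFin \o F) ->
  \int[m1]_x \int[m2]_y F (x, y) = \int[(m1 \x m2)%E]_z F z.
Proof.
move=> iF; have [mF aeF] := ae_fineF iF.
rewrite {1}/Rintegral; congr fine.
rewrite -(integral12_prod_meas1 iF); apply: ae_eq_integral => //.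
  exact/measurable_EFinP.
exact: (measurable_fubini_F iF).
Qed.

Lemma Rintegral21 (F : T1 * T2 -> R) :
  (m1 \x m2)%E.-integrable setT (EFin \o F) ->
  \int[m2]_y \int[m1]_x F (x, y) = \int[(m1 \x m2)%E]_z F z.
Proof.
move=> iF; have [mG aeG] := ae_fineG iF.
rewrite {1}/Rintegral; congr fine.
rewrite -(integral21_prod_meas1 iF); apply: ae_eq_integral => //.
  exact/measurable_EFinP.
exact: (measurable_fubini_G iF).
Qed.

Lemma integrable_Rintegral1 (F : T1 * T2 -> R) :
  (m1 \x m2)%E.-integrable setT (EFin \o F) ->
  m1.-integrable setT (EFin \o (fun x => \int[m2]_y F (x, y))).
Proof.
move=> iF; have [mF aeF] := ae_fineF iF.
have /integrableP[_ foo] := integrable_fubini_F iF.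
apply/integrableP; split; first exact/measurable_EFinP.
apply: le_lt_trans foo; rewrite le_eqVlt; apply/orP; left; apply/eqP.
apply: ae_eq_integral => //.
- apply/measurableT_comp => //; exact/measurable_EFinP.
- by apply/measurableT_comp => //; exact: (measurable_fubini_F iF).
- by apply: filterS aeF => x /= h _; rewrite -h.
Qed.

Lemma integrable_Rintegral2 (F : T1 * T2 -> R) :
  (m1 \x m2)%E.-integrable setT (EFin \o F) ->
  m2.-integrable setT (EFin \o (fun y => \int[m1]_x F (x, y))).
Proof.
move=> iF; have [mG _] := ae_fineG iF.
have mF : measurable_fun setT (EFin \o F) by exact: measurable_int iF.
pose G y := (\int[m1]_x `|(F (x, y))%:E|)%E.
have G0 y : (0 <= G y)%E by apply: integral_ge0 => x _.
have iG : m2.-integrable setT G.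
  apply/integrableP; split.
    apply: (measurable_fun_fubini_tonelli_G (fun z => `|(F z)%:E|%E)) => //.
    exact: measurableT_comp.
  have foo := (integrable21ltyP m1 m2 mF).1 iF.
  apply: le_lt_trans foo; rewrite le_eqVlt; apply/orP; left; apply/eqP.
  by apply: eq_integral => y _; exact: gee0_abs (G0 y).
apply: (le_integrable _ _ _ iG) => //; first exact/measurable_EFinP.
move=> y _; rewrite (gee0_abs (G0 y)).
have mFy : measurable_fun setT (fun x => (F (x, y))%:E).
  exact: (measurableT_comp mF (measurable_pair2 y)).
apply: le_trans (le_abse_integral m1 measurableT mFy).
rewrite /= /Rintegral; case: (integral _ _ _) => [c| |] //=;
  by rewrite ?normr0 ?leey.
Qed.

Lemma integrable_prod (g : T1 -> R) (h : T2 -> R) :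
  m1.-integrable setT (EFin \o g) -> m2.-integrable setT (EFin \o h) ->
  (m1 \x m2)%E.-integrable setT (EFin \o (fun z => g z.1 * h z.2)).
Proof.
move=> ig ih.
have mg : measurable_fun setT g by apply/measurable_EFinP; exact: measurable_int ig.
have mh : measurable_fun setT h by apply/measurable_EFinP; exact: measurable_int ih.
apply/integrable12ltyP => /=.
  apply/measurable_EFinP; apply: measurable_funM.
    exact: (measurableT_comp mg).
  exact: (measurableT_comp mh).
under eq_integral => x _.
  under eq_integral => y _ do rewrite normrM EFinM.
  rewrite ge0_integralZl//; last first.
    by apply/measurable_EFinP; exact: measurableT_comp.
  rewrite -[X in (_ * X)%E]fineK; last first.
    by apply: integrable_fin_num => //; exact: integrable_norm.
  over.
set c := fine _.
have -> : (fun x => (`|g x|%:E * c%:E)%E) = fun x => (c%:E * `|g x|%:E)%E.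
  by apply/funext => x; rewrite muleC.
rewrite integralZl//; last exact: integrable_norm.
rewrite -[X in (_ * X)%E]fineK; last first.
  by apply: integrable_fin_num => //; exact: integrable_norm.
by rewrite -EFinM ltry.
Qed.

End real_integrals.

Section complex_integral.
Local Open Scope complex_scope.
Context d (T : measurableType d) (R : realType).
Implicit Types (f g : T -> R[i]).

Definition cmeas f :=
  measurable_fun setT (fun x => Re (f x)) /\ measurable_fun setT (fun x => Im (f x)).

Variable mu : {measure set T -> \bar R}.

Definition cintble f :=
  mu.-integrable setT (EFin \o (fun x => Re (f x))) /\
  mu.-integrable setT (EFin \o (fun x => Im (f x))).

(** Same shape as [fourier]: a statement about [fourier psi] is one about [fhat] below by
    conversion. *)
Definition cint f : R[i] := (\int[mu]_x Re (f x)) +i* (\int[mu]_x Im (f x)).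

Lemma cmeasD f g : cmeas f -> cmeas g -> cmeas (fun x => f x + g x).
Proof.
move=> [f1 f2] [g1 g2]; split.
  by under eq_fun do rewrite RecD; exact: measurable_funD.
by under eq_fun do rewrite ImcD; exact: measurable_funD.
Qed.

Lemma cmeasN f : cmeas f -> cmeas (fun x => - f x).
Proof.
move=> [f1 f2]; split.
  by under eq_fun do rewrite RecN; exact: measurable_funN.
by under eq_fun do rewrite ImcN; exact: measurable_funN.
Qed.

Lemma cmeasB f g : cmeas f -> cmeas g -> cmeas (fun x => f x - g x).
Proof. by move=> mf mg; apply: cmeasD => //; exact: cmeasN. Qed.

Lemma cmeasM f g : cmeas f -> cmeas g -> cmeas (fun x => f x * g x).
Proof.
move=> [f1 f2] [g1 g2]; split.
  by under eq_fun do rewrite RecM; apply: measurable_funB; exact: measurable_funM.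
by under eq_fun do rewrite ImcM; apply: measurable_funD; exact: measurable_funM.
Qed.

Lemma cmeasJ f : cmeas f -> cmeas (fun x => conjc (f x)).
Proof.
move=> [f1 f2]; split; first by under eq_fun do rewrite ReJ.
by under eq_fun do rewrite ImJ; exact: measurable_funN.
Qed.

Lemma cmeas_cst (c : R[i]) : cmeas (fun=> c). Proof. by split. Qed.

Lemma cmeas_real (f : T -> R) : measurable_fun setT f -> cmeas (fun x => (f x)%:C).
Proof. by move=> mf; split. Qed.

Lemma cmeas_sum (I : Type) (s : seq I) (P : pred I) (F : I -> T -> R[i]) :
  (forall i, cmeas (F i)) -> cmeas (fun x => \sum_(i <- s | P i) F i x).
Proof.
move=> mF; elim: s => [|i s ih].
  by under eq_fun do rewrite big_nil; exact: cmeas_cst.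
under eq_fun do rewrite big_cons; case: (P i) => //; exact: cmeasD.
Qed.

Lemma cmeas_prod (I : Type) (s : seq I) (P : pred I) (F : I -> T -> R[i]) :
  (forall i, cmeas (F i)) -> cmeas (fun x => \prod_(i <- s | P i) F i x).
Proof.
move=> mF; elim: s => [|i s ih].
  by under eq_fun do rewrite big_nil; exact: cmeas_cst.
under eq_fun do rewrite big_cons; case: (P i) => //; exact: cmeasM.
Qed.

Lemma cmeas_cexpi (f : T -> R) : measurable_fun setT f -> cmeas (fun x => cexpi (f x)).
Proof.
move=> mf; split => /=.
  apply: measurableT_comp mf; apply: continuous_measurable_fun.
  exact: continuous_cos.
apply: measurableT_comp mf; apply: continuous_measurable_fun.
exact: continuous_sin.
Qed.

Lemma measurable_normc f : cmeas f -> measurable_fun setT (fun x => normc (f x)).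
Proof.
move=> [f1 f2].
have -> : (fun x => normc (f x)) =
    (@Num.sqrt R) \o (fun x => Re (f x) ^+ 2 + Im (f x) ^+ 2).
  by apply/funext => x /=; case: (f x).
apply: measurableT_comp.
  by apply: continuous_measurable_fun; exact: sqrt_continuous.
by apply: measurable_funD; exact: measurable_funX.
Qed.

Lemma cintble_meas f : cintble f -> cmeas f.
Proof. by move=> [/measurable_int/measurable_EFinP ? /measurable_int/measurable_EFinP]. Qed.

Lemma cintble_le f (g : T -> R) : cmeas f -> mu.-integrable setT (EFin \o g) ->
  (forall x, normc (f x) <= g x) -> cintble f.
Proof.
move=> [f1 f2] ig fg; split; apply: (le_integrable _ _ _ ig) => //.
- exact/measurable_EFinP.
- move=> x _; rewrite /= lee_fin (le_trans (Re_le_normc _))//.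
  by rewrite (le_trans (fg x))// ler_norm.
- exact/measurable_EFinP.
- move=> x _; rewrite /= lee_fin (le_trans (Im_le_normc _))//.
  by rewrite (le_trans (fg x))// ler_norm.
Qed.

Lemma cintble_normc f : cintble f -> mu.-integrable setT (EFin \o (fun x => normc (f x))).
Proof.
move=> cf; have [/integrable_norm f1 /integrable_norm f2] := cf.
apply: (le_integrable _ _ _ (integrableD _ f1 f2)) => //.
  by apply/measurable_EFinP/measurable_normc/cintble_meas.
move=> x _ /=; rewrite lee_fin ger0_norm ?normc_ge0//.
by rewrite (le_trans (normc_le_ReIm _))// ler_norm.
Qed.

Lemma cintble_lty f : cmeas f -> (\int[mu]_x (normc (f x))%:E < +oo)%E -> cintble f.
Proof.
move=> mf foo; apply: (@cintble_le _ (fun x => normc (f x))) => //.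
apply/integrableP; split; first exact/measurable_EFinP/measurable_normc.
under eq_integral do rewrite /= ger0_norm ?normc_ge0//.
exact: foo.
Qed.

Lemma normc_lty f : cintble f -> (\int[mu]_x (normc (f x))%:E < +oo)%E.
Proof.
move=> /cintble_normc/integrableP[_]; apply: le_lt_trans.
rewrite le_eqVlt; apply/orP; left; apply/eqP.
by apply: eq_integral => x _ /=; rewrite ger0_norm// normc_ge0.
Qed.

Lemma cintbleJ f : cintble f -> cintble (fun x => conjc (f x)).
Proof.
move=> cf; apply: (cintble_le _ (cintble_normc cf)).
  exact/cmeasJ/cintble_meas.
by move=> x; rewrite normcJ.
Qed.

Lemma cintbleD f g : cintble f -> cintble g -> cintble (fun x => f x + g x).
Proof.
move=> cf cg.
apply: (@cintble_le _ (fun x => normc (f x) + normc (g x))).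
- by apply: cmeasD; exact: cintble_meas.
- by apply: (integrableD _ (cintble_normc cf) (cintble_normc cg)).
- by move=> x; exact: le_normcD.
Qed.

Lemma cintbleM_bd f g (M : R) : cintble f -> cmeas g -> (forall x, normc (g x) <= M) ->
  cintble (fun x => f x * g x).
Proof.
move=> cf mg gM; apply: (@cintble_le _ (fun x => M * normc (f x))).
- by apply: cmeasM => //; exact: cintble_meas.
- exact: (integrableZl _ M (cintble_normc cf)).
- by move=> x; rewrite normcM mulrC ler_wpM2r ?normc_ge0.
Qed.

Lemma cintbleZ f (c : R[i]) : cintble f -> cintble (fun x => c * f x).
Proof.
move=> cf; under eq_fun do rewrite mulrC.
exact: (@cintbleM_bd _ _ (normc c) cf (cmeas_cst c)).
Qed.

Lemma cintble0 : cintble (fun=> 0).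
Proof. by split; exact: integrable0. Qed.

Lemma cintble_sum (I : Type) (s : seq I) (P : pred I) (F : I -> T -> R[i]) :
  (forall i, P i -> cintble (F i)) -> cintble (fun x => \sum_(i <- s | P i) F i x).
Proof.
move=> mF; elim: s => [|i s ih].
  by under eq_fun do rewrite big_nil; exact: cintble0.
under eq_fun do rewrite big_cons; case: (boolP (P i)) => // Pi.
by apply: cintbleD => //; exact: mF.
Qed.

Lemma cintD f g : cintble f -> cintble g ->
  cint (fun x => f x + g x) = cint f + cint g.
Proof.
move=> [f1 f2] [g1 g2]; apply: complex_eq; rewrite ?RecD ?ImcD /=.
  by rewrite -RintegralD//; apply: eq_Rintegral => x _; rewrite RecD.
by rewrite -RintegralD//; apply: eq_Rintegral => x _; rewrite ImcD.
Qed.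

Lemma cintZ f (c : R[i]) : cintble f -> cint (fun x => c * f x) = c * cint f.
Proof.
move=> [f1 f2]; apply: complex_eq; rewrite ?RecM ?ImcM /=.
  rewrite -!RintegralZl//.
  rewrite -RintegralB//.
    by apply: eq_Rintegral => x _; rewrite RecM.
  exact: (integrableZl _ _ f1).
  exact: (integrableZl _ _ f2).
rewrite -!RintegralZl//.
rewrite -RintegralD//.
  by apply: eq_Rintegral => x _; rewrite ImcM.
exact: (integrableZl _ _ f2).
exact: (integrableZl _ _ f1).
Qed.

Lemma cintZr f (c : R[i]) : cintble f -> cint (fun x => f x * c) = cint f * c.
Proof.
move=> cf; rewrite mulrC -cintZ//.
by under eq_fun do rewrite mulrC.
Qed.

Lemma cint0 : cint (fun=> 0) = 0.
Proof. by apply: complex_eq => /=; rewrite Rintegral_cst//= mul0r. Qed.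

Lemma cintJ f : cintble f -> cint (fun x => conjc (f x)) = conjc (cint f).
Proof.
move=> [f1 f2]; apply: complex_eq; rewrite ?ReJ ?ImJ /=.
  by apply: eq_Rintegral => x _; rewrite ReJ.
rewrite -mulN1r -RintegralZl//.
by apply: eq_Rintegral => x _; rewrite ImJ mulN1r.
Qed.

Lemma cint_sum (I : Type) (s : seq I) (P : pred I) (F : I -> T -> R[i]) :
  (forall i, P i -> cintble (F i)) ->
  cint (fun x => \sum_(i <- s | P i) F i x) = \sum_(i <- s | P i) cint (F i).
Proof.
move=> mF; elim: s => [|i s ih].
  by under eq_fun do rewrite big_nil; rewrite cint0 big_nil.
under eq_fun do rewrite big_cons; rewrite big_cons; case: (boolP (P i)) => // Pi.
by rewrite cintD ?ih//; [exact: mF|exact: cintble_sum].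
Qed.

Lemma eq_cint f g : f =1 g -> cint f = cint g.
Proof. by move=> /funext ->. Qed.

(** Rotation trick: times the conjugate of its own value the integral is real and nonnegative, so it
    suffices to bound a real part under the integral sign. *)
Lemma normc_cint f : cintble f -> normc (cint f) <= \int[mu]_x normc (f x).
Proof.
move=> cf; have [z0|z0] := eqVneq (cint f) 0.
  by rewrite z0 normc0 Rintegral_ge0// => x _; exact: normc_ge0.
have nz : 0 < normc (cint f).
  rewrite lt_neqAle normc_ge0 andbT eq_sym; apply: contra_neq z0.
  exact: eq0_normc.
rewrite -(ler_pM2l nz) -expr2.
have -> : normc (cint f) ^+ 2 = Re (conjc (cint f) * cint f).
  by rewrite mulrC mulcJ.
have := normcJ (cint f); move: (conjc _) => c nc.
rewrite -cintZ//= -RintegralZl//; last exact: cintble_normc.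
have [cz _] := cintbleZ c cf.
apply: le_Rintegral => //.
  by apply: (integrableZl _ _ (cintble_normc cf)).
move=> x _; rewrite (le_trans (ler_norm _))// (le_trans (Re_le_normc _))//.
by rewrite normcM nc.
Qed.

End complex_integral.

Lemma cmeas_comp d1 d2 (T1 : measurableType d1) (T2 : measurableType d2)
    (R : realType) (f : T2 -> R[i]) (g : T1 -> T2) :
  cmeas f -> measurable_fun setT g -> cmeas (fun x => f (g x)).
Proof.
move=> [f1 f2] mg; split.
  exact: (measurableT_comp f1 mg).
exact: (measurableT_comp f2 mg).
Qed.

Section complex_fubini.
Context d1 d2 (T1 : measurableType d1) (T2 : measurableType d2) (R : realType).
Variables (m1 : {sigma_finite_measure set T1 -> \bar R})
          (m2 : {sigma_finite_measure set T2 -> \bar R}).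
Implicit Types F : T1 * T2 -> R[i].

Lemma cint12 F : cintble (m1 \x m2)%E F ->
  cint m1 (fun x => cint m2 (fun y => F (x, y))) = cint (m1 \x m2)%E F.
Proof.
move=> [F1 F2]; apply: complex_eq => /=.
  by rewrite -(Rintegral12 F1).
by rewrite -(Rintegral12 F2).
Qed.

Lemma cint21 F : cintble (m1 \x m2)%E F ->
  cint m2 (fun y => cint m1 (fun x => F (x, y))) = cint (m1 \x m2)%E F.
Proof.
move=> [F1 F2]; apply: complex_eq => /=.
  by rewrite -(Rintegral21 F1).
by rewrite -(Rintegral21 F2).
Qed.

Lemma cint_swap F : cintble (m1 \x m2)%E F ->
  cint m1 (fun x => cint m2 (fun y => F (x, y))) =
  cint m2 (fun y => cint m1 (fun x => F (x, y))).
Proof. by move=> iF; rewrite cint12// cint21. Qed.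

Lemma cintble_cint1 F : cintble (m1 \x m2)%E F ->
  cintble m1 (fun x => cint m2 (fun y => F (x, y))).
Proof.
move=> [F1 F2]; split => /=.
  exact: (integrable_Rintegral1 F1).
exact: (integrable_Rintegral1 F2).
Qed.

Lemma cintble_cint2 F : cintble (m1 \x m2)%E F ->
  cintble m2 (fun y => cint m1 (fun x => F (x, y))).
Proof.
move=> [F1 F2]; split => /=.
  exact: (integrable_Rintegral2 F1).
exact: (integrable_Rintegral2 F2).
Qed.

Lemma cintble_prod_le F (g : T1 -> R) (h : T2 -> R) : cmeas F ->
  m1.-integrable setT (EFin \o g) -> m2.-integrable setT (EFin \o h) ->
  (forall x y, normc (F (x, y)) <= g x * h y) -> cintble (m1 \x m2)%E F.
Proof.
move=> mF ig ih Fgh.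
apply: (cintble_le mF (integrable_prod ig ih)) => -[x y] /=; exact: Fgh.
Qed.

Lemma cintble_lty12 F : cmeas F ->
  (\int[m1]_x \int[m2]_y (normc (F (x, y)))%:E < +oo)%E -> cintble (m1 \x m2)%E F.
Proof.
move=> mF foo; apply: cintble_lty => //.
rewrite fubini_tonelli1//.
  by apply/measurable_EFinP/measurable_normc.
by move=> z; rewrite lee_fin normc_ge0.
Qed.

Lemma cintble_lty21 F : cmeas F ->
  (\int[m2]_y \int[m1]_x (normc (F (x, y)))%:E < +oo)%E -> cintble (m1 \x m2)%E F.
Proof.
move=> mF foo; apply: cintble_lty => //.
rewrite fubini_tonelli2//.
  by apply/measurable_EFinP/measurable_normc.
by move=> z; rewrite lee_fin normc_ge0.
Qed.

Lemma cmeas_cint1 F : cintble (m1 \x m2)%E F ->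
  cmeas (fun x => cint m2 (fun y => F (x, y))).
Proof. by move=> /cintble_cint1/cintble_meas. Qed.

End complex_fubini.

(** * Affine changes of variable and the Poisson kernel *)

Section change_of_variable.
Context {R : realType}.
Local Notation leb := (@lebesgue_measure R).
Local Notation T := (measurableTypeR R).

Definition affine (a c : R) : T -> T := fun x => a * x + c.

Lemma measurable_affine (a c : R) : measurable_fun [set: T] (affine a c).
Proof. by apply: measurable_funD => //; exact: mulrl_measurable. Qed.

Definition pushm d1 d2 (T1 : measurableType d1) (T2 : measurableType d2)
    (m : {measure set T1 -> \bar R}) (f : T1 -> T2) (mf : measurable_fun setT f) :
    {measure set T2 -> \bar R} :=
  measure_function_pushforward__canonical__measure_function_Measure m mf.

(** By uniqueness of Lebesgue measure it is enough to compare both sides on half-open intervals. *)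
Lemma lebesgue_measure_affine (a c : R) (a0 : 0 < a) (A : set T) :
  measurable A ->
  leb A = mscale (NngNum (ltW a0)) (pushm leb (measurable_affine a c)) A.
Proof.
apply: (@lebesgue_measure_unique _ (mscale (NngNum (ltW a0)) (pushm leb (measurable_affine a c)))) => /= _ [[p q]] _ <-.
rewrite /mscale /= /pushforward.
rewrite (_ : affine a c @^-1` _ = `](p - c) / a, (q - c) / a]%classic); last first.
  by apply/seteqP; split => x; rewrite /affine /= !in_itv/= ltr_pdivrMr//
    ler_pdivlMr// ltrBlDr lerBrDr (mulrC x).
rewrite !lebesgue_measure_itv/= !lte_fin ltr_pM2r ?invr_gt0// ltrBlDr subrK.
case: ifPn => _; last by rewrite mule0.
rewrite -!EFinD -EFinM -mulrBl mulrC divfK ?gt_eqF//.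
by congr (_%:E); ring.
Qed.

Lemma ge0_integral_affine (a c : R) (f : T -> \bar R) : 0 < a ->
  measurable_fun setT f -> (forall x, 0 <= f x)%E ->
  (\int[leb]_x f x = a%:E * \int[leb]_x f (a * x + c)%R)%E.
Proof.
move=> a0 mf f0.
rewrite (eq_measure_integral _ (fun A mA _ => lebesgue_measure_affine c a0 mA)).
rewrite ge0_integral_mscale//=.
by rewrite (ge0_integral_pushforward (measurable_affine a c) leb).
Qed.

Lemma integral_shift (c : R) (f : T -> \bar R) : measurable_fun setT f ->
  (\int[leb]_x f (x + c)%R = \int[leb]_x f x)%E.
Proof.
have ge0_shift (g : T -> \bar R) : measurable_fun setT g ->
    (forall x, 0 <= g x)%E -> (\int[leb]_x g (x + c)%R = \int[leb]_x g x)%E.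
  move=> mg g0; rewrite [RHS](@ge0_integral_affine 1 c)// mul1e.
  by under [RHS]eq_integral do rewrite mul1r.
move=> mf; rewrite integralE [RHS]integralE.
rewrite -(ge0_shift (f^\+)%E)//; last exact: measurable_funepos.
rewrite -(ge0_shift (f^\-)%E)//;[|exact: measurable_funeneg].
by congr (_ - _)%E; apply: eq_integral => x _; rewrite ?funeposE ?funenegE.
Qed.

Lemma integral_opp (f : T -> \bar R) : measurable_fun setT f ->
  (\int[leb]_x f (- x)%R = \int[leb]_x f x)%E.
Proof.
have mN : measurable_fun [set: T] (-%R : T -> T) by exact: oppr_measurable.
have ge0_opp (g : T -> \bar R) : measurable_fun setT g ->
    (forall x, 0 <= g x)%E -> (\int[leb]_x g (- x)%R = \int[leb]_x g x)%E.
  move=> mg g0; transitivity (\int[pushm leb mN]_x g x)%E.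
    by rewrite (ge0_integral_pushforward mN leb).
  by apply: eq_measure_integral => A mA _; exact: lebesgue_measureN.
move=> mf; rewrite integralE [RHS]integralE.
rewrite -(ge0_opp (f^\+)%E)//; last exact: measurable_funepos.
rewrite -(ge0_opp (f^\-)%E)//;[|exact: measurable_funeneg].
by congr (_ - _)%E; apply: eq_integral => x _; rewrite ?funeposE ?funenegE.
Qed.

Lemma Rintegral_shift (c : R) (f : T -> R) : measurable_fun setT f ->
  \int[leb]_x f (x + c) = \int[leb]_x f x.
Proof.
by move=> mf; rewrite /Rintegral (@integral_shift c (EFin \o f))//; exact/measurable_EFinP.
Qed.

Lemma Rintegral_opp (f : T -> R) : measurable_fun setT f ->
  \int[leb]_x f (- x) = \int[leb]_x f x.
Proof.
by move=> mf; rewrite /Rintegral (@integral_opp (EFin \o f))//; exact/measurable_EFinP.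
Qed.

Lemma cint_shift (c : R) (f : T -> R[i]) : cmeas f ->
  cint leb (fun x => f (x + c)) = cint leb f.
Proof.
move=> [f1 f2]; apply: complex_eq => /=.
  exact: (Rintegral_shift _ f1).
exact: (Rintegral_shift _ f2).
Qed.

Lemma measurable_shift (c : R) : measurable_fun [set: T] (fun x : T => x + c : T).
Proof. exact: measurable_funD. Qed.

Lemma cintble_shift (c : R) (f : T -> R[i]) : cintble leb f ->
  cintble leb (fun x => f (x + c)).
Proof.
move=> cf; have mf := cintble_meas cf.
apply: cintble_lty; first exact: (cmeas_comp mf (measurable_shift c)).
rewrite (@integral_shift c (fun x => (normc (f x))%:E)) ?normc_lty//.
exact/measurable_EFinP/measurable_normc.
Qed.

End change_of_variable.

Section poisson.
Local Open Scope complex_scope.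
Context {R : realType}.
Local Notation leb := (@lebesgue_measure R).
Local Notation T := (measurableTypeR R).

(** Abel summation factor: it makes bounded functions integrable and increases to 1 as [e] decreases
    to 0. *)
Definition abel (e x : R) : R := expR (- (e * `|x|)).

Lemma abel_continuous e : continuous (abel e).
Proof.
move=> x; apply: (@continuous_comp _ _ _ (fun x => - (e * `|x|)) expR).
  apply: continuousN; apply: continuousM; first exact: cvg_cst.
  exact: norm_continuous.
exact: continuous_expR.
Qed.

Lemma measurable_abel e : measurable_fun [set: T] (abel e).
Proof. by apply: continuous_measurable_fun; exact: abel_continuous. Qed.

Lemma abel_le1 e x : 0 <= e -> abel e x <= 1.
Proof. by move=> e0; rewrite /abel -expR0 ler_expR oppr_le0 mulr_ge0. Qed.

Lemma cvgy_expR_bounded (e M : R) (g : R -> R) : 0 < e -> (forall x, `|g x| <= M) ->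
  (fun x => expR (- (e * x)) * g x) x @[x --> +oo%R] --> 0.
Proof.
move=> e0 gM.
have E0 : expR (- (e * x)) @[x --> +oo%R] --> (0 : R).
  apply: (@cvg_comp _ _ _ (fun x => e * x) (fun x => expR (- x))); last exact: cvgr_expR.
  exact: gt0_cvgMry.
apply: norm_cvg0.
apply: (@squeeze_cvgr _ _ _ _ (cst 0) (fun x => expR (- (e * x)) * M)).
- apply: nearW => x; rewrite normr_ge0/= normrM ger0_norm ?expR_ge0//.
  by rewrite ler_wpM2l ?expR_ge0.
- exact: cvg_cst.
- by rewrite -[X in _ --> X](mul0r M); apply: cvgM; [exact: E0|exact: cvg_cst].
Qed.

(* Adding 1 to the cosine makes the integrand nonnegative. *)
Lemma integral_abel_cos1 (e b : R) : 0 < e ->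
  (\int[leb]_x (abel e x * (1 + cos (b * x)))%:E =
   (2 / e + 2 * e / (e ^+ 2 + b ^+ 2))%:E)%E.
Proof.
move=> e0.
have D0 : 0 < e ^+ 2 + b ^+ 2 by rewrite ltr_wpDr ?sqr_ge0// exprn_gt0.
pose f x := abel e x * (1 + cos (b * x)).
pose h (x : R) := expR (- (e * x)) * (1 + cos (b * x)).
have ccos : continuous (fun x : R => 1 + cos (b * x)).
  move=> x; apply: continuousD; first exact: cvg_cst.
  apply: (@continuous_comp _ _ _ (fun x => b * x) cos); last exact: continuous_cos.
  by apply: continuousM; [exact: cvg_cst|exact: cvg_id].
have cf : continuous f.
  by move=> x; apply: cvgM; [exact: abel_continuous|exact: ccos].
have ch : continuous h.
  move=> x; apply: cvgM; last exact: ccos.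
  apply: (@continuous_comp _ _ _ (fun x => - (e * x)) expR); last exact: continuous_expR.
  by apply: continuousN; apply: continuousM; [exact: cvg_cst|exact: cvg_id].
have f0 x : 0 <= f x.
  by rewrite /f mulr_ge0 ?expR_ge0// -lerBlDl sub0r cos_geN1.
rewrite (ge0_symfun_integralT f0 cf); last first.
  by move=> x; rewrite /f /= /abel normrN mulrN cosN.
rewrite -set_itvcy.
(* [g] is the bounded factor of an antiderivative [F] of [h]; boundedness makes [F] vanish at
   infinity. *)
pose g x := - e^-1 + (b * sin (b * x) - e * cos (b * x)) / (e ^+ 2 + b ^+ 2).
pose F x := expR (- (e * x)) * g x.
have dF (x : R) : is_derive x (1 : R) F (h x).
  rewrite /F /g /h; apply: is_derive_eq.
  rewrite /GRing.scale /=.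
  set E := expR _; set c := cos _; set s := sin _.
  field. by rewrite !gt_eqF.
have gM x : `|g x| <= e^-1 + (`|b| + e) / (e ^+ 2 + b ^+ 2).
  rewrite /g (le_trans (ler_normD _ _))// normrN gtr0_norm ?invr_gt0// lerD2l.
  rewrite normrM [X in _ * X]gtr0_norm ?invr_gt0// ler_pM2r ?invr_gt0//.
  rewrite (le_trans (ler_normB _ _))// !normrM (gtr0_norm e0) lerD//.
    by apply: ler_piMr => //; exact: sin_max.
  by apply: ler_piMr; [exact: ltW|exact: cos_max].
under eq_integral => x.
  rewrite inE/= in_itv/= andbT => x0.
  have -> : f x = h x by rewrite /f /h /abel ger0_norm.
  over.
rewrite (@ge0_continuous_FTC2y _ h F 0 0).
- rewrite -EFinD -EFinM; congr (_%:E).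
  rewrite /F /g !mulr0 oppr0 expR0 sin0 cos0; field.
  by rewrite !gt_eqF.
- move=> x x0; have := f0 x; rewrite /f /abel ger0_norm//.
- exact: continuous_subspaceT.
- exact: (cvgy_expR_bounded e0 gM).
- by move=> x _; apply: ex_derive.
- apply: cvg_at_right_filter; apply: differentiable_continuous.
  by apply/derivable1_diffP; apply: ex_derive.
- by move=> x _; rewrite derive1E; exact: derive_val.
Qed.

End poisson.

(** * Dominated convergence for real and complex integrands *)

Section dominated.
Local Open Scope complex_scope.
Context d (T : measurableType d) (R : realType) (mu : {measure set T -> \bar R}).

Lemma Rdominated_cvg (F_ : (T -> R)^nat) (F g : T -> R) :
  (forall n, measurable_fun setT (F_ n)) -> measurable_fun setT F ->
  {ae mu, forall x, F_ ^~ x @ \oo --> F x} ->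
  mu.-integrable setT (EFin \o g) -> (forall n x, `|F_ n x| <= g x) ->
  \int[mu]_x F_ n x @[n --> \oo] --> \int[mu]_x F x.
Proof.
move=> mF_ mF cvF ig Fg.
have m1 n : measurable_fun setT (EFin \o F_ n) by exact/measurable_EFinP.
have m2 : measurable_fun setT (EFin \o F) by exact/measurable_EFinP.
have h1 : {ae mu, forall x, setT x -> (fun n => (EFin \o F_ n) x) @ \oo --> (EFin \o F) x}.
  by apply: filterS cvF => x cvx _; apply: cvg_EFin => //; exact: nearW.
have h2 : {ae mu, forall x n, setT x -> (`|(EFin \o F_ n) x| <= (EFin \o g) x)%E}.
  by apply: aeW => x n _ /=; rewrite lee_fin.
have [iF _ cvI] := dominated_convergence measurableT m1 m2 h1 ig h2.
apply: fine_cvg; rewrite fineK//; exact: integrable_fin_num iF.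
Qed.

Definition ccvg (u : nat -> R[i]) (l : R[i]) :=
  (fun n => Re (u n)) @ \oo --> Re l /\ (fun n => Im (u n)) @ \oo --> Im l.

Lemma cdominated_cvg (F_ : nat -> T -> R[i]) (F : T -> R[i]) (g : T -> R) :
  (forall n, cmeas (F_ n)) -> cmeas F ->
  {ae mu, forall x, ccvg (F_ ^~ x) (F x)} ->
  mu.-integrable setT (EFin \o g) -> (forall n x, normc (F_ n x) <= g x) ->
  ccvg (fun n => cint mu (F_ n)) (cint mu F).
Proof.
move=> mF_ [mF1 mF2] cvF ig Fg; split => /=.
  apply: (Rdominated_cvg _ mF1 _ ig) => [n||n x].
  - by have [] := mF_ n.
  - by apply: filterS cvF => x [].
  - by rewrite (le_trans (Re_le_normc _)).
apply: (Rdominated_cvg _ mF2 _ ig) => [n||n x].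
- by have [] := mF_ n.
- by apply: filterS cvF => x [].
- by rewrite (le_trans (Im_le_normc _)).
Qed.

Lemma ccvg_cst (c : R[i]) : ccvg (fun=> c) c.
Proof. by split; exact: cvg_cst. Qed.

Lemma ccvgM (u v : nat -> R[i]) (l m : R[i]) :
  ccvg u l -> ccvg v m -> ccvg (fun n => u n * v n) (l * m).
Proof.
move=> [u1 u2] [v1 v2]; split.
  under eq_fun do rewrite RecM; rewrite RecM; apply: cvgB; exact: cvgM.
under eq_fun do rewrite ImcM; rewrite ImcM; apply: cvgD; exact: cvgM.
Qed.

Lemma ccvg_unique (u : nat -> R[i]) (l m : R[i]) : ccvg u l -> ccvg u m -> l = m.
Proof.
move=> [u1 u2] [v1 v2]; apply: complex_eq.
  exact: (cvg_unique _ u1 v1).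
exact: (cvg_unique _ u2 v2).
Qed.

End dominated.

(** * The Poisson kernel as an approximate identity *)

Section poisson_kernel.
Local Open Scope complex_scope.
Context {R : realType}.
Local Notation leb := (@lebesgue_measure R).
Local Notation T := (measurableTypeR R).

Lemma Rintegral_affine (a c : R) (f : T -> R) : 0 < a ->
  leb.-integrable setT (EFin \o f) ->
  \int[leb]_x f x = a * \int[leb]_x f (a * x + c).
Proof.
move=> a0 jf; rewrite /Rintegral.
rewrite [X in fine X](integralE leb setT (EFin \o f)).
rewrite [X in _ * fine X](integralE leb setT (fun x : T => (f (a * x + c))%:E)).
have mf := measurable_int _ jf.
have pE : (\int[leb]_x ((fun x : T => (f (a * x + c)%R)%:E)^\+ x) =
    \int[leb]_x ((EFin \o f)^\+ (a * x + c)%R))%E.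
  by apply: eq_integral => x _; rewrite !funeposE.
have nE : (\int[leb]_x ((fun x : T => (f (a * x + c)%R)%:E)^\- x) =
    \int[leb]_x ((EFin \o f)^\- (a * x + c)%R))%E.
  by apply: eq_integral => x _; rewrite !funenegE.
have fp : (\int[leb]_x ((EFin \o f)^\+ x))%E \is a fin_num.
  by apply: integrable_fin_num => //; exact: integrable_funepos.
have fn : (\int[leb]_x ((EFin \o f)^\- x))%E \is a fin_num.
  by apply: integrable_fin_num => //; exact: integrable_funeneg.
rewrite pE nE; move: fp fn.
rewrite (@ge0_integral_affine _ a c ((EFin \o f)^\+)%E)//; last exact: measurable_funepos.
rewrite (@ge0_integral_affine _ a c ((EFin \o f)^\-)%E)//; last exact: measurable_funeneg.
case: (integral _ _ _) => [p| |]; last 2 first.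
  by rewrite gt0_muley ?lte_fin.
  by rewrite gt0_muleNy ?lte_fin.
case: (integral _ _ _) => [q| |] /=; last 2 first.
  by rewrite gt0_muley ?lte_fin.
  by rewrite gt0_muleNy ?lte_fin.
by move=> _ _; rewrite mulrBr.
Qed.

Lemma integral_abel (e : R) : 0 < e -> (\int[leb]_x (abel e x)%:E = (2 / e)%:E)%E.
Proof.
move=> e0; have := integral_abel_cos1 0 e0.
under eq_integral do rewrite mul0r cos0 mulrC EFinM.
rewrite ge0_integralZl//; last 2 first.
- by apply/measurable_EFinP; exact: measurable_abel.
- by move=> x _; rewrite lee_fin expR_ge0.
have -> : 2 / e + 2 * e / (e ^+ 2 + 0 ^+ 2) = (1 + 1) * (2 / e).
  by field; rewrite gt_eqF.
rewrite EFinM => /(congr1 (fun x => ((1 + 1)^-1%:E * x)%E)).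
by rewrite !muleA -EFinM mulVf ?mul1e.
Qed.

Lemma integrable_abel (e : R) : 0 < e -> leb.-integrable setT (EFin \o abel e).
Proof.
move=> e0; apply/integrableP; split.
  by apply/measurable_EFinP; exact: measurable_abel.
under eq_integral do rewrite /= ger0_norm ?expR_ge0//.
by rewrite integral_abel// ltry.
Qed.

Lemma cintble_abel (e : R) (f : T -> R[i]) (M : R) : 0 < e -> cmeas f ->
  (forall x, normc (f x) <= M) -> cintble leb (fun x => (abel e x)%:C * f x).
Proof.
move=> e0 mf fM; apply: (@cintble_le _ T _ leb _ (fun x => M * abel e x)).
- by apply: cmeasM => //; apply: cmeas_real; exact: measurable_abel.
- exact: (integrableZl _ M (integrable_abel e0)).
- move=> x; rewrite normcM normc_real ger0_norm ?expR_ge0// mulrC.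
  by rewrite ler_wpM2r ?expR_ge0.
Qed.

Lemma cmeas_cexpiM (c : R) : cmeas (fun x : T => cexpi (c * x)).
Proof. by apply: cmeas_cexpi; exact: mulrl_measurable. Qed.

Lemma cint_abel (e t : R) : 0 < e ->
  cint leb (fun x => (abel e x)%:C * cexpi (t * x)) = (2 * e / (e ^+ 2 + t ^+ 2))%:C.
Proof.
move=> e0.
have [c1 c2] : cintble leb (fun x => (abel e x)%:C * cexpi (t * x)).
  by apply: (cintble_abel (M := 1) e0 (cmeas_cexpiM t)) => x; rewrite normc_cexpi.
have ReE x : Re ((abel e x)%:C * cexpi (t * x)) = abel e x * cos (t * x).
  by rewrite RecM/= mul0r subr0.
have ImE x : Im ((abel e x)%:C * cexpi (t * x)) = abel e x * sin (t * x).
  by rewrite ImcM/= mul0r addr0.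
have j1 : leb.-integrable setT (EFin \o (fun x : T => abel e x * cos (t * x))).
  by apply: eq_integrable c1 => // x _; exact: (congr1 EFin (ReE x)).
have j2 : leb.-integrable setT (EFin \o (fun x : T => abel e x * sin (t * x))).
  by apply: eq_integrable c2 => // x _; exact: (congr1 EFin (ImE x)).
have E1 : Re (cint leb (fun x => (abel e x)%:C * cexpi (t * x))) =
    \int[leb]_x (abel e x * cos (t * x)).
  by apply: eq_Rintegral => x _; exact: ReE.
have E2 : Im (cint leb (fun x => (abel e x)%:C * cexpi (t * x))) =
    \int[leb]_x (abel e x * sin (t * x)).
  by apply: eq_Rintegral => x _; exact: ImE.
apply: complex_eq; rewrite ?E1 ?E2 /=.
  have : \int[leb]_x (abel e x + abel e x * cos (t * x)) =
      2 / e + 2 * e / (e ^+ 2 + t ^+ 2).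
    rewrite /Rintegral; under eq_integral do rewrite -[X in X + _]mulr1 -mulrDr.
    by rewrite integral_abel_cos1.
  rewrite RintegralD//; last exact: integrable_abel.
  by rewrite [X in X + _ = _]/Rintegral integral_abel//= => /addrI.
(* The imaginary part integrates an odd function, so it equals its own opposite. *)
set I := \int[leb]_x _.
suff : I = - I by move=> h; lra.
have mI : measurable_fun setT (fun x : T => abel e x * sin (t * x)).
  by apply/measurable_EFinP; exact: measurable_int j2.
rewrite {1}/I -(Rintegral_opp mI) -mulN1r -RintegralZl//.
by apply: eq_Rintegral => x _; rewrite /abel normrN mulrN sinN mulrN mulN1r.
Qed.

(* Poisson kernel, the Fourier transform of [expR (- e |x|)]. *)
Definition pk (e x : R) : R := 2 * e / (e ^+ 2 + (2 * pi * x) ^+ 2).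

Lemma pk_den (e x : R) : 0 < e -> 0 < e ^+ 2 + (2 * pi * x) ^+ 2.
Proof. by move=> e0; rewrite ltr_wpDr ?sqr_ge0// exprn_gt0. Qed.

Lemma pk_ge0 (e x : R) : 0 < e -> 0 <= pk e x.
Proof. by move=> e0; rewrite divr_ge0 ?mulr_ge0 ?ltW// pk_den. Qed.

Lemma pk_le (e x : R) : 0 < e -> pk e x <= 2 / e.
Proof.
move=> e0; rewrite /pk ler_pdivrMr ?pk_den//.
rewrite (_ : 2 / e * _ = 2 * e + 2 / e * (2 * pi * x) ^+ 2); last first.
  by field; rewrite gt_eqF.
by rewrite lerDl mulr_ge0 ?sqr_ge0// divr_ge0// ltW.
Qed.

Lemma pkN (e x : R) : pk e (- x) = pk e x.
Proof. by rewrite /pk mulrN sqrrN. Qed.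

Lemma measurable_pk (e : R) : measurable_fun [set: T] (pk e).
Proof.
have [e0|e0] := eqVneq e 0.
  by rewrite (_ : pk e = cst 0)//; apply/funext => x; rewrite /pk e0 mulr0 mul0r.
apply: continuous_measurable_fun => x; apply: cvgM; first exact: cvg_cst.
apply: cvgV.
  by rewrite gt_eqF// ltr_wpDr ?sqr_ge0// lt_neqAle sqr_ge0 andbT eq_sym expf_neq0.
apply: cvgD; first exact: cvg_cst.
rewrite expr2; under eq_fun do rewrite expr2.
by apply: cvgM; apply: cvgM; (try exact: cvg_cst); exact: cvg_id.
Qed.

Lemma cint_abel_pk (e x : R) : 0 < e ->
  cint leb (fun xi => (abel e xi)%:C * cexpi (2 * pi * x * xi)) = (pk e x)%:C.
Proof. by move=> e0; rewrite cint_abel. Qed.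

(* The Poisson kernel is the dilation by [e / (2 pi)] of the Cauchy density. *)
Definition cauchy (x : R) : R := pi^-1 / oneDsqr x.

Lemma pk_dilation (e x : R) : 0 < e -> e / (2 * pi) * pk e (e / (2 * pi) * x) = cauchy x.
Proof.
move=> e0; rewrite /pk /cauchy /oneDsqr.
have p0 : pi != 0 :> R by rewrite gt_eqF// pi_gt0.
move: (pi : R) p0 => p p0.
have x0 : 1 + x ^+ 2 != 0 by rewrite gt_eqF// ltr_wpDr ?sqr_ge0.
have e2 : e ^+ 2 + (2 * p * (e / (2 * p) * x)) ^+ 2 = e ^+ 2 * (1 + x ^+ 2).
  by field; rewrite p0.
by rewrite e2; field; rewrite x0 p0 gt_eqF.
Qed.

Lemma integral_cauchy : (\int[leb]_x (cauchy x)%:E = 1)%E.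
Proof.
have p0 : 0 < (pi : R) by exact: pi_gt0.
rewrite ge0_symfun_integralT.
- rewrite -set_itvcy /cauchy; under eq_integral do rewrite EFinM.
  rewrite ge0_integralZl//.
  + rewrite integral0y_oneDsqr -!EFinM; congr (_%:E).
    by move: (pi : R) p0 => p p0; field; rewrite gt_eqF.
  + apply/measurable_EFinP; apply: measurable_funTS.
    apply: continuous_measurable_fun; exact: continuous_oneDsqrV.
  + by rewrite lee_fin invr_ge0 ltW.
- by move=> x; rewrite divr_ge0 ?invr_ge0 ?ltW.
- by move=> x; apply: cvgM; [exact: cvg_cst|exact: continuous_oneDsqrV].
- by move=> x; rewrite /cauchy /oneDsqr/= sqrrN.
Qed.

Lemma cauchy_ge0 (x : R) : 0 <= cauchy x.
Proof. by rewrite divr_ge0 ?invr_ge0 ?ltW ?pi_gt0. Qed.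

Lemma measurable_cauchy : measurable_fun [set: T] cauchy.
Proof.
apply: continuous_measurable_fun => x; apply: cvgM; first exact: cvg_cst.
exact: continuous_oneDsqrV.
Qed.

Lemma integrable_cauchy : leb.-integrable setT (EFin \o cauchy).
Proof.
apply/integrableP; split; first by apply/measurable_EFinP; exact: measurable_cauchy.
under eq_integral do rewrite /= ger0_norm ?cauchy_ge0//.
by rewrite integral_cauchy ltry.
Qed.

Lemma integral_pk (e : R) : 0 < e -> (\int[leb]_x (pk e x)%:E = 1)%E.
Proof.
move=> e0; have a0 : 0 < e / (2 * pi) by rewrite divr_gt0// mulr_gt0// pi_gt0.
rewrite (@ge0_integral_affine _ _ 0 _ a0)//.
- rewrite -ge0_integralZl//.
  + under eq_integral do rewrite addr0 -EFinM pk_dilation//.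
    exact: integral_cauchy.
  + apply/measurable_EFinP.
    exact: (measurableT_comp (measurable_pk e) (measurable_affine _ 0)).
  + by move=> x _; rewrite lee_fin pk_ge0.
  + by rewrite lee_fin ltW.
- by apply/measurable_EFinP; exact: measurable_pk.
- by move=> x; rewrite lee_fin pk_ge0.
Qed.

Lemma integral_pk_shift (e x : R) : 0 < e -> (\int[leb]_y (pk e (y - x))%:E = 1)%E.
Proof.
move=> e0; rewrite (@integral_shift _ (- x) (EFin \o pk e)) ?integral_pk//.
by apply/measurable_EFinP; exact: measurable_pk.
Qed.

Lemma integral_pk_shiftr (e x : R) : 0 < e -> (\int[leb]_y (pk e (x - y))%:E = 1)%E.
Proof.
move=> e0; rewrite -(integral_pk_shift x e0); apply: eq_integral => y _.
by rewrite -pkN opprB.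
Qed.

Lemma integrable_pk_shiftr (e x : R) : 0 < e ->
  leb.-integrable setT (EFin \o (fun y => pk e (x - y))).
Proof.
move=> e0; apply/integrableP; split.
  apply/measurable_EFinP.
  by apply: (measurableT_comp (measurable_pk e)); exact: measurable_funB.
under eq_integral do rewrite /= ger0_norm ?pk_ge0//.
by rewrite integral_pk_shiftr// ltry.
Qed.

Lemma integrableM_bd (f g : T -> R) (M : R) : measurable_fun setT f ->
  (forall y, `|f y| <= M) -> leb.-integrable setT (EFin \o g) ->
  leb.-integrable setT (EFin \o (fun y => f y * g y)).
Proof.
move=> mf fM ig; have := integrableZl measurableT M (integrable_norm ig).
apply: le_integrable => //.
  by apply/measurable_EFinP/measurable_funM => //; apply/measurable_EFinP;
    exact: measurable_int ig.
move=> y _ /=; rewrite lee_fin normrM (le_trans _ (ler_norm _))//.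
by rewrite ler_wpM2r.
Qed.

Definition eps (n : nat) : R := n.+1%:R^-1.

Lemma eps_gt0 n : 0 < eps n. Proof. by rewrite invr_gt0. Qed.

Lemma cvg_eps : eps @ \oo --> (0 : R).
Proof. exact: cvg_harmonic. Qed.

(** The substitution [y = a n * z + x] turns the moving kernel into the fixed Cauchy density;
    dominated convergence then applies with the bound [M * cauchy]. *)
Lemma approx_identity (f : T -> R) (M x : R) : measurable_fun setT f ->
  (forall y, `|f y| <= M) -> {for x, continuous (f : R -> R)} ->
  (fun n => \int[leb]_y (f y * pk (eps n) (x - y))) @ \oo --> f x.
Proof.
move=> mf fM cfx.
pose a n : R := eps n / (2 * pi).
have a0 n : 0 < a n by rewrite divr_gt0 ?eps_gt0// mulr_gt0// pi_gt0.
have -> : (fun n => \int[leb]_y (f y * pk (eps n) (x - y))) =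
    (fun n => \int[leb]_z (f (a n * z + x) * cauchy z)).
  apply/funext => n; rewrite (@Rintegral_affine (a n) x)//.
    rewrite -RintegralZl//.
      apply: eq_Rintegral => z _; rewrite mulrCA opprD addrCA subrr addr0 pkN.
      by rewrite pk_dilation ?eps_gt0.
    have -> : (fun z => f (a n * z + x) * pk (eps n) (x - (a n * z + x))) =
        (fun z => f (a n * z + x) * ((a n)^-1 * cauchy z)).
      apply/funext => z; congr (_ * _).
      rewrite -(pk_dilation z (eps_gt0 n)) mulrA mulVf ?mul1r ?gt_eqF//.
      by rewrite opprD addrCA subrr addr0 pkN.
    apply: (@integrableM_bd _ _ M) => //.
      exact: (measurableT_comp mf (measurable_affine _ x)).
    exact: (integrableZl _ _ integrable_cauchy).
  by apply: (@integrableM_bd _ _ M) => //; exact/integrable_pk_shiftr/eps_gt0.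
have -> : f x = \int[leb]_z (f x * cauchy z).
  rewrite RintegralZl//; last exact: integrable_cauchy.
  by rewrite /Rintegral integral_cauchy/= mulr1.
apply: (@Rdominated_cvg _ T _ leb _ _ (fun z => M * cauchy z)).
- move=> n; apply: measurable_funM; last exact: measurable_cauchy.
  exact: (measurableT_comp mf (measurable_affine _ x)).
- by apply: measurable_funM => //; exact: measurable_cauchy.
- apply: aeW => z; apply: cvgM; last exact: cvg_cst.
  have : (fun n => a n * z + x) @ \oo --> 0 * (2 * pi)^-1 * z + x.
    apply: cvgD; last exact: cvg_cst.
    apply: cvgM; last exact: cvg_cst.
    by apply: cvgM; [exact: cvg_eps|exact: cvg_cst].
  rewrite !mul0r add0r => h; exact: (cvg_comp _ _ h cfx).
- exact: (integrableZl _ M integrable_cauchy).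
- by move=> n z; rewrite normrM (ger0_norm (cauchy_ge0 z)) ler_wpM2r ?cauchy_ge0.
Qed.

End poisson_kernel.

(** * Fourier transform and Plancherel *)

Lemma cint_ae d (T : measurableType d) (R : realType)
    (mu : {measure set T -> \bar R}) (f g : T -> R[i]) : cmeas f -> cmeas g ->
  {ae mu, forall x, f x = g x} -> cint mu f = cint mu g.
Proof.
move=> [m1 m2] [m3 m4] fg; apply: complex_eq => /=; congr fine;
  apply: ae_eq_integral => //; (try exact/measurable_EFinP).
  by apply: filterS fg => x -> _.
by apply: filterS fg => x -> _.
Qed.

Section sqint.
Context d (X : measurableType d) (R : realType).
Implicit Types f : X -> R[i].

Definition sqint (mu : {measure set X -> \bar R}) f : \bar R :=
  (\int[mu]_x (normc (f x) ^+ 2)%:E)%E.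

Lemma measurable_sq f : cmeas f ->
  measurable_fun setT (fun x => (normc (f x) ^+ 2)%:E).
Proof. by move=> mf; apply/measurable_EFinP/measurable_funX/measurable_normc. Qed.

Lemma sqint_ge0 (mu : {measure set X -> \bar R}) f : (0 <= sqint mu f)%E.
Proof. by apply: integral_ge0 => x _; rewrite lee_fin sqr_ge0. Qed.

End sqint.

Section fourier_transform.
Local Open Scope complex_scope.
Context {R : realType}.
Local Notation leb := (@lebesgue_measure R).
Local Notation T := (measurableTypeR R).
Implicit Types (u : T -> R[i]) (e x xi : R).

Definition fhat u xi : R[i] := cint leb (fun x => u x * cexpi (- (2 * pi * x * xi))).

Lemma cmeas_phase (xi : R) : cmeas (fun x : T => cexpi (- (2 * pi * x * xi))).
Proof.
apply: cmeas_cexpi; apply: measurable_funN; exact: measurable_funM.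
Qed.

Lemma cmeas_phase2 (c : R) :
  cmeas (fun z : T * T => cexpi (c * z.1 * z.2)).
Proof.
apply: cmeas_cexpi; apply: measurable_funM => //.
by apply: (measurableT_comp (mulrl_measurable _) measurable_fst).
Qed.

Lemma cmeas_phase2' : cmeas (fun z : T * T => cexpi (- (2 * pi * z.2 * z.1))).
Proof.
apply: cmeas_cexpi; apply: measurable_funN; apply: measurable_funM => //.
by apply: (measurableT_comp (mulrl_measurable _) measurable_snd).
Qed.

Lemma cintble_fhat u xi : cintble leb u ->
  cintble leb (fun x => u x * cexpi (- (2 * pi * x * xi))).
Proof.
by move=> iu; apply: (cintbleM_bd (M := 1) iu (cmeas_phase xi)) => x; rewrite normc_cexpi.
Qed.

Lemma normc_fhat u xi : cintble leb u ->
  normc (fhat u xi) <= \int[leb]_x normc (u x).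
Proof.
move=> iu; rewrite (le_trans (normc_cint (cintble_fhat xi iu)))//.
by rewrite le_eqVlt; apply/orP; left; apply/eqP; apply: eq_Rintegral => x _;
  rewrite normcM normc_cexpi mulr1.
Qed.

Lemma fhat_ae u v xi : cmeas u -> cmeas v -> {ae leb, forall x, u x = v x} ->
  fhat u xi = fhat v xi.
Proof.
move=> mu mv uv; apply: cint_ae; [exact: cmeasM (cmeas_phase _)..|].
by move: uv; apply: filterS; [exact: (ae_filter_ringOfSetsType leb)|move=> x ->].
Qed.

Let fub e x u (z : T * T) := (abel e z.1)%:C * (u z.2 * cexpi (- (2 * pi * z.2 * z.1)))
   * cexpi (2 * pi * x * z.1).

Let cintble_fub e x u : 0 < e -> cintble leb u -> cintble (leb \x leb)%E (fub e x u).
Proof.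
move=> e0 iu.
apply: (@cintble_prod_le _ _ T T R leb leb _ (abel e) (fun y => normc (u y))).
- apply: cmeasM; [apply: cmeasM; [|apply: cmeasM]|].
  + by apply: cmeas_real; apply: (measurableT_comp (measurable_abel e) measurable_fst).
  + exact: (cmeas_comp (cintble_meas iu) measurable_snd).
  + exact: cmeas_phase2'.
  + exact: (cmeas_comp (cmeas_cexpiM (2 * pi * x)) measurable_fst).
- exact: integrable_abel.
- exact: cintble_normc.
- move=> xi y; rewrite /fub/= !normcM !normc_cexpi !mulr1 normc_real.
  by rewrite ger0_norm// expR_ge0.
Qed.

(** Measurability comes from Fubini, which wants a jointly integrable function: the transform is
    damped by [abel 1] first, and the factor is undone by [expR |x|]. *)
Lemma cmeas_fhat u : cintble leb u -> cmeas (fhat u).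
Proof.
move=> iu; have := cmeas_cint1 (cintble_fub 0 (@ltr01 R) iu).
have -> : (fun x => cint leb (fun y => fub 1 0 u (x, y))) =
    (fun x => (abel 1 x)%:C * fhat u x).
  apply/funext => x; rewrite /fub/=; under eq_cint do rewrite mulr0 mul0r cexpi0 mulr1.
  by rewrite cintZ//; exact: cintble_fhat.
move=> h.
have -> : fhat u = fun x => (expR (`|x|))%:C * ((abel 1 x)%:C * fhat u x).
  apply/funext => x; rewrite mulrA -rmorphM/= /abel mul1r.
  by rewrite -expRD subrr expR0 mul1r.
apply: cmeasM h; apply: cmeas_real.
apply: (measurableT_comp (@measurable_expR R)); exact: normr_measurable.
Qed.

Lemma cintble_abel_fhat e x u : 0 < e -> cintble leb u ->
  cintble leb (fun xi => (abel e xi)%:C * fhat u xi * cexpi (2 * pi * x * xi)).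
Proof.
move=> e0 iu.
apply: (cintbleM_bd (M := 1) _ (cmeas_cexpiM _)) => [|y]; last by rewrite normc_cexpi.
exact: (cintble_abel e0 (cmeas_fhat iu) (fun xi => normc_fhat xi iu)).
Qed.

(** Convolving [u] with the Poisson kernel is Abel summation of its inversion integral: Fubini, with
    the kernel as the inner integral. Both Plancherel and inversion come from letting [e] tend to 0
    here. *)
Lemma poisson_fhat e x u : 0 < e -> cintble leb u ->
  cint leb (fun y => u y * (pk e (x - y))%:C) =
  cint leb (fun xi => (abel e xi)%:C * fhat u xi * cexpi (2 * pi * x * xi)).
Proof.
move=> e0 iu; have := cint_swap (cintble_fub x e0 iu).
rewrite /fub/=.
have -> : (fun xi => cint leb (fun y => (abel e xi)%:C * (u y * cexpi (- (2 * pi * y * xi))) * cexpi (2 * pi * x * xi))) =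
   (fun xi => (abel e xi)%:C * fhat u xi * cexpi (2 * pi * x * xi)).
  apply/funext => xi; rewrite cintZr; last by apply: cintbleZ; exact: cintble_fhat.
  by rewrite cintZ//; exact: cintble_fhat.
move=> ->; apply: eq_cint => y.
have -> : (fun xi => (abel e xi)%:C * (u y * cexpi (- (2 * pi * y * xi))) * cexpi (2 * pi * x * xi)) =
   (fun xi => u y * ((abel e xi)%:C * cexpi (2 * pi * (x - y) * xi))).
  apply/funext => xi; have -> : 2 * pi * (x - y) * xi = - (2 * pi * y * xi) + 2 * pi * x * xi by ring.
  by rewrite cexpiD; ring.
rewrite cintZ ?cint_abel_pk//.
by apply: (cintble_abel (M := 1) e0 (cmeas_cexpiM _)) => xi; rewrite normc_cexpi.
Qed.

Lemma cintble_poisson e x u : 0 < e -> cintble leb u ->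
  cintble leb (fun y => u y * (pk e (x - y))%:C).
Proof.
move=> e0 iu; apply: (cintbleM_bd (M := 2 / e) iu) => [|y].
  apply: cmeas_real.
  by apply: (measurableT_comp (measurable_pk e)); exact: measurable_funB.
by rewrite normc_real ger0_norm ?pk_ge0// pk_le.
Qed.

Let fub2 e u (z : T * T) := conjc (u z.1) * ((abel e z.2)%:C * fhat u z.2 * cexpi (2 * pi * z.1 * z.2)).

Let cintble_fub2 e u : 0 < e -> cintble leb u -> cintble (leb \x leb)%E (fub2 e u).
Proof.
move=> e0 iu; pose M := \int[leb]_x normc (u x).
apply: (@cintble_prod_le _ _ T T R leb leb _ (fun y => normc (u y)) (fun x => M * abel e x)).
- apply: cmeasM; [apply: cmeasJ|apply: cmeasM; [apply: cmeasM|]].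
  + exact: (cmeas_comp (cintble_meas iu) measurable_fst).
  + by apply: cmeas_real; apply: (measurableT_comp (measurable_abel e) measurable_snd).
  + exact: (cmeas_comp (cmeas_fhat iu) measurable_snd).
  + exact: cmeas_phase2.
- exact: cintble_normc.
- exact: (integrableZl _ M (integrable_abel e0)).
- move=> y xi; rewrite /fub2/= !normcM normcJ !normc_cexpi !mulr1 normc_real.
  rewrite ger0_norm ?expR_ge0// ler_wpM2l ?normc_ge0// mulrC ler_wpM2r ?expR_ge0//.
  exact: normc_fhat.
Qed.

(** Damped Plancherel identity: one of the two factors of [normc (fhat u xi) ^+ 2] is expanded as an
    integral, and the damping allows the exchange. *)
Lemma plancherel_poisson e u : 0 < e -> cintble leb u ->
  cint leb (fun xi => ((abel e xi) * normc (fhat u xi) ^+ 2)%:C) =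
  cint leb (fun x => conjc (u x) * cint leb (fun y => u y * (pk e (x - y))%:C)).
Proof.
move=> e0 iu; under [RHS]eq_cint do rewrite poisson_fhat//.
transitivity (cint leb (fun x => cint leb (fun xi => fub2 e u (x, xi)))); last first.
  by apply: eq_cint => x; rewrite /fub2/= cintZ//; exact: cintble_abel_fhat.
rewrite cint_swap; last exact: cintble_fub2.
apply: eq_cint => xi; rewrite /fub2/=.
have -> : (fun x => conjc (u x) * ((abel e xi)%:C * fhat u xi * cexpi (2 * pi * x * xi))) =
   (fun x => ((abel e xi)%:C * fhat u xi) * conjc (u x * cexpi (- (2 * pi * x * xi)))).
  apply/funext => x; rewrite conjcM -cexpiN opprK; ring.
rewrite cintZ; last by apply: cintbleJ; exact: cintble_fhat.
rewrite cintJ; last exact: cintble_fhat.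
by rewrite -mulrA mulcJ -rmorphM.
Qed.

Definition abelsq e u : \bar R := (\int[leb]_xi (abel e xi * normc (fhat u xi) ^+ 2)%:E)%E.

Lemma measurable_abelsq e u : cintble leb u ->
  measurable_fun [set: T] (fun xi => (abel e xi * normc (fhat u xi) ^+ 2)%:E).
Proof.
move=> iu; apply/measurable_EFinP; apply: measurable_funM; first exact: measurable_abel.
by apply/measurable_funX/measurable_normc; exact: cmeas_fhat.
Qed.

(** The damped energy is finite because [fhat u] is bounded by the L1 norm of [u] and [abel e] is
    integrable. *)
Lemma abelsqE e u : 0 < e -> cintble leb u ->
  abelsq e u = (Re (cint leb (fun x => conjc (u x) * cint leb (fun y => u y * (pk e (x - y))%:C))))%:E.
Proof.
move=> e0 iu; rewrite -plancherel_poisson//= /Rintegral fineK// /abelsq.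
rewrite ge0_fin_numE; last first.
  by apply: integral_ge0 => x _; rewrite lee_fin mulr_ge0 ?sqr_ge0 ?expR_ge0.
pose M := (\int[leb]_x normc (u x)) ^+ 2.
apply: (@le_lt_trans _ _ (\int[leb]_x (M * abel e x)%:E)%E).
  apply: ge0_le_integral => //.
  - by move=> x _; rewrite lee_fin mulr_ge0 ?sqr_ge0 ?expR_ge0.
  - exact: measurable_abelsq.
  - by apply/measurable_EFinP/measurable_funM => //; exact: measurable_abel.
  - move=> x _; rewrite lee_fin mulrC ler_wpM2r ?expR_ge0//.
    rewrite ler_pXn2r ?nnegrE ?normc_ge0 ?normc_fhat//.
    by apply: Rintegral_ge0 => y _; exact: normc_ge0.
under eq_integral do rewrite EFinM.
rewrite ge0_integralZl//.
- by rewrite integral_abel// -EFinM ltry.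
- by apply/measurable_EFinP; exact: measurable_abel.
- by move=> x _; rewrite lee_fin expR_ge0.
- by rewrite lee_fin sqr_ge0.
Qed.

(** Schur's test: [|u x| |u y|] is at most the mean of the two squares, and the kernel has mass 1 in
    each variable. The right-hand side may be [+oo], hence Tonelli throughout. *)
Lemma abelsq_le e u : 0 < e -> cintble leb u -> (abelsq e u <= sqint leb u)%E.
Proof.
move=> e0 iu; rewrite abelsqE//.
pose P x := cint leb (fun y => u y * (pk e (x - y))%:C).
have mu := cintble_meas iu.
pose G (z : T * T) := (2^-1 * (normc (u z.1) ^+ 2 + normc (u z.2) ^+ 2) * pk e (z.1 - z.2))%:E.
have pp a x : 0 <= a -> 0 <= a * pk e x.
  by move=> a0; apply: mulr_ge0 => //; exact: pk_ge0.
have mG1 : measurable_fun setT (fun z : T * T => normc (u z.1)).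
  by apply: measurable_normc; exact: (cmeas_comp mu measurable_fst).
have mG2 : measurable_fun setT (fun z : T * T => normc (u z.2)).
  by apply: measurable_normc; exact: (cmeas_comp mu measurable_snd).
have mpk : measurable_fun setT (fun z : T * T => pk e (z.1 - z.2)).
  by apply: (measurableT_comp (measurable_pk e)); exact: measurable_funB.
have ifub := cintble_cint1 (cintble_fub2 e0 iu).
have iP : cintble leb (fun x => conjc (u x) * P x).
  have -> : (fun x => conjc (u x) * P x) = (fun x => cint leb (fun xi => fub2 e u (x, xi))).
    apply/funext => x; rewrite /P poisson_fhat// /fub2/= cintZ//.
    exact: cintble_abel_fhat.
  exact: ifub.
apply: (@le_trans _ _ (\int[leb]_x (normc (conjc (u x) * P x))%:E)%E).
  rewrite -[leRHS]fineK; last first.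
    rewrite ge0_fin_numE; first exact: normc_lty.
    by apply: integral_ge0 => x _; rewrite lee_fin normc_ge0.
  rewrite lee_fin (le_trans (ler_norm _))// (le_trans (Re_le_normc _))//.
  exact: normc_cint.
apply: (@le_trans _ _ (\int[leb]_x \int[leb]_y (normc (u x) * normc (u y) * pk e (x - y))%:E)%E).
  apply: ge0_le_integral => //.
  - by move=> x _; rewrite lee_fin normc_ge0.
  - by apply/measurable_EFinP; apply: measurable_normc; exact: cintble_meas iP.
  - apply: (measurable_fun_fubini_tonelli_F (fun z : T * T => (normc (u z.1) * normc (u z.2) * pk e (z.1 - z.2))%:E)).
      by apply/measurable_EFinP; apply: measurable_funM => //; apply: measurable_funM.
    by move=> z; rewrite lee_fin pp// mulr_ge0 ?normc_ge0.
  - move=> x _; rewrite normcM normcJ.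
    under eq_integral do rewrite -mulrA EFinM.
    rewrite ge0_integralZl//; last 3 first.
    + apply/measurable_EFinP/measurable_funM; first exact: measurable_normc.
      by apply: (measurableT_comp (measurable_pk e)); exact: measurable_funB.
    + by move=> y _; rewrite lee_fin mulr_ge0 ?normc_ge0 ?pk_ge0//.
    + by rewrite lee_fin normc_ge0.
    rewrite EFinM lee_wpmul2l ?lee_fin ?normc_ge0//.
    have iux := cintble_poisson x e0 iu.
    have E : (\int[leb]_y (normc (u y) * pk e (x - y))%:E =
        \int[leb]_y (normc (u y * (pk e (x - y))%:C))%:E)%E.
      by apply: eq_integral => y _; rewrite normcM normc_real (ger0_norm (pk_ge0 _ e0)).
    rewrite E -[leRHS]fineK; last first.
      rewrite ge0_fin_numE; first exact: normc_lty.
      by apply: integral_ge0 => y _; rewrite lee_fin normc_ge0.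
    by rewrite lee_fin; exact: normc_cint.
apply: (@le_trans _ _ (\int[leb]_x \int[leb]_y G (x, y))%E).
  have m1 : measurable_fun setT (fun z : T * T => (normc (u z.1) * normc (u z.2) * pk e (z.1 - z.2))%:E).
    by apply/measurable_EFinP; apply: measurable_funM => //; apply: measurable_funM.
  have m2 : measurable_fun setT G.
    apply/measurable_EFinP/measurable_funM => //; apply: measurable_funM => //.
    by apply: measurable_funD; exact: measurable_funX.
  have h z : (0 <= (normc (u z.1) * normc (u z.2) * pk e (z.1 - z.2))%:E)%E.
    by rewrite lee_fin pp// mulr_ge0 ?normc_ge0.
  have hG z : (0 <= G z)%E.
    by rewrite lee_fin pp// mulr_ge0// addr_ge0 ?sqr_ge0.
  rewrite -(fubini_tonelli1 (fun z : T * T => (normc (u z.1) * normc (u z.2) * pk e (z.1 - z.2))%:E))//.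
  rewrite -(fubini_tonelli1 G)//; apply: ge0_le_integral => //.
  move=> z _; rewrite lee_fin ler_wpM2r ?pk_ge0//.
  rewrite -subr_ge0 (_ : _ - _ = 2^-1 * (normc (u z.1) - normc (u z.2)) ^+ 2); last by field.
  by rewrite mulr_ge0 ?sqr_ge0.
have mS1 : measurable_fun setT (fun z : T * T => (2^-1 * normc (u z.1) ^+ 2 * pk e (z.1 - z.2))%:E).
  by apply/measurable_EFinP/measurable_funM => //; apply: measurable_funM => //; exact: measurable_funX.
have mS2 : measurable_fun setT (fun z : T * T => (2^-1 * normc (u z.2) ^+ 2 * pk e (z.1 - z.2))%:E).
  by apply/measurable_EFinP/measurable_funM => //; apply: measurable_funM => //; exact: measurable_funX.
have S1_ge0 z : (0 <= (2^-1 * normc (u z.1) ^+ 2 * pk e (z.1 - z.2))%:E)%E.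
  by rewrite lee_fin pp// mulr_ge0// sqr_ge0.
have S2_ge0 z : (0 <= (2^-1 * normc (u z.2) ^+ 2 * pk e (z.1 - z.2))%:E)%E.
  by rewrite lee_fin pp// mulr_ge0// sqr_ge0.
have -> : (\int[leb]_x \int[leb]_y G (x, y) =
   \int[leb]_x \int[leb]_y (2^-1 * normc (u x) ^+ 2 * pk e (x - y))%:E +
   \int[leb]_x \int[leb]_y (2^-1 * normc (u y) ^+ 2 * pk e (x - y))%:E)%E.
  rewrite -ge0_integralD//.
  - apply: eq_integral => x _; rewrite -ge0_integralD//.
    + by apply: eq_integral => y _; rewrite -EFinD /G/= -mulrDl mulrDr.
    + by move=> y _; exact: (S1_ge0 (x, y)).
    + exact: (measurableT_comp mS1 (measurable_pair1 x)).
    + by move=> y _; exact: (S2_ge0 (x, y)).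
    + exact: (measurableT_comp mS2 (measurable_pair1 x)).
  - by move=> x _; apply: integral_ge0 => y _; exact: (S1_ge0 (x, y)).
  - exact: (measurable_fun_fubini_tonelli_F _ mS1).
  - by move=> x _; apply: integral_ge0 => y _; exact: (S2_ge0 (x, y)).
  - exact: (measurable_fun_fubini_tonelli_F _ mS2).
have halfE c : (0 <= c)%R -> forall w : R -> R,
    (\int[leb]_y (w y)%:E = 1)%E -> (forall y, 0 <= w y) -> measurable_fun [set: T] w ->
    (\int[leb]_y (c * w y)%:E = c%:E)%E.
  move=> c0 w w1 w0 mw; under eq_integral do rewrite EFinM.
  rewrite ge0_integralZl ?w1 ?mule1//; first exact/measurable_EFinP.
  by move=> y _; rewrite lee_fin.
have hx x : (\int[leb]_y (2^-1 * normc (u x) ^+ 2 * pk e (x - y))%:E = (2^-1 * normc (u x) ^+ 2)%:E)%E.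
  apply: halfE; first by rewrite mulr_ge0 ?sqr_ge0.
  - exact: integral_pk_shiftr.
  - by move=> y; exact: pk_ge0.
  - by apply: (measurableT_comp (measurable_pk e)); exact: measurable_funB.
have hy y : (\int[leb]_x (2^-1 * normc (u y) ^+ 2 * pk e (x - y))%:E = (2^-1 * normc (u y) ^+ 2)%:E)%E.
  apply: halfE; first by rewrite mulr_ge0 ?sqr_ge0.
  - exact: integral_pk_shift.
  - by move=> x; exact: pk_ge0.
  - by apply: (measurableT_comp (measurable_pk e)); exact: measurable_funB.
rewrite (fubini_tonelli (fun z : T * T => (2^-1 * normc (u z.2) ^+ 2 * pk e (z.1 - z.2))%:E))//=.
under eq_integral do rewrite hx.
under [X in (_ + X)%E]eq_integral do rewrite hy.
under eq_integral do rewrite EFinM.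
rewrite ge0_integralZl//; last 2 first.
- exact: measurable_sq.
- by move=> x _; rewrite lee_fin sqr_ge0.
rewrite -ge0_muleDl ?lee_fin// -EFinD.
by rewrite (_ : 2^-1 + 2^-1 = 1) ?mul1e//; field.
Qed.

End fourier_transform.

(** * The two halves of Plancherel, and functions with vanishing interval integrals *)

Section plancherel.
Local Open Scope complex_scope.
Context {R : realType}.
Local Notation leb := (@lebesgue_measure R).
Local Notation T := (measurableTypeR R).
Implicit Types (u : T -> R[i]).

(** Same damping device as in [cmeas_fhat], for an integrand dominated uniformly in [x]. *)
Lemma cmeas_param d (Y : measurableType d) (m2 : {sigma_finite_measure set Y -> \bar R})
    (F : T * Y -> R[i]) (h : Y -> R) : cmeas F -> m2.-integrable setT (EFin \o h) ->
  (forall x y, normc (F (x, y)) <= h y) -> cmeas (fun x => cint m2 (fun y => F (x, y))).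
Proof.
move=> mF ih Fh.
have iG : cintble (leb \x m2)%E (fun z : T * Y => (abel 1 z.1)%:C * F z).
  apply: (@cintble_prod_le _ _ T Y R leb m2 _ (abel 1) h) => //.
  - apply: cmeasM => //; apply: cmeas_real.
    exact: (measurableT_comp (measurable_abel 1) measurable_fst).
  - exact: integrable_abel.
  - move=> x y; rewrite normcM normc_real ger0_norm ?expR_ge0//.
    by rewrite ler_wpM2l ?expR_ge0.
have := cmeas_cint1 iG => /= mG.
have -> : (fun x => cint m2 (fun y => F (x, y))) = (fun x => (expR (`|x|))%:C *
    cint m2 (fun y => (abel 1 x)%:C * F (x, y))).
  apply/funext => x; rewrite cintZ; last first.
    apply: (cintble_le _ ih) => //; exact: (cmeas_comp mF (measurable_pair1 x)).
  by rewrite mulrA -rmorphM/= /abel mul1r -expRD subrr expR0 mul1r.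
apply: cmeasM mG; apply: cmeas_real.
by apply: (measurableT_comp (@measurable_expR R)); exact: normr_measurable.
Qed.

Lemma cvg_abel_eps (xi : R) : (fun n => abel (eps n : R) xi) @ \oo --> (1 : R).
Proof.
rewrite -(@expR0 R); apply: (cvg_comp (fun n => - (eps n * `|xi|)) expR); last first.
  exact: continuous_expR.
rewrite -oppr0; apply: cvgN; rewrite -(mul0r `|xi|).
by apply: cvgM; [exact: cvg_eps|exact: cvg_cst].
Qed.

(** [abel (eps n)] increases to 1, so monotone convergence carries [abelsq_le] to the limit. *)
Lemma plancherel_le u : cintble leb u -> (sqint leb (fhat u) <= sqint leb u)%E.
Proof.
move=> iu.
have cv : (fun n => abelsq (eps n) u) @ \oo --> sqint leb (fhat u).
  have -> : sqint leb (fhat u) = (\int[leb]_xi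
      limn (fun n => (abel (eps n) xi * normc (fhat u xi) ^+ 2)%:E))%E.
    apply: eq_integral => xi _; apply/esym/cvg_lim => //.
    apply: cvg_EFin; first exact: nearW.
    rewrite -[X in _ --> X]mul1r; apply: cvgM; last exact: cvg_cst.
    exact: cvg_abel_eps.
  apply: cvg_monotone_convergence => //.
  - by move=> n; exact: measurable_abelsq.
  - by move=> n xi _; rewrite lee_fin mulr_ge0 ?sqr_ge0 ?expR_ge0.
  - move=> xi _ m n mn; rewrite lee_fin ler_wpM2r ?sqr_ge0// ler_expR lerN2.
    by rewrite ler_wpM2r// lef_pV2 ?posrE// ler_nat.
apply: (cvge_to_le cv); apply: nearW => n; apply: abelsq_le => //; exact: eps_gt0.
Qed.

Lemma ccvg_poisson u (M x : R) : cintble leb u -> (forall y, normc (u y) <= M) ->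
  {for x, continuous (fun y : R => Re (u y))} ->
  {for x, continuous (fun y : R => Im (u y))} ->
  ccvg (fun n => cint leb (fun y => u y * (pk (eps n) (x - y))%:C)) (u x).
Proof.
move=> iu uM c1 c2; have [m1 m2] := cintble_meas iu; split => /=.
  have -> : (fun n => \int[leb]_y Re (u y * (pk (eps n) (x - y))%:C)) =
    (fun n => \int[leb]_y (Re (u y) * pk (eps n) (x - y))).
    by apply/funext => n; apply: eq_Rintegral => y _; rewrite RecM/= mulr0 subr0.
  by apply: (approx_identity (M := M)) => // y; rewrite (le_trans (Re_le_normc _)).
have -> : (fun n => \int[leb]_y Im (u y * (pk (eps n) (x - y))%:C)) =
    (fun n => \int[leb]_y (Im (u y) * pk (eps n) (x - y))).
  by apply/funext => n; apply: eq_Rintegral => y _; rewrite ImcM/= mulr0 add0r.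
by apply: (approx_identity (M := M)) => // y; rewrite (le_trans (Im_le_normc _)).
Qed.

Lemma normc_poisson u (M e x : R) : 0 < e -> cintble leb u -> (forall y, normc (u y) <= M) ->
  normc (cint leb (fun y => u y * (pk e (x - y))%:C)) <= M.
Proof.
move=> e0 iu uM; have ip := cintble_poisson x e0 iu.
rewrite (le_trans (normc_cint ip))//.
apply: (@le_trans _ _ (\int[leb]_y (M * pk e (x - y)))).
  apply: le_Rintegral => //.
  - exact: cintble_normc.
  - exact: (integrableZl _ M (integrable_pk_shiftr x e0)).
  - move=> y _; rewrite normcM normc_real (ger0_norm (pk_ge0 _ e0)).
    by rewrite ler_wpM2r// pk_ge0.
rewrite RintegralZl//; last exact: integrable_pk_shiftr.
by rewrite /Rintegral integral_pk_shiftr//= mulr1.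
Qed.

Lemma cmeas_poisson u (e : R) : 0 < e -> cintble leb u ->
  cmeas (fun x : T => cint leb (fun y => u y * (pk e (x - y))%:C)).
Proof.
move=> e0 iu; have mu := cintble_meas iu.
apply: (@cmeas_param _ T leb (fun z : T * T => u z.2 * (pk e (z.1 - z.2))%:C)
    (fun y => 2 / e * normc (u y))).
- apply: cmeasM; first exact: (cmeas_comp mu measurable_snd).
  by apply: cmeas_real; apply: (measurableT_comp (measurable_pk e)); exact: measurable_funB.
- exact: (integrableZl _ _ (cintble_normc iu)).
- move=> x y; rewrite normcM normc_real (ger0_norm (pk_ge0 _ e0)) mulrC.
  by rewrite ler_wpM2r ?normc_ge0// pk_le.
Qed.

(** Continuity makes the Poisson means converge to [u] at every point, and boundedness gives the
    dominating function [M |u|]; so the damped energies tend to the energy of [u], while each is at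
    most that of [fhat u]. *)
Lemma plancherel_ge u (M : R) : cintble leb u -> (forall y, normc (u y) <= M) ->
  continuous (fun y : R => Re (u y)) -> continuous (fun y : R => Im (u y)) ->
  (sqint leb u <= sqint leb (fhat u))%E.
Proof.
move=> iu uM c1 c2.
have mu := cintble_meas iu.
pose P n x := cint leb (fun y => u y * (pk (eps n) (x - y))%:C).
have mP n : cmeas (P n) by apply: cmeas_poisson => //; exact: eps_gt0.
have M0 : 0 <= M by rewrite (le_trans (normc_ge0 (u 0))).
have cP : ccvg (fun n => cint leb (fun x => conjc (u x) * P n x))
    (cint leb (fun x => conjc (u x) * u x)).
  apply: (@cdominated_cvg _ T _ leb _ _ (fun x => M * normc (u x))).
  - move=> n; exact: (cmeasM (cmeasJ mu) (mP n)).
  - exact: (cmeasM (cmeasJ mu) mu).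
  - by apply: aeW => x; apply: ccvgM; [exact: ccvg_cst|exact: (ccvg_poisson iu uM (c1 x) (c2 x))].
  - exact: (integrableZl _ M (cintble_normc iu)).
  - move=> n x; rewrite normcM normcJ mulrC ler_wpM2r ?normc_ge0//.
    by apply: normc_poisson => //; exact: eps_gt0.
have fsq : sqint leb u = (Re (cint leb (fun x => conjc (u x) * u x)))%:E.
  have ic : cintble leb (fun x => conjc (u x) * u x).
    by apply: (cintbleM_bd (M := M)) => //; exact: cintbleJ.
  have [ic1 _] := ic.
  rewrite /= /Rintegral fineK; last exact: integrable_fin_num ic1.
  by apply: eq_integral => x _; rewrite mulrC mulcJ.
have cA : (fun n => abelsq (eps n) u) @ \oo --> sqint leb u.
  rewrite fsq; apply: cvg_EFin; first by apply: nearW => n; rewrite abelsqE ?eps_gt0.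
  rewrite (_ : fine \o _ = fun n => Re (cint leb (fun x => conjc (u x) * P n x))).
    by have [] := cP.
  by apply/funext => n /=; rewrite abelsqE ?eps_gt0.
apply: (cvge_to_le cA); apply: nearW => n; apply: ge0_le_integral => //.
- by move=> x _; rewrite lee_fin mulr_ge0 ?sqr_ge0 ?expR_ge0.
- exact: measurable_abelsq.
- exact/measurable_sq/cmeas_fhat.
- by move=> x _; rewrite lee_fin ler_piMl ?sqr_ge0// abel_le1// ltW// eps_gt0.
Qed.

(** Lebesgue differentiation: [D] is a.e. the derivative of its primitive, which is constant. *)
Lemma ae0_of_integral_itv (D : R -> R) : locally_integrable setT D ->
  (forall a b, \int[leb]_(x in `[a, b]) D x = 0) -> {ae leb, forall x, D x = 0}.
Proof.
move=> lD D0.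
(* The primitive needs a finite left endpoint for integrability; the points [- n] then exhaust the
   line. *)
have h n : {ae leb, forall x, - n%:R < x -> D x = 0}.
  have iD (y : R) : leb.-integrable [set` Interval (BLeft (- n%:R)) (BRight y)] (EFin \o D).
    have [mD _ bD] := lD; apply/integrableP; split.
      by apply/measurable_EFinP; exact: measurable_funS mD.
    by apply: bD => //; exact: segment_compact.
  have := FTC1 iD lD.
  apply: filterS; first exact: (ae_filter_ringOfSetsType leb).
  move=> x hx nx; have [|_ <-] := hx; first by rewrite /= lte_fin.
  rewrite (_ : (fun x => _) = cst 0); last by apply/funext => y; exact: D0.
  by rewrite derive1_cst.
have := ae_foralln h.
apply: filterS => x hx; have [n nx] : exists n : nat, - n%:R < x.
  exists (Num.truncn `|x|).+1; rewrite ltrNl (le_lt_trans (ler_norm _))// normrN.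
  exact: truncnS_gt.
exact: hx nx.
Qed.

End plancherel.

(** * Fourier inversion *)

Section inversion.
Local Open Scope complex_scope.
Context {R : realType}.
Local Notation leb := (@lebesgue_measure R).
Local Notation T := (measurableTypeR R).
Implicit Types (u : T -> R[i]).

Definition ifhat u (x : R) : R[i] := cint leb (fun xi => u xi * cexpi (2 * pi * x * xi)).

Lemma cintble_ifhat u x : cintble leb u ->
  cintble leb (fun xi => u xi * cexpi (2 * pi * x * xi)).
Proof.
by move=> iu; apply: (cintbleM_bd (M := 1) iu (cmeas_cexpiM _)) => y; rewrite normc_cexpi.
Qed.

Lemma normc_ifhat u x : cintble leb u -> normc (ifhat u x) <= \int[leb]_xi normc (u xi).
Proof.
move=> iu; rewrite (le_trans (normc_cint (cintble_ifhat x iu)))//.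
by rewrite le_eqVlt; apply/orP; left; apply/eqP; apply: eq_Rintegral => y _;
  rewrite normcM normc_cexpi mulr1.
Qed.

Lemma cmeas_ifhat u : cintble leb u -> cmeas (ifhat u).
Proof.
move=> iu.
apply: (@cmeas_param R _ T leb (fun z : T * T => u z.2 * cexpi (2 * pi * z.1 * z.2))
    (fun y => normc (u y))).
- apply: cmeasM; first exact: (cmeas_comp (cintble_meas iu) measurable_snd).
  exact: cmeas_phase2.
- exact: cintble_normc.
- by move=> x y; rewrite normcM normc_cexpi mulr1.
Qed.

(** For an integrable transform the damping in [poisson_fhat] can be removed at every point by
    dominated convergence. *)
Lemma ccvg_poisson_ifhat u x : cintble leb u -> cintble leb (fhat u) ->
  ccvg (fun n => cint leb (fun y => u y * (pk (eps n) (x - y))%:C)) (ifhat (fhat u) x).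
Proof.
move=> iu iuh; have -> : (fun n => cint leb (fun y => u y * (pk (eps n) (x - y))%:C)) =
   (fun n => cint leb (fun xi => (abel (eps n) xi)%:C * fhat u xi * cexpi (2 * pi * x * xi))).
  by apply/funext => n; rewrite poisson_fhat ?eps_gt0.
apply: (@cdominated_cvg _ T _ leb _ _ (fun xi => normc (fhat u xi))).
- by move=> n; apply: cintble_meas; apply: cintble_abel_fhat => //; exact: eps_gt0.
- exact: cintble_meas (cintble_ifhat x iuh).
- apply: aeW => xi; rewrite -[X in ccvg _ X]mul1r.
  rewrite (_ : (fun n => _) = (fun n => (abel (eps n) xi)%:C *
      (fhat u xi * cexpi (2 * pi * x * xi)))); last first.
    by apply/funext => n; rewrite mulrA.
  apply: ccvgM; last exact: ccvg_cst.
  by split => /=; [exact: cvg_abel_eps|exact: cvg_cst].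
- exact: cintble_normc.
- move=> n xi; rewrite !normcM normc_cexpi mulr1 normc_real ger0_norm ?expR_ge0//.
  by rewrite ler_piMl ?normc_ge0// abel_le1// ltW// eps_gt0.
Qed.

Lemma normc_poisson_ifhat u e x : 0 < e -> cintble leb u -> cintble leb (fhat u) ->
  normc (cint leb (fun y => u y * (pk e (x - y))%:C)) <= \int[leb]_xi normc (fhat u xi).
Proof.
move=> e0 iu iuh; rewrite poisson_fhat//.
have ip := cintble_abel_fhat x e0 iu.
rewrite (le_trans (normc_cint ip))//; apply: le_Rintegral => //.
- exact: cintble_normc.
- exact: cintble_normc.
- move=> xi _; rewrite !normcM normc_cexpi mulr1 normc_real ger0_norm ?expR_ge0//.
  by rewrite ler_piMl ?normc_ge0// abel_le1// ltW.
Qed.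

Lemma indic_itv_continuous (a b y : R) : y != a -> y != b ->
  {for y, continuous (\1_(`[a, b]%classic) : R -> R)}.
Proof.
move=> ya yb; have [yab|yab] := boolP (y \in `]a, b[%R).
  apply: cvg_near_cst; near=> z.
  rewrite !indicE !mem_set//=.
  - by apply: subset_itv_oo_cc; rewrite /= yab.
  - by apply: subset_itv_oo_cc; near: z; exact: near_in_itvoo.
have yc : (~` `[a, b]%classic) y.
  rewrite /= in_itv/=; apply/negP; apply: contra yab => /andP[ay yb'].
  by rewrite in_itv/= !lt_neqAle ay yb' eq_sym ya yb.
have ny : nbhs y (~` `[a, b]%classic).
  by apply: open_nbhs_nbhs; split => //; apply: closed_openC; exact: itv_closed.
apply: cvg_near_cst; apply: filterS ny => z yz.
by rewrite !indicE !memNset.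
Unshelve. all: by end_near. Qed.

(** The Poisson means converge everywhere to [ifhat (fhat u)], but [u] is not continuous, so their
    relation to [u] is only tested on intervals. The symmetry of the kernel moves the mean from [u]
    to the indicator, where it converges off the two endpoints. *)
Lemma inversion_itv u (a b : R) : cintble leb u -> cintble leb (fhat u) ->
  cint leb (fun x => (\1_(`[a, b]%classic) x)%:C * ifhat (fhat u) x) =
  cint leb (fun x => (\1_(`[a, b]%classic) x)%:C * u x).
Proof.
move=> iu iuh; have mu := cintble_meas iu.
set chi : T -> R := \1_(`[a, b]%classic).
have mchi : measurable_fun setT chi by exact: measurable_indic.
have ichi : leb.-integrable setT (EFin \o chi) by exact: integrable_indic_itv.
have chi0 x : 0 <= chi x by rewrite /chi indicE.
have chi1 x : chi x <= 1 by rewrite /chi indicE; case: (_ \in _).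
pose P n (x : T) := cint leb (fun y => u y * (pk (eps n) (x - y))%:C).
pose A := \int[leb]_xi normc (fhat u xi).
have mP n : cmeas (P n) by apply: cmeas_poisson => //; exact: eps_gt0.
have cv1 : ccvg (fun n => cint leb (fun x => (chi x)%:C * P n x))
    (cint leb (fun x => (chi x)%:C * ifhat (fhat u) x)).
  apply: (@cdominated_cvg _ T _ leb _ _ (fun x => A * chi x)).
  - by move=> n; apply: cmeasM => //; exact: cmeas_real.
  - by apply: cmeasM (cmeas_ifhat iuh); exact: cmeas_real.
  - apply: aeW => x; apply: ccvgM; [exact: ccvg_cst|exact: ccvg_poisson_ifhat].
  - exact: (integrableZl _ A ichi).
  - move=> n x; rewrite normcM normc_real ger0_norm// mulrC ler_wpM2r//.
    by apply: normc_poisson_ifhat => //; exact: eps_gt0.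
pose Q n (y : T) := \int[leb]_x (chi x * pk (eps n) (y - x)).
have PQ : (fun n => cint leb (fun x => (chi x)%:C * P n x)) =
    (fun n => cint leb (fun y => u y * (Q n y)%:C)).
  apply/funext => n; have e0 : 0 < (eps n : R) by exact: eps_gt0.
  pose F (z : T * T) := (chi z.1)%:C * (u z.2 * (pk (eps n) (z.1 - z.2))%:C).
  have iF : cintble (leb \x leb)%E F.
    apply: (@cintble_prod_le _ _ T T R leb leb _ chi (fun y => 2 / eps n * normc (u y))) => //.
    - apply: cmeasM; last apply: cmeasM.
      + by apply: cmeas_real; exact: (measurableT_comp mchi measurable_fst).
      + exact: (cmeas_comp mu measurable_snd).
      + by apply: cmeas_real; apply: (measurableT_comp (measurable_pk _)); exact: measurable_funB.
    - exact: (integrableZl _ _ (cintble_normc iu)).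
    - move=> x y; rewrite /F/= !normcM !normc_real ger0_norm// ler_wpM2l//.
      by rewrite mulrC ler_wpM2r ?normc_ge0// ger0_norm ?pk_ge0 ?pk_le.
  transitivity (cint leb (fun x => cint leb (fun y => F (x, y)))).
    by apply: eq_cint => x; rewrite /F/= cintZ//; exact: cintble_poisson.
  rewrite cint_swap//; apply: eq_cint => y; rewrite /F/=.
  have ichipk : cintble leb (fun x => (chi x * pk (eps n) (y - x))%:C).
    have i1 : leb.-integrable setT (EFin \o (fun x => chi x * pk (eps n) (y - x))).
      apply: (@integrableM_bd _ _ _ 1) => //.
        by move=> x; rewrite ger0_norm.
      exact: integrable_pk_shiftr.
    by split => //=; exact: integrable0.
  under eq_cint => x.
    rewrite mulrCA -rmorphM/= -(opprB y x) pkN; over.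
  rewrite cintZ//; congr (_ * _).
  by apply: complex_eq => //=; rewrite Rintegral_cst// mul0r.
have Q0 n y : 0 <= Q n y.
  by apply: Rintegral_ge0 => x _; rewrite mulr_ge0// pk_ge0// eps_gt0.
have Q1 n y : Q n y <= 1.
  have e0 : 0 < (eps n : R) by exact: eps_gt0.
  apply: (@le_trans _ _ (\int[leb]_x pk (eps n) (y - x))); last first.
    by rewrite /Rintegral integral_pk_shiftr.
  apply: le_Rintegral => //.
  - apply: (@integrableM_bd _ _ _ 1) => //.
      by move=> x; rewrite ger0_norm.
    exact: integrable_pk_shiftr.
  - exact: integrable_pk_shiftr.
  - by move=> x _; rewrite ler_piMl ?pk_ge0.
have mQ n : measurable_fun setT (Q n).
  have e0 : 0 < (eps n : R) by exact: eps_gt0.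
  have [] : cmeas (fun y : T => cint leb (fun x => (chi x * pk (eps n) (y - x))%:C)).
    apply: (@cmeas_param R _ T leb (fun z : T * T => (chi z.2 * pk (eps n) (z.1 - z.2))%:C)
        (fun x => 2 / eps n * chi x)).
    - apply: cmeas_real; apply: measurable_funM.
        exact: (measurableT_comp mchi measurable_snd).
      by apply: (measurableT_comp (measurable_pk _)); exact: measurable_funB.
    - exact: (integrableZl _ _ ichi).
    - move=> x y; rewrite normc_real normrM ger0_norm// mulrC ler_wpM2r//.
      by rewrite ger0_norm ?pk_ge0 ?pk_le.
  by [].
have cv2 : ccvg (fun n => cint leb (fun y => u y * (Q n y)%:C))
    (cint leb (fun x => u x * (chi x)%:C)).
  apply: (@cdominated_cvg _ T _ leb _ _ (fun y => normc (u y))).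
  - by move=> n; apply: cmeasM => //; exact: cmeas_real.
  - by apply: cmeasM => //; exact: cmeas_real.
  - exists ([set a] `|` [set b]); split.
    + by apply: measurableU; exact: measurable_set1.
    + by rewrite null_set_setU//; exact: lebesgue_measure_set1.
    + move=> y; apply: contra_notP => /not_orP[/eqP ya /eqP yb].
      apply: ccvgM; first exact: ccvg_cst.
      split => /=; last exact: cvg_cst.
      apply: (@approx_identity _ chi 1) => //.
        by move=> x; rewrite ger0_norm.
      exact: indic_itv_continuous.
  - exact: cintble_normc.
  - move=> n y; rewrite normcM normc_real ger0_norm// ler_piMr ?normc_ge0//.
under [RHS]eq_cint do rewrite mulrC.
by apply: (ccvg_unique cv1); rewrite PQ.
Qed.

(** By [inversion_itv] both sides have the same integral over every interval. The left one is
    integrable and the right one merely bounded, so their difference is handled as a locally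
    integrable function. *)
Lemma inversion u : cintble leb u -> cintble leb (fhat u) ->
  {ae leb, forall x, u x = ifhat (fhat u) x}.
Proof.
move=> iu iuh; have [u1 u2] := iu; have [m1 m2] := cmeas_ifhat iuh.
pose A := \int[leb]_xi normc (fhat u xi).
have li (f g : T -> R) : leb.-integrable setT (EFin \o f) -> measurable_fun setT g ->
    (forall x, `|g x| <= A) -> locally_integrable setT (f \- g).
  move=> jf mg gA; apply: locally_integrableB.
    apply: open_integrable_locally => //; exact: openT.
  split; [exact: mg|exact: openT|move=> B _ cB].
  apply: (@le_lt_trans _ _ (\int[leb]_(x in B) A%:E)%E).
    apply: ge0_le_integral => //=.
    - exact: compact_measurable.
    - by apply/measurable_EFinP; apply: measurable_funTS; exact: measurableT_comp.
    - by move=> x _; rewrite lee_fin.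
  rewrite integral_cst/=; last exact: compact_measurable.
  rewrite lte_mul_pinfty ?lee_fin//; first exact: le_trans (gA 0).
  exact: compact_finite_measure.
have key (f g : T -> R) : leb.-integrable setT (EFin \o f) -> measurable_fun setT g ->
    (forall x, `|g x| <= A) ->
    (forall a b, \int[leb]_x (\1_(`[a, b]%classic) x * g x) = \int[leb]_x (\1_(`[a, b]%classic) x * f x)) ->
    {ae leb, forall x, f x = g x}.
  move=> jf mg gA fg.
  have := @ae0_of_integral_itv R (f \- g) (li _ _ jf mg gA).
  have iab (h : T -> R) a b : \int[leb]_(x in `[a, b]) h x = \int[leb]_x (\1_(`[a, b]%classic) x * h x).
    rewrite Rintegral_mkcond; apply: eq_Rintegral => x _.
    by rewrite patchE indicE; case: (x \in _); rewrite ?mul1r ?mul0r.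
  have ib (a b : R) : leb.-integrable setT (EFin \o (fun x => \1_(`[a, b]%classic) x * g x)).
    have h : leb.-integrable setT (EFin \o (fun x : T => A * \1_(`[a, b]%classic) x)).
      have hi : leb.-integrable setT (EFin \o (\1_(`[a, b]%classic) : T -> R)).
        exact: integrable_indic_itv.
      exact: (integrableZl _ A hi).
    apply: (le_integrable _ _ _ h) => //.
      by apply/measurable_EFinP/measurable_funM => //; exact: measurable_indic.
    move=> x _ /=; rewrite lee_fin !normrM mulrC ler_wpM2r//.
    by rewrite (le_trans (gA x))// ler_norm.
  have jb (a b : R) : leb.-integrable setT (EFin \o (fun x => \1_(`[a, b]%classic) x * f x)).
    apply: (@integrableM_bd _ (\1_(`[a, b]%classic) : T -> R) f 1) => //.
    by move=> x; rewrite indicE; case: (_ \in _); rewrite ?normr1 ?normr0.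
  move=> /(_ _) H; have {}H : {ae leb, forall x, (f \- g) x = 0}.
    apply: H => a b; rewrite iab; under eq_Rintegral do rewrite /= mulrBr.
    by rewrite RintegralB// fg subrr.
  move: H; apply: filterS => x /= /eqP.
  by rewrite subr_eq0 => /eqP.
have Ab x : normc (ifhat (fhat u) x) <= A by exact: normc_ifhat.
have eqab (a b : R) := inversion_itv a b iu iuh.
have hRe := key (fun x => Re (u x)) (fun x => Re (ifhat (fhat u) x)) u1 m1.
have hIm := key (fun x => Im (u x)) (fun x => Im (ifhat (fhat u) x)) u2 m2.
have ReE (a b : R) (w : T -> R[i]) :
    \int[leb]_x (\1_(`[a, b]%classic) x * Re (w x)) =
    Re (cint leb (fun x => (\1_(`[a, b]%classic) x)%:C * w x)).
  by apply: eq_Rintegral => x _; rewrite RecM/= mul0r subr0.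
have ImE (a b : R) (w : T -> R[i]) :
    \int[leb]_x (\1_(`[a, b]%classic) x * Im (w x)) =
    Im (cint leb (fun x => (\1_(`[a, b]%classic) x)%:C * w x)).
  by apply: eq_Rintegral => x _; rewrite ImcM/= mul0r addr0.
have {}hRe : {ae leb, forall x, Re (u x) = Re (ifhat (fhat u) x)}.
  apply: hRe => [x|a b]; first by rewrite (le_trans (Re_le_normc _)).
  by rewrite !ReE eqab.
have {}hIm : {ae leb, forall x, Im (u x) = Im (ifhat (fhat u) x)}.
  apply: hIm => [x|a b]; first by rewrite (le_trans (Im_le_normc _)).
  by rewrite !ImE eqab.
move: hRe hIm; apply: filterS2.
by move=> x; exact: complex_eq.
Qed.

(** On the band the phases [2 pi x xi] and [2 pi y xi] differ by at most [2 pi K |x - y|]. *)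
Lemma ifhat_lip u (K : R) x y : cintble leb u -> (forall xi, K < `|xi| -> u xi = 0) ->
  normc (ifhat u x - ifhat u y) <= 2 * pi * K * (\int[leb]_xi normc (u xi)) * `|x - y|.
Proof.
move=> iu uK; have -> : ifhat u x - ifhat u y =
    cint leb (fun xi => u xi * (cexpi (2 * pi * x * xi) - cexpi (2 * pi * y * xi))).
  under [RHS]eq_cint do rewrite mulrBr -mulN1r mulrCA.
  rewrite cintD; [|exact: cintble_ifhat|].
    rewrite /ifhat -[- cint _ _]mulN1r -cintZ//; [|exact: cintble_ifhat].
    by congr (_ + _); apply: eq_cint => xi; rewrite mulrCA.
  under eq_fun do rewrite mulrCA; apply: cintbleZ; exact: cintble_ifhat.
have p0 : 0 <= (2 * pi : R) by rewrite mulr_ge0// pi_ge0.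
set D := cint _ _.
have ib : cintble leb (fun xi => u xi * (cexpi (2 * pi * x * xi) - cexpi (2 * pi * y * xi))).
  apply: (cintbleM_bd (M := 2) iu).
    by apply: cmeasB; exact: cmeas_cexpiM.
  by move=> xi; rewrite (le_trans (le_normcB _ _))// !normc_cexpi.
rewrite (le_trans (normc_cint ib))// [leRHS]mulrAC -RintegralZl//; last exact: cintble_normc.
apply: le_Rintegral => //.
- exact: cintble_normc.
- exact: (integrableZl _ _ (cintble_normc iu)).
move=> xi _; rewrite normcM mulrC.
have [xiK|Kxi] := leP `|xi| K; last by rewrite uK// normc0 !mulr0.
rewrite ler_wpM2r ?normc_ge0// (le_trans (cexpi_lip _ _))//.
rewrite -mulrBl -mulrBr normrM normrM (ger0_norm p0) [leRHS]mulrAC.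
by apply: ler_wpM2l => //; exact: mulr_ge0.
Qed.

End inversion.

(** * Band-limited functions *)

Section bandlimited.
Local Open Scope complex_scope.
Context {R : realType}.
Local Notation leb := (@lebesgue_measure R).
Local Notation T := (measurableTypeR R).
Implicit Types (u : T -> R[i]).

(* Since [|1 - e^{2 pi i h xi}| <= 1/2] on the band, the n-th difference of step [h]
   of [ifhat u] is at most [2^-n |u|_1]; if [ifhat u] vanishes at all the points
   [x + m h], m >= 1, this difference is its value at [x]. *)
Lemma ifhat_extend u (K x h : R) : cintble leb u -> (forall xi, K < `|xi| -> u xi = 0) ->
  2 * pi * K * `|h| <= 2^-1 ->
  (forall m : nat, ifhat u (x + m.+1%:R * h) = 0) -> ifhat u x = 0.
Proof.
move=> iu uK hK w0.
pose A := \int[leb]_xi normc (u xi).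
pose q (xi : R) : R[i] := 1 - cexpi (2 * pi * h * xi).
pose F n (xi : R) := u xi * cexpi (2 * pi * x * xi) * q xi ^+ n.
have q2 xi : normc (q xi) <= 2 by rewrite (le_trans (le_normcB _ _))// normc1 normc_cexpi.
have mq n : cmeas (fun xi : T => q xi ^+ n).
  elim: n => [|n ih]; first by under eq_fun do rewrite expr0; exact: cmeas_cst.
  under eq_fun do rewrite exprS; apply: cmeasM => //.
  by apply: cmeasB; [exact: cmeas_cst|exact: cmeas_cexpiM].
have iF n : cintble leb (F n).
  apply: (cintbleM_bd (M := 2 ^+ n) (cintble_ifhat x iu) (mq n)) => xi.
  by rewrite normcX lerXn2r ?nnegrE ?normc_ge0.
have FE n : cint leb (F n) = ifhat u x.
  transitivity (\sum_(i < n.+1) (-1) ^+ i * ('C(n, i))%:R * ifhat u (x + i%:R * h)).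
    rewrite (_ : F n = fun xi => \sum_(i < n.+1) ((-1) ^+ i * ('C(n, i))%:R) *
        (u xi * cexpi (2 * pi * (x + i%:R * h) * xi))); last first.
      apply/funext => xi; rewrite /F /q exprBn mulr_sumr; apply: eq_bigr => i _.
      rewrite expr1n mulr1 -[_ *+ 'C(n, i)]mulr_natr.
      have -> : 2 * pi * (x + i%:R * h) * xi = 2 * pi * x * xi + i%:R * (2 * pi * h * xi) by ring.
      rewrite cexpiD.
      have -> : cexpi (i%:R * (2 * pi * h * xi)) = cexpi (2 * pi * h * xi) ^+ i.
        elim: (nat_of_ord i) => [|j ih]; first by rewrite mul0r cexpi0 expr0.
        by rewrite exprS -ih -cexpiD -natr1 mulrDl mul1r addrC.
      by ring.
    rewrite cint_sum; last by move=> i _; apply: cintbleZ; exact: cintble_ifhat.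
    by apply: eq_bigr => i _; rewrite cintZ//; exact: cintble_ifhat.
  rewrite big_ord_recl expr0 bin0 mul1r mul0r addr0 mul1r big1 ?addr0// => i _.
  by rewrite w0 mulr0.
have bd n : normc (ifhat u x) <= 2^-1 ^+ n * A.
  rewrite -(FE n) (le_trans (normc_cint (iF n)))// -RintegralZl//; last exact: cintble_normc.
  apply: le_Rintegral => //.
  - exact: cintble_normc.
  - exact: (integrableZl _ _ (cintble_normc iu)).
  move=> xi _; rewrite /F !normcM normc_cexpi mulr1 mulrC normcX.
  have [xiK|Kxi] := leP `|xi| K; last by rewrite uK// normc0 !mulr0.
  rewrite ler_wpM2r ?normc_ge0// lerXn2r ?nnegrE ?normc_ge0//.
  rewrite /q -(@cexpi0 R) (le_trans (cexpi_lip _ _))// sub0r normrN.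
  rewrite (le_trans _ hK)// normrM normrM (@ger0_norm _ (2 * pi)); last first.
    by rewrite mulr_ge0// pi_ge0.
  by rewrite mulrAC ler_wpM2r// ler_wpM2l// mulr_ge0// pi_ge0.
have A0 : 0 <= A by apply: Rintegral_ge0 => y _; exact: normc_ge0.
apply: eq0_normc; apply/eqP; rewrite eq_le normc_ge0 andbT.
have cv : (fun n => 2^-1 ^+ n * A) @ \oo --> 0 * A.
  apply: cvgM; last exact: cvg_cst.
  by apply: cvg_expr; rewrite ger0_norm// invf_lt1// ltr1n.
rewrite mul0r in cv.
by rewrite -(cvg_lim _ cv)//; apply: limr_ge; [exact: cvgP cv|exact: nearW].
Qed.

(** Each use of [ifhat_extend] moves the boundary of the zero set by a step [h] that depends on [K]
    only, so the half-line grows to the whole line. The sign [s] selects the half-line. *)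
Lemma ifhat_extend_half u (K s : R) : 0 < K -> cintble leb u ->
  (forall xi, K < `|xi| -> u xi = 0) -> `|s| = 1 ->
  (forall x, 0 < x -> ifhat u (s * x) = 0) -> forall x, ifhat u x = 0.
Proof.
move=> K0 iu uK s1 w0.
have p0 : 0 < (pi : R) by exact: pi_gt0.
(* Then [2 pi K h = 1/2], the largest step that [ifhat_extend] admits. *)
pose h := (4 * pi * K)^-1.
have h0 : 0 < h by rewrite invr_gt0 !mulr_gt0.
have ind n : forall x, - (n%:R * h) < x -> ifhat u (s * x) = 0.
  elim: n => [|n ih] x; first by rewrite mul0r oppr0; exact: w0.
  move=> nx; apply: (@ifhat_extend u K _ (s * h)) => //.
    rewrite normrM s1 mul1r gtr0_norm// /h.
    rewrite (_ : 2 * pi * K * _ = 2^-1)//.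
    by move: (pi : R) p0 => p p0; field; rewrite !gt_eqF.
  move=> m; rewrite mulrCA -mulrDr; apply: ih.
  rewrite -natr1 mulrDl mul1r in nx.
  rewrite -natr1 mulrDl mul1r.
  have : 0 <= m%:R * h by rewrite mulr_ge0// ltW.
  by move: nx; set a := n%:R * h; set b := m%:R * h; lra.
move=> x; have s0 : s != 0 by rewrite -normr_eq0 s1 oner_eq0.
have -> : x = s * (x / s) by rewrite mulrC divfK.
have [n nx] : exists n : nat, `|x / s| / h < n%:R.
  exists (Num.truncn (`|x / s| / h)).+1; exact: truncnS_gt.
apply: (ind n); rewrite ltrNl (le_lt_trans (ler_norm _))// normrN.
by rewrite -ltr_pdivrMr.
Qed.

(** A nonzero value at [x] would persist, by the Lipschitz bound, on an interval of positive length
    around [x]. *)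
Lemma ifhat_ae_eq0 u (K s x : R) : 0 < K -> cintble leb u ->
  (forall xi, K < `|xi| -> u xi = 0) ->
  {ae leb, forall y, 0 < s * y -> ifhat u y = 0} -> 0 < s * x -> ifhat u x = 0.
Proof.
move=> K0 iu uK [N [mN N0 Nsub]] sx; apply: contrapT => wx.
have nw : 0 < normc (ifhat u x).
  rewrite lt_neqAle normc_ge0 andbT eq_sym; apply/eqP => /eq0_normc; exact: wx.
pose L := 2 * pi * K * (\int[leb]_xi normc (u xi)).
have L0 : 0 <= L.
  rewrite mulr_ge0//; last by apply: Rintegral_ge0 => y _; exact: normc_ge0.
  by rewrite !mulr_ge0 ?pi_ge0// ltW.
have x0 : x != 0 by apply: contraTneq sx => ->; rewrite mulr0 ltxx.
(* Within [del] of [x] the point stays on the same side of 0 and the value stays nonzero; [L + 1]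
   replaces [L], which may be 0. *)
pose del := Num.min `|x| (normc (ifhat u x) / (L + 1)).
have del0 : 0 < del by rewrite lt_min normr_gt0 x0 divr_gt0// ltr_wpDl.
have sub : `]x - del, x + del[%classic `<=` N.
  move=> y; rewrite /= in_itv/= => yx; apply: Nsub => /= h.
  have yxd : `|x - y| < del by rewrite distrC ltr_distl.
  have : 0 < s * y.
    have : `|x - y| < `|x| by rewrite (lt_le_trans yxd)// ge_min lexx.
    move=> xy; rewrite (_ : s * y = s * x - s * (x - y)); last by ring.
    rewrite subr_gt0 (le_lt_trans (ler_norm _))// normrM.
    rewrite -(gtr0_norm sx) normrM ltr_pM2l// normr_gt0.
    by apply: contraTneq sx => ->; rewrite mul0r ltxx.
  move/h => wy; have := ifhat_lip x y iu uK; rewrite wy subr0 -/L.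
  have : `|x - y| < normc (ifhat u x) / (L + 1) by rewrite (lt_le_trans yxd)// ge_min lexx orbT.
  rewrite ltr_pdivlMr; last by rewrite ltr_wpDl.
  move=> h1 h2; have := lt_le_trans h1 h2.
  by rewrite mulrDr mulr1 mulrC -subr_lt0 addrAC subrr add0r ltNge normr_ge0.
have : (leb `](x - del)%R, (x + del)%R[%classic <= leb N)%E by apply: le_measure; rewrite ?inE.
rewrite N0 lebesgue_measure_itv/= lte_fin ltrD2l gtrN// -EFinD lee_fin.
by move: del0; clearbody del => del0 h; lra.
Qed.

End bandlimited.

(** * The band-limited weight: mass on half-lines and in frequency windows *)

Section bandlimited_window.
Local Open Scope complex_scope.
Context {R : realType}.
Local Notation leb := (@lebesgue_measure R).
Local Notation T := (measurableTypeR R).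

Lemma lip_continuous (f : R -> R) (L : R) :
  (forall x y, `|f x - f y| <= L * `|x - y|) -> continuous f.
Proof.
move=> fL x; apply/cvgrPdist_le => e e0; near=> y.
have L1 : 0 < `|L| + 1 by rewrite ltr_wpDl.
rewrite (le_trans (fL x y))// (@le_trans _ _ ((`|L| + 1) * `|x - y|))//.
  by rewrite ler_wpM2r// (le_trans (ler_norm _))// lerDl.
rewrite mulrC -ler_pdivlMr//.
by near: y; apply: cvgr_dist_le; [exact: cvg_id|rewrite divr_gt0].
Unshelve. all: by end_near. Qed.

Lemma sqint_tail (u : T -> R[i]) (e : R) : cmeas u -> (sqint leb u < +oo)%E -> 0 < e ->
  exists X : R, (\int[leb]_x (\1_(~` `[- X, X]%classic) x * normc (u x) ^+ 2)%:E <= e%:E)%E.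
Proof.
move=> mu uoo e0.
have ig : leb.-integrable setT (EFin \o (fun x => normc (u x) ^+ 2)).
  apply/integrableP; split; first exact: measurable_sq.
  by under eq_integral do rewrite /= ger0_norm ?sqr_ge0//.
pose f n (x : T) := \1_(~` `[- n%:R, n%:R]%classic) x * normc (u x) ^+ 2.
have mf n : measurable_fun setT (f n).
  apply: measurable_funM; last exact/measurable_funX/measurable_normc.
  by apply: measurable_indic; exact: measurableC.
have bf n x : `|f n x| <= normc (u x) ^+ 2.
  rewrite /f indicE; case: (_ \in _); rewrite ?mul1r ?mul0r ?normr0 ?sqr_ge0//.
  by rewrite ger0_norm ?sqr_ge0.
have cv : \int[leb]_x f n x @[n --> \oo] --> \int[leb]_x (cst 0 x : R).
  apply: (@Rdominated_cvg _ T _ leb f (cst 0) (fun x => normc (u x) ^+ 2)) => //.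
  apply: aeW => x; apply: cvg_near_cst.
  exists (Num.truncn `|x|).+1 => // n /= xn; rewrite /f indicE memNset ?mul0r//=.
  apply; rewrite in_itv/= -ler_norml.
  by rewrite (le_trans (ltW (truncnS_gt _)))// ler_nat.
rewrite Rintegral_cst// mul0r in cv.
have /cvgrPdist_le/(_ _ e0)[n _ /(_ n (leqnn n))] := cv.
rewrite sub0r normrN /= => fe; exists n%:R.
rewrite -[leLHS]fineK.
  by rewrite lee_fin (le_trans _ fe)// ler_norm.
apply: integrable_fin_num => //; apply: (le_integrable _ _ _ ig) => //.
  by apply/measurable_EFinP; exact: mf.
move=> x _ /=; rewrite lee_fin (le_trans (bf n x))// ler_norm//.
Qed.

Variables (psi : T -> R) (K : R).
Hypothesis K0 : 0 < K.
Hypothesis ipsi : leb.-integrable setT (EFin \o psi).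
Local Notation psiC := (fun x : T => (psi x)%:C).
Hypothesis psi1 : sqint leb psiC = 1%E.
Hypothesis psiK : forall xi, K < `|xi| -> fhat psiC xi = 0.

Let cpsi : cintble leb psiC.
Proof. by split => //=; exact: integrable0. Qed.

Lemma cintble_fhat_psi : cintble leb (fhat psiC).
Proof.
apply: (@cintble_le _ T _ leb _ (fun x => (\int[leb]_x normc (psiC x)) * \1_(`[- K, K]%classic) x)).
- exact: cmeas_fhat.
- have hi : leb.-integrable setT (EFin \o (\1_(`[- K, K]%classic) : T -> R)).
    exact: integrable_indic_itv.
  exact: (integrableZl _ _ hi).
- move=> xi; have [xiK|Kxi] := leP `|xi| K.
    rewrite (_ : \1_ _ xi = 1); first by rewrite mulr1; exact: normc_fhat.
    by rewrite indicE mem_set//= in_itv/= -ler_norml.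
  rewrite psiK// normc0 mulr_ge0 ?indicE//.
  by apply: Rintegral_ge0 => x _; exact: normc_ge0.
Qed.

(** The continuous representative of [psi]. As an inverse transform it can be evaluated at points,
    which [psi], known only up to null sets, cannot. *)
Definition psi0 : R -> R[i] := ifhat (fhat psiC).

Lemma psi0_ae : {ae leb, forall x, psiC x = psi0 x}.
Proof. by apply: inversion => //; exact: cintble_fhat_psi. Qed.

Lemma psi0_bound : exists M : R, forall x, normc (psi0 x) <= M.
Proof. by eexists => x; apply: normc_ifhat; exact: cintble_fhat_psi. Qed.

Lemma cmeas_psi0 : cmeas (psi0 : T -> R[i]).
Proof. by apply: cmeas_ifhat; exact: cintble_fhat_psi. Qed.

Lemma psi0_continuous :
  continuous (fun x => Re (psi0 x)) /\ continuous (fun x => Im (psi0 x)).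
Proof.
split; apply: lip_continuous => x y.
  rewrite -RecN -RecD (le_trans (Re_le_normc _))//.
  exact: (ifhat_lip x y cintble_fhat_psi psiK).
rewrite -ImcN -ImcD (le_trans (Im_le_normc _))//.
exact: (ifhat_lip x y cintble_fhat_psi psiK).
Qed.

Definition half (s : bool) : set T := if s then `]0, +oo[%classic else `]-oo, 0]%classic.

Lemma measurable_half s : measurable (half s). Proof. by case: s; exact: measurable_itv. Qed.

Lemma half_split x : \1_(half true) x + \1_(half false) x = 1 :> R.
Proof.
rewrite !indicE; have [x0|x0] := leP x 0.
  by rewrite memNset ?mem_set ?add0r//= in_itv/= ?andbT// ltNge x0.
by rewrite mem_set ?memNset ?addr0//= in_itv/= ?andbT// leNgt x0.
Qed.

Definition part (s : bool) (x : T) : R[i] := (\1_(half s) x * psi x)%:C.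

Let indic_sq (s : bool) (x : T) : (\1_(half s) x : R) ^+ 2 = \1_(half s) x.
Proof. by rewrite indicE; case: (_ \in _); rewrite ?expr1n ?expr0n. Qed.

Let cpart s : cintble leb (part s).
Proof.
split => /=; last exact: integrable0.
apply: (@integrableM_bd _ (\1_(half s)) psi 1) => //.
  by apply: measurable_indic; exact: measurable_half.
by move=> x; rewrite indicE; case: (_ \in _); rewrite ?normr1 ?normr0.
Qed.

Lemma mass_sum : (sqint leb (part true) + sqint leb (part false) = 1)%E.
Proof.
rewrite -psi1 /sqint -ge0_integralD//.
- apply: eq_integral => x _; rewrite -EFinD !normc_real !real_normK ?num_real//.
  by rewrite !exprMn !indic_sq -mulrDl half_split mul1r.
- by move=> x _; rewrite lee_fin sqr_ge0.
- apply: measurable_sq; exact: (cintble_meas (cpart _)).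
- by move=> x _; rewrite lee_fin sqr_ge0.
- apply: measurable_sq; exact: (cintble_meas (cpart _)).
Qed.

(** If one part were null, [psi0] would vanish a.e. on that half-line, hence at each of its points
    by the Lipschitz bound, hence on the whole line by [ifhat_extend_half], against [psi1]. *)
Lemma mass_neq0 s : sqint leb (part s) != 0%E.
Proof.
apply/eqP => m0.
have mp : measurable_fun setT (fun x => (normc (part s x) ^+ 2)%:E).
  apply: measurable_sq; exact: (cintble_meas (cpart _)).
have /(ae_eq_integral_abs leb measurableT mp) part0 :
    (\int[leb]_x `|(normc (part s x) ^+ 2)%:E| = 0)%E.
  by rewrite -m0; apply: eq_integral => x _; rewrite gee0_abs// lee_fin sqr_ge0.
pose sg : R := if s then 1 else -1.
have sg1 : `|sg| = 1 by rewrite /sg; case: (s); rewrite ?normrN normr1.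
have w0 x : psi0 x = 0.
  apply: (ifhat_extend_half (s := sg) K0 cintble_fhat_psi psiK sg1) => {}x x0.
  apply: (@ifhat_ae_eq0 _ _ K sg _ K0 cintble_fhat_psi psiK).
    move: part0 psi0_ae; apply: filterS2.
    move=> y /(_ I) h py sy.
    have p0 : part s y = 0.
      apply: eq0_normc; apply/eqP; rewrite -sqrf_eq0; apply/eqP.
      exact: EFin_inj h.
    have [] := p0; rewrite -/(psi0 y) -py indicE mem_set ?mul1r => [->//|].
    by rewrite /half; move: sy; rewrite /sg; case: (s) => /=;
      rewrite in_itv/= ?mul1r ?andbT// mulN1r oppr_gt0 => /ltW.
  by rewrite mulrA -expr2 -[_ ^+ 2]real_normK ?num_real// sg1 expr1n mul1r.
have : sqint leb psiC = 0%E.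
  have mp1 : measurable_fun setT (fun x => (normc (psiC x) ^+ 2)%:E).
    apply: measurable_sq; exact: (cintble_meas cpsi).
  rewrite -[RHS](integral0 leb setT).
  apply: ae_eq_integral => //; move: psi0_ae.
  by apply: filterS => x px _; rewrite px w0 normc0 expr0n.
by rewrite psi1 => /eqP; rewrite onee_eq0.
Qed.

Lemma mass_lt1 : exists q : R, [/\ 0 <= q, q < 1 & forall s, (sqint leb (part s) <= q%:E)%E].
Proof.
have := mass_sum; have := mass_neq0 true; have := mass_neq0 false.
have := sqint_ge0 leb (part true); have := sqint_ge0 leb (part false).
set p := sqint leb (part true); set m := sqint leb (part false).
case Ep : p => [p'| |]; case Em : m => [m'| |] //=.
rewrite !lee_fin !eqe => m0 p0 mn pn [pm].
exists (Num.max p' m'); split.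
- by rewrite le_max p0.
- by rewrite gt_max; apply/andP; split; rewrite -pm ?ltrDl ?ltrDr lt_neqAle eq_sym ?mn ?pn.
- by case; rewrite -/p -/m ?Ep ?Em lee_fin le_max lexx ?orbT.
Qed.

(* One coordinate factor of [target * phi], with [al = r v_j] and [be = r w_j]. *)
Definition fj (al be : R) (x : T) : R[i] :=
  cexpi (2 * pi * (al * x + be * Num.max 0 x)) * (psi x)%:C.

Lemma measurable_phase (al be : R) :
  measurable_fun [set: T] (fun x : T => 2 * pi * (al * x + be * Num.max 0 x) : T).
Proof.
apply: measurable_funM => //; apply: measurable_funD; apply: measurable_funM => //.
exact: measurable_maxr.
Qed.

Lemma cintble_fj al be : cintble leb (fj al be).
Proof.
have mphase := cmeas_cexpi (measurable_phase al be).
have := @cintbleM_bd _ _ _ leb _ _ 1 cpsi mphase.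
under eq_fun do rewrite mulrC; apply => x; by rewrite normc_cexpi.
Qed.

(** The lower half of Plancherel asks for a bounded continuous function, so [fj] is replaced by the
    a.e. equal [g], in which [psi0] stands for [psi]. *)
Lemma sqint_fhat_fj al be : sqint leb (fhat (fj al be)) = 1%E.
Proof.
have sq1 : sqint leb (fj al be) = 1%E.
  by rewrite -psi1; apply: eq_integral => x _; rewrite /fj normcM normc_cexpi mul1r.
apply/eqP; rewrite eq_le -{1}sq1 plancherel_le ?andTb; last exact: cintble_fj.
pose g (x : T) := cexpi (2 * pi * (al * x + be * Num.max 0 x)) * psi0 x.
have mg : cmeas g by exact: cmeasM (cmeas_cexpi (measurable_phase al be)) cmeas_psi0.
have gae : {ae leb, forall x, fj al be x = g x}.
  move: psi0_ae; apply: filterS.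
  by move=> x; rewrite /fj /g => ->.
have sqg : sqint leb g = 1%E.
  rewrite -sq1; apply: ae_eq_integral => //.
  - exact: measurable_sq.
  - apply: measurable_sq; exact: (cintble_meas (cintble_fj _ _)).
  - move: gae; apply: filterS.
    by move=> x -> _.
have ig : cintble leb g.
  apply: cintble_lty => //.
  rewrite (_ : integral _ _ _ = (\int[leb]_x (normc (fj al be x))%:E)%E).
    by apply: normc_lty; exact: cintble_fj.
  apply: ae_eq_integral => //.
  - exact/measurable_EFinP/measurable_normc.
  - by apply/measurable_EFinP/measurable_normc; apply: cintble_meas; exact: cintble_fj.
  - move: gae; apply: filterS.
    by move=> x -> _.
have [M psiM] := psi0_bound.
rewrite -sqg.
have -> : fhat (fj al be) = fhat g.
  by apply/funext => xi; apply: fhat_ae => //; apply: cintble_meas; exact: cintble_fj.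
have cphase : continuous (fun x : R => 2 * pi * (al * x + be * Num.max 0 x)).
  move=> x; apply: cvgM; first exact: cvg_cst.
  apply: cvgD; apply: cvgM; (try exact: cvg_cst); first exact: cvg_id.
  by apply: continuous_max; [exact: cvg_cst|exact: cvg_id].
have [cR cI] := psi0_continuous.
have ccos : continuous (fun x : R => cos (2 * pi * (al * x + be * Num.max 0 x))).
  by move=> x; apply: continuous_comp; [exact: cphase|exact: continuous_cos].
have csin : continuous (fun x : R => sin (2 * pi * (al * x + be * Num.max 0 x))).
  by move=> x; apply: continuous_comp; [exact: cphase|exact: continuous_sin].
apply: (@plancherel_ge _ _ M) => //.
- by move=> x; rewrite normcM normc_cexpi mul1r.
- under eq_fun do rewrite RecM; move=> x; apply: cvgB; apply: cvgM.
  + exact: ccos.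
  + exact: cR.
  + exact: csin.
  + exact: cI.
- under eq_fun do rewrite ImcM; move=> x; apply: cvgD; apply: cvgM.
  + exact: ccos.
  + exact: cI.
  + exact: csin.
  + exact: cR.
Qed.

(** The phase is linear on each half-line, of slope [al + be] on the right and [al] on the left, and
    a linear phase translates the spectrum. *)
Lemma fhat_fj al be xi :
  fhat (fj al be) xi = fhat (part true) (xi - (al + be)) + fhat (part false) (xi - al).
Proof.
rewrite /fhat -cintD; try exact: cintble_fhat.
apply: eq_cint => x; rewrite /fj /part.
have [x0|x0] := leP x 0.
  rewrite !indicE memNset ?mem_set/=; last 2 first.
  - by rewrite in_itv/=.
  - by rewrite in_itv/= andbT ltNge x0.
  rewrite !mul0r mul1r add0r mulrAC -cexpiD mulrC; congr (_ * cexpi _).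
  by rewrite mulr0 addr0; ring.
rewrite !indicE mem_set ?memNset/=; last 2 first.
- by rewrite in_itv/= leNgt x0.
- by rewrite in_itv/= andbT.
rewrite !mul0r mul1r addr0 mulrAC -cexpiD mulrC; congr (_ * cexpi _).
by ring.
Qed.

(** Young's inequality with a weight: a small [k] costs the main term [a] little and puts the large
    factor on [b], which will be a small tail. *)
Lemma sq_normcD_le (a b : R[i]) (k : R) : 0 < k ->
  normc (a + b) ^+ 2 <= (1 + k) * normc a ^+ 2 + (1 + k^-1) * normc b ^+ 2.
Proof.
move=> k0; apply: (@le_trans _ _ ((normc a + normc b) ^+ 2)).
  by rewrite lerXn2r ?nnegrE ?addr_ge0 ?normc_ge0// le_normcD.
rewrite -subr_ge0 (_ : _ - _ = k^-1 * (k * normc a - normc b) ^+ 2).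
  by rewrite mulr_ge0 ?sqr_ge0// invr_ge0 ltW.
by field; rewrite gt_eqF.
Qed.

(** The half-width [4 K] covers the tolerance [3 K] of a tube plus the width of one cell, which will
    be at most [K / 2]. *)
Let window (y : R) : set T := `[y - 4 * K, y + 4 * K]%classic.

(* If the two frequencies [al] and [al + be] are far apart, a window of bounded length
   is far from one of them, hence sees almost only one of the two half-line parts. *)
Lemma fhat_fj_window : exists c : R, [/\ 0 < c, c < 1 & exists D : R, forall al be y,
  D <= `|be| ->
  (\int[leb]_xi (\1_(window y) xi * normc (fhat (fj al be) xi) ^+ 2)%:E <= c%:E)%E].
Proof.
have [q [q0 q1 mq]] := mass_lt1.
(* The main part will contribute at most [(1 + k) q] and the tail [(1 + k^-1) e = k]; the sum is at
   most [q + 2 k = (1 + q) / 2 < 1]. *)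
pose k := (1 - q) / 4.
have k0 : 0 < k by rewrite divr_gt0// subr_gt0.
pose e := k / (1 + k^-1).
have k1 : 0 < 1 + k^-1 by rewrite addr_gt0// invr_gt0.
have e0 : 0 < e by rewrite divr_gt0.
have k10 : 0 <= 1 + k by rewrite addr_ge0// ltW.
have mF s : cmeas (fhat (part s)) by exact: cmeas_fhat.
have sqF s : (sqint leb (fhat (part s)) <= q%:E)%E.
  by rewrite (le_trans _ (mq s))// plancherel_le.
have tl s : exists X : R,
    (\int[leb]_x (\1_(~` `[- X, X]%classic) x * normc (fhat (part s) x) ^+ 2)%:E <= e%:E)%E.
  by apply: (sqint_tail (mF s) _ e0); rewrite (le_lt_trans (sqF s))// ltry.
have [Xt ht] := tl true; have [Xf hf] := tl false.
exists ((1 + q) / 2); split; first by rewrite divr_gt0// ltr_wpDr.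
  by rewrite ltr_pdivrMr// mul1r -[2]/(1 + 1) ltrD2l.
pose X s := if s then Xt else Xf.
have hX s : (\int[leb]_x (\1_(~` `[- X s, X s]%classic) x * normc (fhat (part s) x) ^+ 2)%:E <= e%:E)%E.
  by case: s; [exact: ht|exact: hf].
(* The distances from [y] to [al] and to [al + be] add up to at least [|be|], so with this threshold
   one of them exceeds [max Xt Xf + 4 K]. *)
exists (2 * (Num.max Xt Xf + 4 * K) + 1) => al be y beD.
pose ctr s := if s then al + be else al.
(* The half [s] is the one centred far from the window: there its spectrum [A] is seen only outside
   [[- X s, X s]]. *)
have [s far] : exists s, Num.max Xt Xf + 4 * K < `|y - ctr s|.
  have : `|be| <= `|y - al| + `|y - (al + be)|.
    rewrite [leLHS](_ : _ = `|(y - al) - (y - (al + be))|); first exact: ler_normB.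
    by congr `|_|; ring.
  have [h1|h1] := ltP (Num.max Xt Xf + 4 * K) `|y - al|; first by exists false.
  by move=> h2; exists true => /=; lra.
have XM : X s <= Num.max Xt Xf by rewrite /X le_max; case: (s); rewrite lexx ?orbT.
pose A xi := fhat (part s) (xi - ctr s); pose B xi := fhat (part (~~ s)) (xi - ctr (~~ s)).
have msh (a : R) : measurable_fun [set: T] (fun x : T => x - a : T).
  exact: (measurable_shift (- a)).
have mA : cmeas A by exact: (cmeas_comp (mF s) (msh _)).
have mB : cmeas B by exact: (cmeas_comp (mF (~~ s)) (msh _)).
have fE xi : fhat (fj al be) xi = B xi + A xi.
  by rewrite fhat_fj /A /B /ctr; case: (s) => //=; rewrite addrC.
have T0 (z : T) (w : R[i]) : 0 <= (\1_(~` `[- X s, X s]%classic) z : R) * normc w ^+ 2.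
  by rewrite indicE; case: (_ \in _); rewrite ?mul1r ?mul0r// sqr_ge0.
have mw : measurable_fun setT (\1_(window y) : T -> R).
  by apply: measurable_indic; exact: measurable_itv.
apply: (@le_trans _ _ (\int[leb]_xi ((1 + k) * normc (B xi) ^+ 2 +
    (1 + k^-1) * (\1_(~` `[- X s, X s]%classic) (xi - ctr s) * normc (A xi) ^+ 2))%:E)%E).
  have mi : measurable_fun [set: T] (fun xi : T => \1_(~` `[- X s, X s]%classic) (xi - ctr s) : R).
    have mm : measurable_fun [set: T] (\1_(~` `[- X s, X s]%classic) : T -> R).
      by apply: measurable_indic; exact: measurableC.
    exact: (measurableT_comp mm (msh _)).
  apply: ge0_le_integral => //.
  - by move=> xi _; rewrite lee_fin mulr_ge0 ?sqr_ge0// indicE.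
  - apply/measurable_EFinP/measurable_funM => //; apply/measurable_funX/measurable_normc.
    by apply: cmeas_fhat; exact: cintble_fj.
  - apply/measurable_EFinP/measurable_funD; apply: measurable_funM => //.
      by apply/measurable_funX/measurable_normc.
    by apply: measurable_funM => //; apply/measurable_funX/measurable_normc.
  - move=> xi _; rewrite lee_fin fE [X in X * _ <= _]indicE.
    have [/set_mem hw|_] := boolP (xi \in window y); last first.
      rewrite mul0r; apply: addr_ge0; apply: mulr_ge0 => //; first exact: sqr_ge0.
      exact: ltW.
    rewrite mul1r (le_trans (sq_normcD_le _ _ k0))// lerD2l ler_pM2l//.
    rewrite indicE mem_set ?mul1r// /setC/= in_itv/= => /andP[h1 h2].
    move: hw; rewrite /window/= in_itv/= => /andP[h3 h4].
    have : `|y - ctr s| <= X s + 4 * K.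
      rewrite ler_norml; apply/andP; split; lra.
    by move=> h5; lra.
under eq_integral do rewrite EFinD.
rewrite ge0_integralD//; last 4 first.
- by move=> xi _; rewrite lee_fin mulr_ge0 ?sqr_ge0.
- apply/measurable_EFinP/measurable_funM => //.
  by apply/measurable_funX/measurable_normc.
- by move=> xi _; rewrite lee_fin; apply: mulr_ge0 => //; exact: ltW.
- apply/measurable_EFinP/measurable_funM => //; apply: measurable_funM.
    have mm : measurable_fun [set: T] (\1_(~` `[- X s, X s]%classic) : T -> R).
      by apply: measurable_indic; exact: measurableC.
    exact: (measurableT_comp mm (msh _)).
  by apply/measurable_funX/measurable_normc.
have IB : (\int[leb]_xi ((1 + k) * normc (B xi) ^+ 2)%:E <= ((1 + k) * q)%:E)%E.
  under eq_integral do rewrite EFinM.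
  rewrite ge0_integralZl ?lee_fin//; last 2 first.
  - exact: (measurable_sq mB).
  - by move=> xi _; rewrite lee_fin sqr_ge0.
  rewrite EFinM; apply: lee_wpmul2l; first by rewrite lee_fin.
  apply: (le_trans _ (sqF (~~ s))).
  rewrite (@integral_shift _ (- ctr (~~ s)) (fun xi => (normc (fhat (part (~~ s)) xi) ^+ 2)%:E)).
    exact: lexx.
  exact: (measurable_sq (mF _)).
have IA : (\int[leb]_xi ((1 + k^-1) * (\1_(~` `[- X s, X s]%classic) (xi - ctr s) * normc (A xi) ^+ 2))%:E
    <= k%:E)%E.
  pose G (xi : T) := (\1_(~` `[- X s, X s]%classic) xi * normc (fhat (part s) xi) ^+ 2)%:E.
  have mG : measurable_fun setT G.
    apply/measurable_EFinP/measurable_funM.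
      by apply: measurable_indic; exact: measurableC.
    by apply: measurable_funX; exact: (measurable_normc (mF s)).
  have G0 xi : (0 <= G xi)%E by rewrite lee_fin T0.
  under eq_integral do rewrite EFinM.
  rewrite ge0_integralZl//; last 3 first.
  - by apply: (measurableT_comp mG); exact: msh.
  - by move=> xi _; exact: (G0 (xi - ctr s)).
  - by rewrite lee_fin ltW.
  rewrite (@integral_shift _ (- ctr s) G)//.
  apply: (@le_trans _ _ ((1 + k^-1)%:E * e%:E)%E).
    by apply: lee_wpmul2l; [rewrite lee_fin ltW|exact: hX].
  by rewrite -EFinM lee_fin /e mulrC divfK// gt_eqF.
apply: (le_trans (leeD IB IA)).
rewrite -EFinD lee_fin /k.
have : (1 - q) / 4 * q <= (1 - q) / 4 by rewrite ler_piMr ?ltW// divr_ge0// subr_ge0 ltW.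
lra.
Qed.

End bandlimited_window.

(** * Frequency cells *)

Section cells.
Local Open Scope complex_scope.
Context {R : realType}.
Local Notation leb := (@lebesgue_measure R).
Local Notation T := (measurableTypeR R).
Implicit Types (u : T -> R[i]).

(** As [u] is only integrable there is no Lipschitz bound. The phase difference is at most
    [min 2 (2 pi |x| / (p + 1))], uniformly in the frequencies, and dominated convergence makes its
    integral against [|u|] small. *)
Lemma fhat_unif_continuous u (e : R) : cintble leb u -> 0 < e ->
  exists p0 : nat, forall p : nat, (p0 <= p)%N -> forall xi eta : R,
    `|xi - eta| <= p.+1%:R^-1 -> normc (fhat u xi - fhat u eta) <= e.
Proof.
move=> iu e0.
pose g n (x : T) := normc (u x) * Num.min 2 (2 * pi * `|x| * n.+1%:R^-1).
have mu := cintble_meas iu.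
have g0 n x : 0 <= Num.min 2 (2 * pi * `|x| * n.+1%:R^-1) :> R.
  by rewrite le_min ler0n/= !mulr_ge0// pi_ge0.
have mg n : measurable_fun setT (g n).
  apply: measurable_funM; first exact: measurable_normc.
  have mm : measurable_fun setT (fun x : T => 2 * pi * `|x| * n.+1%:R^-1).
    have mn : measurable_fun [set: T] (fun x : T => `|x| : R) by exact: normr_measurable.
    exact: (measurable_funM (measurable_funM (measurable_cst (2 * pi : R)) mn)
      (measurable_cst (n.+1%:R^-1 : R))).
  exact: (measurable_minr (measurable_cst (2 : R)) mm).
have ig2 : leb.-integrable setT (EFin \o (fun x => 2 * normc (u x))).
  exact: (integrableZl _ _ (cintble_normc iu)).
have bg n x : `|g n x| <= 2 * normc (u x).
  rewrite ger0_norm ?mulr_ge0 ?normc_ge0// /g [leLHS]mulrC ler_wpM2r ?normc_ge0//.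
  by rewrite ge_min lexx.
have cv : \int[leb]_x g n x @[n --> \oo] --> \int[leb]_x (cst 0 x : R).
  apply: (@Rdominated_cvg _ T _ leb g (cst 0) (fun x => 2 * normc (u x))) => //.
  apply: aeW => x.
  have : (fun n => normc (u x) * (2 * pi * `|x| * eps n)) @ \oo --> normc (u x) * (2 * pi * `|x| * 0).
    by apply: cvgM; [exact: cvg_cst|apply: cvgM; [exact: cvg_cst|exact: cvg_eps]].
  rewrite !mulr0 => h; apply: (squeeze_cvgr _ (cvg_cst 0) h).
  apply: nearW => n; rewrite /g mulr_ge0 ?normc_ge0//= ler_wpM2l ?normc_ge0//.
  by rewrite ge_min lexx orbT.
rewrite Rintegral_cst// mul0r in cv.
have /cvgrPdist_le/(_ _ e0)[p0 _ hp] := cv.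
exists p0 => p pp xi eta xieta.
have fe : `|\int[leb]_x g p x| <= e by have := hp p pp; rewrite /= sub0r normrN.
rewrite (le_trans _ (le_trans (ler_norm _) fe))//.
have iF := cintble_fhat xi iu; have iG := cintble_fhat eta iu.
have -> : fhat u xi - fhat u eta = cint leb (fun x => u x * (cexpi (- (2 * pi * x * xi)) - cexpi (- (2 * pi * x * eta)))).
  rewrite -mulN1r /fhat -cintZ// -cintD//; last exact: cintbleZ.
  by apply: eq_cint => x; ring.
have iH : cintble leb (fun x => u x * (cexpi (- (2 * pi * x * xi)) - cexpi (- (2 * pi * x * eta)))).
  apply: (cintbleM_bd (M := 2) iu).
    by apply: cmeasB; exact: cmeas_phase.
  by move=> x; rewrite (le_trans (le_normcB _ _))// !normc_cexpi.
rewrite (le_trans (normc_cint iH))//; apply: le_Rintegral => //.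
- exact: cintble_normc.
- apply: (le_integrable _ _ _ ig2) => //; first exact/measurable_EFinP.
  by move=> x _ /=; rewrite lee_fin (le_trans (bg p x))// ler_norm.
move=> x _; rewrite normcM ler_wpM2l ?normc_ge0// le_min; apply/andP; split.
  by rewrite (le_trans (le_normcB _ _))// !normc_cexpi.
rewrite (le_trans (cexpi_lip _ _))//.
rewrite (_ : _ - _ = 2 * pi * x * (eta - xi)); last by ring.
rewrite !normrM (@ger0_norm _ 2)// (ger0_norm (pi_ge0 _)) distrC ler_wpM2l//.
by rewrite !mulr_ge0// pi_ge0.
Qed.

Variables (a del : R).
Hypothesis del0 : 0 < del.

Definition cell (n : nat) : set T := `[a + n%:R * del, a + n.+1%:R * del[%classic.

Lemma measurable_cell n : measurable (cell n). Proof. exact: measurable_itv. Qed.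

Lemma integrable_cell n : leb.-integrable setT (EFin \o (\1_(cell n) : T -> R)).
Proof. exact: integrable_indic_itv. Qed.

Lemma integral_cell n : \int[leb]_x (\1_(cell n) x : R) = del.
Proof.
have E : leb (cell n) = del%:E.
  rewrite /cell lebesgue_measure_itv/= lte_fin ltrD2l ltr_pM2r// ltr_nat leqnn.
  by rewrite -EFinB/= -natr1; congr (_%:E); ring.
rewrite /Rintegral integral_indic//; last exact: measurable_cell.
by rewrite setIT; exact: (congr1 fine E).
Qed.

Lemma cell_inj n m x : cell n x -> cell m x -> n = m.
Proof.
rewrite /cell/= !in_itv/= => /andP[n1 n2] /andP[m1 m2].
have h (i j : nat) : a + i%:R * del <= x -> x < a + j.+1%:R * del -> (i <= j)%N.
  move=> h1 h2; have := le_lt_trans h1 h2.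
  by rewrite ltrD2l ltr_pM2r// ltr_nat ltnS.
by apply/eqP; rewrite eqn_leq (h n m)// (h m n).
Qed.

Lemma indic_cellE n m x : cell n x -> \1_(cell m) x = (n == m)%:R :> R.
Proof.
move=> nx; rewrite indicE; have [<-|nm] := eqVneq n m; first by rewrite mem_set.
by rewrite memNset// => mx; move/eqP: nm; apply; exact: cell_inj nx mx.
Qed.

Lemma sum_cells m x :
  \sum_(i < m) \1_(cell i) x = \1_(`[a, a + m%:R * del[%classic) x :> R.
Proof.
elim: m => [|m ih].
  by rewrite big_ord0 mul0r addr0 set_itvco0 indicE memNset.
rewrite big_ord_recr/= ih !indicE /cell !mem_setE !in_itv/=.
have am : a <= a + m%:R * del by rewrite lerDl mulr_ge0// ltW.
have mm : a + m%:R * del <= a + m.+1%:R * del by rewrite lerD2l ler_pM2r// ler_nat.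
have [xm|xm] := ltP x (a + m%:R * del).
  by rewrite (lt_le_trans xm mm) addr0.
by rewrite andbF add0r (le_trans am xm).
Qed.

Lemma sum_cells_sub m (P : pred 'I_m) (W : set T) x :
  (forall i, P i -> cell i `<=` W) -> \sum_(i < m | P i) \1_(cell i) x <= \1_W x :> R.
Proof.
move=> PW; have [Wx|Wx] := pselect (W x); last first.
  rewrite big1 ?indicE ?ler0n// => i Pi; rewrite indicE memNset// => ix.
  by apply: Wx; exact: PW ix.
rewrite [leRHS]indicE mem_set//.
rewrite (@le_trans _ _ (\sum_(i < m) \1_(cell i) x))//.
  by rewrite [leRHS](bigID P)/= lerDl sumr_ge0.
by rewrite sum_cells indicE; case: (_ \in _).
Qed.

Let rd : R := Num.sqrt del^-1.

Let rd2 : rd ^+ 2 = del^-1. Proof. by rewrite sqr_sqrtr// invr_ge0 ltW. Qed.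

(* No conjugation is used in pairings with [bt]: [coef u n] is, up to the factor
   [sqrt del], the mean of [fhat u] over the [n]-th cell. *)
Definition bt (n : nat) (x : R) : R[i] :=
  (Num.sqrt del^-1)%:C * fhat (fun xi => (\1_(cell n) xi)%:C) x.

Lemma cintble_cell n : cintble leb (fun xi : T => (\1_(cell n) xi)%:C).
Proof. by split => /=; [exact: integrable_cell|exact: integrable0]. Qed.

Lemma cmeas_bt n : cmeas (bt n : T -> R[i]).
Proof.
apply: cmeasM; first exact: cmeas_cst.
by apply: cmeas_fhat; exact: cintble_cell.
Qed.

(** The combination is the transform of a step function whose squared norm is the right-hand side,
    since the cells are disjoint; then [plancherel_le]. *)
Lemma bt_contraction m (c : 'I_m -> R[i]) :
  (sqint leb (fun x => (\sum_(i < m) c i * bt i x)%R) <= (\sum_(i < m) normc (c i) ^+ 2)%:E)%E.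
Proof.
pose v (xi : T) := \sum_(i < m) (c i * rd%:C) * (\1_(cell i) xi)%:C.
have iv : cintble leb v.
  by apply: cintble_sum => i _; apply: cintbleZ; exact: cintble_cell.
have -> : (fun x => \sum_(i < m) c i * bt i x) = fhat v.
  apply/funext => x; rewrite /fhat /v; under [RHS]eq_cint do rewrite mulr_suml.
  rewrite cint_sum.
    apply: eq_bigr => i _; under [RHS]eq_cint do rewrite -mulrA.
    by rewrite cintZ ?mulrA//; apply: cintble_fhat; exact: cintble_cell.
  move=> i _; under eq_fun do rewrite -mulrA.
  by apply: cintbleZ; apply: cintble_fhat; exact: cintble_cell.
apply: (le_trans (plancherel_le iv)).
have vE xi : normc (v xi) ^+ 2 = \sum_(i < m) (normc (c i) ^+ 2 * del^-1) * \1_(cell i) xi.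
  rewrite /v; have [[i ix]|ni] := pselect (exists i : 'I_m, cell i xi).
    rewrite (bigD1 i)//= [X in _ + X]big1 ?addr0; last first.
      move=> j ji; rewrite (indic_cellE _ ix) eq_sym (_ : (_ == _) = false) ?mulr0//.
      by apply/negbTE; apply: contra ji.
    rewrite [RHS](bigD1 i)//= [X in _ = _ + X]big1 ?addr0; last first.
      move=> j ji; rewrite (indic_cellE _ ix) eq_sym (_ : (_ == _) = false) ?mulr0//.
      by apply/negbTE; apply: contra ji.
    rewrite (indic_cellE _ ix) eqxx !mulr1 normcM normc_real.
    by rewrite exprMn real_normK ?num_real// rd2.
  have z (i : 'I_m) : \1_(cell i) xi = 0 :> R.
    by rewrite indicE memNset// => ix; apply: ni; exists i.
  rewrite !big1 ?normc0 ?expr0n// => i _; rewrite z ?mulr0//.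
rewrite /sqint; under eq_integral do rewrite vE -sumEFin.
rewrite ge0_integral_sum//; last 2 first.
- move=> i; apply/measurable_EFinP/measurable_funM => //.
  by apply: measurable_indic; exact: measurable_cell.
- move=> i xi _; rewrite lee_fin mulr_ge0 ?indicE//.
  by rewrite mulr_ge0 ?sqr_ge0// invr_ge0 ltW.
rewrite -sumEFin; apply: lee_sum => i _.
under eq_integral do rewrite EFinM.
rewrite ge0_integralZl//; last 2 first.
- by apply/measurable_EFinP; apply: measurable_indic; exact: measurable_cell.
- by rewrite lee_fin mulr_ge0 ?sqr_ge0// invr_ge0 ltW.
have -> : (\int[leb]_x (\1_(cell i) x)%:E)%E = del%:E.
  rewrite -(integral_cell i) fineK//.
  exact: integrable_fin_num (integrable_cell i).
by rewrite -EFinM divfK ?gt_eqF.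
Qed.

Definition coef u n : R[i] := cint leb (fun x => u x * bt n x).

Let cellint u n : R[i] := cint leb (fun xi => (\1_(cell n) xi)%:C * fhat u xi).

(** Multiplication formula: Fubini moves the transform from the indicator of the cell to [u]. *)
Lemma coefE u n : cintble leb u -> coef u n = rd%:C * cellint u n.
Proof.
move=> iu; have mu := cintble_meas iu.
pose F (z : T * T) := u z.1 * ((\1_(cell n) z.2)%:C * cexpi (2 * - pi * z.1 * z.2)).
have iF : cintble (leb \x leb)%E F.
  apply: (@cintble_prod_le _ _ T T R leb leb _ (fun x => normc (u x)) (\1_(cell n))) => //.
  - apply: cmeasM; first exact: (cmeas_comp mu measurable_fst).
    apply: cmeasM; last exact: cmeas_phase2.
    apply: cmeas_real; apply: (measurableT_comp _ measurable_snd).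
    by apply: measurable_indic; exact: measurable_cell.
  - exact: cintble_normc.
  - exact: integrable_cell.
  - move=> x xi; rewrite /F/= !normcM normc_cexpi mulr1 normc_real ger0_norm// indicE//.
have E x xi : cexpi (2 * - pi * x * xi) = cexpi (- (2 * pi * xi * x)) :> R[i].
  by congr cexpi; ring.
have ib x : cintble leb (fun xi => (\1_(cell n) xi)%:C * cexpi (2 * - pi * x * xi)).
  under eq_fun do rewrite E; exact: (cintble_fhat x (cintble_cell n)).
rewrite /coef /cellint; transitivity (rd%:C * cint leb (fun x => cint leb (fun xi => F (x, xi)))).
  rewrite -cintZ; last exact: cintble_cint1.
  apply: eq_cint => x; rewrite /F/= cintZ// mulrCA; congr (_ * (_ * _)).
  by apply: eq_cint => xi; rewrite E.
rewrite cint_swap//; congr (_ * _); apply: eq_cint => xi; rewrite /F/=.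
rewrite -cintZ; last exact: cintble_fhat.
apply: eq_cint => x; rewrite mulrCA; congr (_ * (_ * cexpi _)); ring.
Qed.

Let mass u n := \int[leb]_xi (\1_(cell n) xi * normc (fhat u xi) ^+ 2).

Let ibd (f : T -> R) (M : R) n : measurable_fun setT f -> (forall x, `|f x| <= M) ->
  leb.-integrable setT (EFin \o (fun x => \1_(cell n) x * f x)).
Proof.
move=> mf fM; have := integrableM_bd mf fM (integrable_cell n).
by apply: eq_integrable => // x _ /=; rewrite mulrC.
Qed.

(** Variance identity: [del^-1 * cellint u n] is the mean of [fhat u] over the cell, and the squared
    coefficient is [del] times the squared modulus of that mean. *)
Lemma cell_variance u n : cintble leb u ->
  \int[leb]_xi (\1_(cell n) xi * normc (fhat u xi - (del^-1)%:C * cellint u n) ^+ 2) =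
  mass u n - normc (coef u n) ^+ 2.
Proof.
move=> iu; set al := (del^-1)%:C * cellint u n.
pose M := \int[leb]_x normc (u x).
have mh : cmeas (fhat u) by exact: cmeas_fhat.
have bh xi : normc (fhat u xi) <= M by exact: normc_fhat.
have i1 : leb.-integrable setT (EFin \o (fun xi => \1_(cell n) xi * normc (fhat u xi) ^+ 2)).
  apply: (@ibd _ (M ^+ 2)); first exact/measurable_funX/measurable_normc.
  move=> x; rewrite ger0_norm ?sqr_ge0// lerXn2r ?nnegrE ?normc_ge0//.
  by rewrite (le_trans (normc_ge0 _) (bh 0)).
have ic : cintble leb (fun xi => (\1_(cell n) xi)%:C * fhat u xi).
  exact: (cintbleM_bd (cintble_cell n) mh bh).
have [i2 _] := cintbleZ (2%:C * conjc al) ic.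
have E xi : \1_(cell n) xi * normc (fhat u xi - al) ^+ 2 =
   (\1_(cell n) xi * normc (fhat u xi) ^+ 2 -
   Re (2%:C * conjc al * ((\1_(cell n) xi)%:C * fhat u xi))) + \1_(cell n) xi * normc al ^+ 2.
  rewrite !normc_sq; case: (fhat u xi) => x y; case: (al) => b c /=; ring.
under eq_Rintegral do rewrite E.
rewrite RintegralD//; last 2 first.
- exact: (integrableB _ i1 i2).
- by apply: (@ibd _ (normc al ^+ 2)) => // x; rewrite ger0_norm ?sqr_ge0.
rewrite RintegralB//.
rewrite RintegralZr//; last exact: integrable_cell.
rewrite integral_cell.
have -> : \int[leb]_x Re (2%:C * conjc al * ((\1_(cell n) x)%:C * fhat u x)) =
    Re (2%:C * conjc al * cellint u n) by rewrite -cintZ.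
rewrite coefE// -/(mass u n) -addrA; congr (_ + _).
rewrite /al; move: (cellint u n) => w.
rewrite !normcM !exprMn !normc_real !real_normK ?num_real// rd2.
rewrite !normc_sq; case: w => x y /=; field.
by rewrite gt_eqF.
Qed.

Lemma coef_le u n : cintble leb u -> normc (coef u n) ^+ 2 <= mass u n.
Proof.
move=> iu; rewrite -subr_ge0 -cell_variance//; apply: Rintegral_ge0 => xi _.
by rewrite mulr_ge0 ?sqr_ge0 ?indicE.
Qed.

(** If [fhat u] oscillates by at most [e] over a distance [del], it stays within [e] of its mean on
    the cell, so the variance is at most [e ^+ 2 * del]. *)
Lemma coef_ge u n (e : R) : cintble leb u ->
  (forall xi eta, `|xi - eta| <= del -> normc (fhat u xi - fhat u eta) <= e) ->
  mass u n - e ^+ 2 * del <= normc (coef u n) ^+ 2.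
Proof.
move=> iu ue; rewrite lerBlDr addrC -lerBlDr -cell_variance//.
have mh : cmeas (fhat u) by exact: cmeas_fhat.
have bh xi := normc_fhat xi iu.
have e0 : 0 <= e by rewrite (le_trans (normc_ge0 _) (ue 0 0 _))// subrr normr0 ltW.
have dC : (del^-1)%:C * del%:C = 1 :> R[i] by rewrite -rmorphM/= mulVf ?gt_eqF.
have cb xi : cell n xi -> normc (fhat u xi - (del^-1)%:C * cellint u n) <= e.
  move=> nxi.
  have ic : cintble leb (fun eta => (\1_(cell n) eta)%:C * fhat u eta).
    exact: (cintbleM_bd (cintble_cell n) mh bh).
  have intC : cint leb (fun eta => (\1_(cell n) eta)%:C) = del%:C.
    by apply: complex_eq => /=; rewrite ?integral_cell// Rintegral_cst// mul0r.
  have id : cintble leb (fun eta => (\1_(cell n) eta)%:C * (fhat u xi - fhat u eta)).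
    apply: (@cintbleM_bd _ _ _ _ _ _ (2 * \int[leb]_x normc (u x)) (cintble_cell n)).
      by apply: cmeasB => //; exact: cmeas_cst.
    by move=> eta; rewrite (le_trans (le_normcB _ _))// mulr_natl mulr2n lerD.
  have -> : fhat u xi - (del^-1)%:C * cellint u n =
     (del^-1)%:C * cint leb (fun eta => (\1_(cell n) eta)%:C * (fhat u xi - fhat u eta)).
    have -> : (fun eta => (\1_(cell n) eta)%:C * (fhat u xi - fhat u eta)) =
        (fun eta => fhat u xi * (\1_(cell n) eta)%:C + -1 * ((\1_(cell n) eta)%:C * fhat u eta)).
      by apply/funext => eta; ring.
    rewrite cintD; [|by apply: cintbleZ; exact: cintble_cell|exact: cintbleZ].
    rewrite cintZ; last exact: cintble_cell.
    rewrite cintZ// intC mulrDr mulrCA dC mulr1 mulN1r mulrN//.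
  rewrite normcM normc_real gtr0_norm ?invr_gt0// mulrC ler_pdivrMr//.
  rewrite (le_trans (normc_cint id))// -(integral_cell n).
  rewrite -RintegralZl//; last exact: integrable_cell.
  apply: le_Rintegral => //.
  - exact: cintble_normc.
  - exact: (integrableZl _ e (integrable_cell n)).
  move=> eta _; rewrite normcM normc_real.
  have [neta|neta] := pselect (cell n eta); last first.
    by rewrite indicE memNset// normr0 mul0r mulr0.
  rewrite indicE mem_set// normr1 mul1r mulr1; apply: ue.
  move: nxi neta; rewrite /cell/= !in_itv/= -natr1 mulrDl mul1r => /andP[h1 h2] /andP[h3 h4].
  by rewrite ler_norml; apply/andP; split; move: h1 h2 h3 h4; set b := n%:R * del; lra.
rewrite -[X in _ <= _ * X](integral_cell n) -RintegralZl//; last exact: integrable_cell.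
apply: le_Rintegral => //.
- apply: (@ibd _ ((\int[leb]_x normc (u x) + normc ((del^-1)%:C * cellint u n)) ^+ 2)).
    by apply/measurable_funX/measurable_normc; apply: cmeasB => //; exact: cmeas_cst.
  move=> x; rewrite ger0_norm ?sqr_ge0// lerXn2r ?nnegrE ?normc_ge0//.
    by apply: addr_ge0; [exact: le_trans (normc_ge0 _) (bh 0)|exact: normc_ge0].
  by apply: (le_trans (le_normcB _ _)); apply: lerD; [exact: bh|exact: lexx].
- exact: (integrableZl _ _ (integrable_cell n)).
move=> xi _; have [nxi|nxi] := pselect (cell n xi); last first.
  by rewrite indicE memNset// mul0r mulr0.
rewrite indicE mem_set// mul1r mulr1 lerXn2r ?nnegrE ?normc_ge0//; exact: cb.
Qed.

Lemma sum_coef_le u m (P : pred 'I_m) (W : set T) : cintble leb u -> measurable W ->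
  (forall i, P i -> cell i `<=` W) ->
  ((\sum_(i < m | P i) normc (coef u i) ^+ 2)%:E <=
   \int[leb]_xi (\1_W xi * normc (fhat u xi) ^+ 2)%:E)%E.
Proof.
move=> iu mW PW.
have mh : measurable_fun setT (fun xi : T => normc (fhat u xi) ^+ 2).
  by apply/measurable_funX/measurable_normc; exact: cmeas_fhat.
apply: (@le_trans _ _ (\sum_(i < m | P i) \int[leb]_xi (\1_(cell i) xi * normc (fhat u xi) ^+ 2)%:E)%E).
  rewrite -sumEFin; apply: lee_sum => i _.
  rewrite -[leRHS]fineK; first by rewrite lee_fin; exact: coef_le.
  apply: integrable_fin_num => //.
  apply: (@ibd _ ((\int[leb]_x normc (u x)) ^+ 2)) => // x.
  rewrite ger0_norm ?sqr_ge0// lerXn2r ?nnegrE ?normc_ge0//; last exact: normc_fhat.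
  by apply: Rintegral_ge0 => y _; exact: normc_ge0.
rewrite -big_filter -ge0_integral_sum//; last 2 first.
- move=> i; apply/measurable_EFinP/measurable_funM => //.
  by apply: measurable_indic; exact: measurable_cell.
- by move=> i xi _; rewrite lee_fin mulr_ge0 ?sqr_ge0 ?indicE.
apply: ge0_le_integral => //.
- by move=> xi _; apply: sume_ge0 => i _; rewrite lee_fin mulr_ge0 ?sqr_ge0 ?indicE.
- apply: emeasurable_sum => i; apply/measurable_EFinP/measurable_funM => //.
  by apply: measurable_indic; exact: measurable_cell.
- by apply/measurable_EFinP/measurable_funM => //; exact: measurable_indic.
move=> xi _; rewrite big_filter sumEFin lee_fin -mulr_suml ler_wpM2r ?sqr_ge0//.
exact: sum_cells_sub.
Qed.

Lemma sum_coef_ge u m (e : R) : cintble leb u ->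
  (forall xi eta, `|xi - eta| <= del -> normc (fhat u xi - fhat u eta) <= e) ->
  (\int[leb]_xi (\1_(`[a, (a + m%:R * del)%R[%classic) xi * normc (fhat u xi) ^+ 2)%:E <=
   (\sum_(i < m) normc (coef u i) ^+ 2 + e ^+ 2 * (m%:R * del))%:E)%E.
Proof.
move=> iu ue.
have mh : measurable_fun setT (fun xi : T => normc (fhat u xi) ^+ 2).
  by apply/measurable_funX/measurable_normc; exact: cmeas_fhat.
have -> : (\int[leb]_xi (\1_(`[a, (a + m%:R * del)%R[%classic) xi * normc (fhat u xi) ^+ 2)%:E =
    \sum_(i < m) \int[leb]_xi (\1_(cell i) xi * normc (fhat u xi) ^+ 2)%:E)%E.
  rewrite -ge0_integral_sum//; last 2 first.
  - move=> i; apply/measurable_EFinP/measurable_funM => //.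
    by apply: measurable_indic; exact: measurable_cell.
  - by move=> i xi _; rewrite lee_fin mulr_ge0 ?sqr_ge0 ?indicE.
  by apply: eq_integral => xi _; rewrite sumEFin -mulr_suml sum_cells.
apply: (@le_trans _ _ (\sum_(i < m) (normc (coef u i) ^+ 2 + e ^+ 2 * del)%:E)%E).
  apply: lee_sum => i _; rewrite -[leLHS]fineK.
    by rewrite lee_fin -lerBlDr; exact: coef_ge.
  apply: integrable_fin_num => //.
  apply: (@ibd _ ((\int[leb]_x normc (u x)) ^+ 2)) => // x.
  rewrite ger0_norm ?sqr_ge0// lerXn2r ?nnegrE ?normc_ge0//; last exact: normc_fhat.
  by apply: Rintegral_ge0 => y _; exact: normc_ge0.
rewrite sumEFin lee_fin big_split/= lerD2l sumr_const card_ord -mulr_natr.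
by rewrite le_eqVlt; apply/orP; left; apply/eqP; ring.
Qed.

End cells.

(** * Integrals over tuples *)

Section coef_total.
Local Open Scope complex_scope.
Context {R : realType}.
Local Notation leb := (@lebesgue_measure R).
Local Notation T := (measurableTypeR R).

(** Both parameters come as thresholds so that a common range [L] and a common mesh [p] can later
    serve all coordinates. The mesh threshold comes after [L], because the oscillation error is
    multiplied by the length [2 L]. *)
Lemma coef_total_ge (u : T -> R[i]) (e : R) : cintble leb u -> sqint leb (fhat u) = 1%E ->
  0 < e -> exists L0 : nat, forall L : nat, (L0 <= L)%N ->
  exists p0 : nat, forall p : nat, (p0 <= p)%N ->
  1 - e <= \sum_(i < 2 * L * p.+1) normc (coef (- L%:R) p.+1%:R^-1 u i) ^+ 2.
Proof.
move=> iu u1 e0; have e20 : 0 < e / 2 by rewrite divr_gt0.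
have mh : cmeas (fhat u) by exact: cmeas_fhat.
have [|X hX] := sqint_tail mh _ e20; first by rewrite u1 ltry.
exists (Num.truncn `|X|).+1 => L LX.
have XL : X < L%:R.
  rewrite (le_lt_trans (ler_norm _))// (lt_le_trans (truncnS_gt _))// ler_nat//.
(* Gives [w ^+ 2 * (2 L) <= w * (2 L + 1) <= e / 2]; the other [e / 2] pays for the tail outside
   [[- X, X]]. *)
pose w := Num.min 1 (e / 2 / (2 * L%:R + 1)).
have L0 : 0 < 2 * (L%:R : R) + 1 by rewrite ltr_wpDl// mulr_ge0.
have w0 : 0 < w by rewrite lt_min ltr01 divr_gt0.
have [p0 hp] := fhat_unif_continuous iu w0.
exists p0 => p pp; have d0 : 0 < (p.+1%:R^-1 : R) by rewrite invr_gt0.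
have := sum_coef_ge (- L%:R) d0 (2 * L * p.+1) iu (hp p pp).
have mE : - L%:R + (2 * L * p.+1)%:R * p.+1%:R^-1 = L%:R :> R.
  by rewrite !natrM; field; rewrite nat1r pnatr_eq0.
have mE2 : (2 * L * p.+1)%:R * p.+1%:R^-1 = 2 * L%:R :> R.
  by rewrite !natrM; field; rewrite nat1r pnatr_eq0.
rewrite mE mE2 => h.
set S := \sum_(i < _) _ in h *.
have sq_eq : (\int[leb]_x (\1_(`[- L%:R, L%:R[%classic) x * normc (fhat u x) ^+ 2)%:E +
   \int[leb]_x (\1_(~` `[- X, X]%classic) x * normc (fhat u x) ^+ 2)%:E >= 1%:E)%E.
  have m1 : measurable_fun setT (fun x : T => (\1_(`[- L%:R, L%:R[%classic) x * normc (fhat u x) ^+ 2)%:E).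
    apply/measurable_EFinP/measurable_funM; last exact/measurable_funX/measurable_normc.
    by apply: measurable_indic; exact: measurable_itv.
  have m2 : measurable_fun setT (fun x : T => (\1_(~` `[- X, X]%classic) x * normc (fhat u x) ^+ 2)%:E).
    apply/measurable_EFinP/measurable_funM; last exact/measurable_funX/measurable_normc.
    by apply: measurable_indic; exact: measurableC.
  rewrite -ge0_integralD//.
  - rewrite -u1; apply: ge0_le_integral => //.
    + by move=> x _; rewrite lee_fin sqr_ge0.
    + exact: measurable_sq.
    + exact: emeasurable_funD.
    + move=> x _; rewrite -EFinD lee_fin -mulrDl ler_peMl ?sqr_ge0//.
      have [xX|xX] := pselect ((~` `[- X, X]%classic) x).
        by rewrite [X in _ <= _ + X]indicE mem_set// lerDr indicE.
      rewrite [X in _ <= X + _]indicE mem_set ?lerDl ?indicE//=.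
      move/contrapT : xX; rewrite /= !in_itv/= => /andP[x1 x2].
      by rewrite (le_lt_trans x2 XL) andbT (le_trans _ x1)// lerN2 ltW.
  - by move=> x _; rewrite lee_fin mulr_ge0 ?sqr_ge0 ?indicE.
  - by move=> x _; rewrite lee_fin mulr_ge0 ?sqr_ge0 ?indicE.
have := le_trans sq_eq (leeD h hX); rewrite -EFinD lee_fin => fin.
have : w ^+ 2 * (2 * L%:R) <= e / 2.
  have h1 : w ^+ 2 <= w by rewrite expr2; apply: ler_piMl; [exact: ltW|rewrite ge_min lexx].
  have h2 : w * (2 * L%:R + 1) <= e / 2.
    by rewrite -ler_pdivlMr// ge_min lexx orbT.
  rewrite (le_trans _ h2)// (@le_trans _ _ (w * (2 * L%:R)))//.
    by rewrite ler_wpM2r// mulr_ge0.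
  by apply: ler_wpM2l; [exact: ltW|rewrite lerDl].
by move: fin; set q := w ^+ 2 * _; lra.
Qed.

Lemma coef_total_le (u : T -> R[i]) (a del : R) m : cintble leb u -> sqint leb (fhat u) = 1%E ->
  0 < del -> \sum_(i < m) normc (coef a del u i) ^+ 2 <= 1.
Proof.
move=> iu u1 d0.
have h := sum_coef_le d0 (P := xpredT) (W := setT) iu measurableT (fun i _ => @subsetT _ _).
rewrite -lee_fin -u1 (le_trans (h a m))// le_eqVlt; apply/orP; left; apply/eqP.
by apply: eq_integral => x _; rewrite indicT mul1r.
Qed.

End coef_total.

(** * Fubini for the measure on tuples, along any coordinate *)

Section tuple_integrals.
Local Open Scope complex_scope.
Context {R : realType}.
Local Notation leb := (@lebesgue_measure R).
Local Notation T := (measurableTypeR R).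
Local Notation LT := (lebesgue_tuple R).

Lemma lebesgue_tuple0_setT : LT 0 setT = 1%E.
Proof. exact: diracT. Qed.

Lemma ge0_integral_cons d (f : d.+1.-tuple T -> \bar R) : measurable_fun setT f ->
  (forall t, 0 <= f t)%E ->
  (\int[LT d.+1]_t f t = \int[leb]_x \int[LT d]_t f (tuple_cons (x, t)))%E.
Proof.
move=> mf f0.
transitivity (\int[(leb \x LT d)%E]_z f (tuple_cons z))%E.
  by rewrite -[RHS](ge0_integral_pushforward (measurable_tuple_cons (R:=R) (d:=d)) (leb \x LT d)%E measurableT mf).
rewrite fubini_tonelli1//; apply: (measurableT_comp mf); exact: measurable_tuple_cons.
Qed.

Lemma cint_cons d (F : d.+1.-tuple T -> R[i]) : cmeas F ->
  cintble (leb \x LT d)%E (F \o @tuple_cons R d) ->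
  cintble (LT d.+1) F /\ cint (LT d.+1) F = cint (leb \x LT d)%E (F \o @tuple_cons R d).
Proof.
move=> [m1 m2] [i1 i2]; have mc := measurable_tuple_cons (R:=R) (d:=d).
have e1 : measurable_fun setT (EFin \o (fun t => Re (F t))) by exact/measurable_EFinP.
have e2 : measurable_fun setT (EFin \o (fun t => Im (F t))) by exact/measurable_EFinP.
split.
  split.
    exact: (integrable_pushforward mc e1 i1 measurableT).
  exact: (integrable_pushforward mc e2 i2 measurableT).
apply: complex_eq => /=; rewrite /Rintegral; congr fine.
  exact: (integral_pushforward mc e1 i1 measurableT).
exact: (integral_pushforward mc e2 i2 measurableT).
Qed.

Lemma cmeas_tnth d (u : T -> R[i]) (j : 'I_d) : cmeas u ->
  cmeas (fun t : d.-tuple T => u (tnth t j)).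
Proof. by move=> mu; exact: (cmeas_comp mu (measurable_tnth j)). Qed.

Lemma cint_prod d (u : 'I_d -> T -> R[i]) : (forall j, cintble leb (u j)) ->
  cintble (LT d) (fun t => \prod_(j < d) u j (tnth t j)) /\
  cint (LT d) (fun t => \prod_(j < d) u j (tnth t j)) = \prod_(j < d) cint leb (u j).
Proof.
elim: d u => [|d ih] u iu.
  rewrite big_ord0; under eq_fun do rewrite big_ord0; split.
    apply: cintble_lty; first exact: cmeas_cst.
    by rewrite integral_cst// [X in (_ * X)%E]lebesgue_tuple0_setT mule1 ltry.
  by rewrite /cint !Rintegral_cst// ![X in fine X]lebesgue_tuple0_setT/= mul0r mulr1.
have mF : cmeas (fun t : d.+1.-tuple T => \prod_(j < d.+1) u j (tnth t j)).
  by apply: cmeas_prod => j; apply: cmeas_tnth; exact: cintble_meas.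
have [ip ep] := ih (fun j => u (lift ord0 j)) (fun j => iu _).
pose G (z : T * d.-tuple T) := u ord0 z.1 * \prod_(j < d) u (lift ord0 j) (tnth z.2 j).
have FG : (fun t : d.+1.-tuple T => \prod_(j < d.+1) u j (tnth t j)) \o @tuple_cons R d = G.
  apply/funext => -[x t]; rewrite /G/= big_ord_recl tnth0; congr (_ * _).
  by apply: eq_bigr => j _; rewrite tnthS.
have iG : cintble (leb \x LT d)%E G.
  apply: (@cintble_prod_le _ _ T _ R leb (LT d) _ (fun x => normc (u ord0 x))
    (fun t => normc (\prod_(j < d) u (lift ord0 j) (tnth t j)))).
  - rewrite -FG; exact: (cmeas_comp mF (measurable_tuple_cons (R:=R) (d:=d))).
  - exact: cintble_normc.
  - exact: cintble_normc.
  - by move=> x t; rewrite /G/= normcM.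
have [|i1 ->] := cint_cons mF; first by rewrite FG.
split=> //; rewrite FG -cint12// big_ord_recl -ep -cintZr//.
by apply: eq_cint => x; rewrite /G/= cintZ.
Qed.

(* Inserts [z.1] as the [i]-th coordinate. *)
Definition ins d (i : 'I_d.+1) (z : T * d.-tuple T) : d.+1.-tuple T :=
  [tuple if unlift i k is Some k' then tnth z.2 k' else z.1 | k < d.+1].

Lemma ins_id d (i : 'I_d.+1) z : tnth (ins i z) i = z.1.
Proof. by rewrite tnth_mktuple unlift_none. Qed.

Lemma ins_lift d (i : 'I_d.+1) z k : tnth (ins i z) (lift i k) = tnth z.2 k.
Proof. by rewrite tnth_mktuple liftK. Qed.

Lemma measurable_ins d (i : 'I_d.+1) : measurable_fun [set: T * d.-tuple T] (ins i).
Proof.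
apply/measurable_fun_tnthP => k.
case: (unliftP i k) => [k' ->|->].
  rewrite (_ : _ \o _ = fun z => tnth z.2 k'); last by apply/funext => z; rewrite /= ins_lift.
  exact: (measurableT_comp (measurable_tnth k') measurable_snd).
rewrite (_ : _ \o _ = fst); first exact: measurable_fst.
by apply/funext => z; rewrite /= ins_id.
Qed.

Lemma ins0 d z : ins ord0 z = tuple_cons z :> d.+1.-tuple T.
Proof.
case: z => x t; apply: eq_from_tnth => k.
by case: (unliftP ord0 k) => [k' ->|->]; rewrite ?ins_lift ?ins_id/= ?tnthS.
Qed.

Lemma ins_cons d (i : 'I_d.+1) x y (t : d.-tuple T) :
  ins (lift ord0 i) (x, tuple_cons (y, t)) = tuple_cons (y, ins i (x, t)).
Proof.
apply: eq_from_tnth => k.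
case: (unliftP (lift ord0 i) k) => [k' ->|->]; last by rewrite ins_id/= tnthS ins_id.
rewrite ins_lift/=; case: (unliftP ord0 k') => [k'' ->|->].
  have -> : lift (lift ord0 i) (lift ord0 k'') = lift ord0 (lift i k'').
    apply: val_inj => /=; rewrite /bump/=; lia.
  by rewrite !tnthS ins_lift.
have -> : lift (lift ord0 i) ord0 = ord0 by apply: val_inj.
by rewrite !tnth0.
Qed.

(** The measure is built by adding a first coordinate. For another index, Tonelli exchanges the
    first coordinate with the inserted one, inside an induction on [d]. *)
Lemma ge0_integral_ins d (i : 'I_d.+1) (f : d.+1.-tuple T -> \bar R) : measurable_fun setT f ->
  (forall t, 0 <= f t)%E ->
  (\int[LT d.+1]_t f t = \int[leb]_x \int[LT d]_t f (ins i (x, t)))%E.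
Proof.
elim: d i f => [|d ih] i f mf f0.
  rewrite (ord1 i) ge0_integral_cons//.
  by apply: eq_integral => x _; apply: eq_integral => t _; rewrite ins0.
case: (unliftP ord0 i) => [i' ->|->]; last first.
  rewrite ge0_integral_cons//.
  by apply: eq_integral => x _; apply: eq_integral => t _; rewrite ins0.
rewrite ge0_integral_cons//.
have mfc y : measurable_fun setT (fun t : d.+1.-tuple T => f (tuple_cons (y, t))).
  apply: (measurableT_comp mf).
  exact: (measurableT_comp (measurable_tuple_cons (R:=R) (d:=d.+1)) (measurable_pair1 y)).
under eq_integral => y _ do rewrite (ih i')//.
have mins x y : measurable_fun [set: d.-tuple T] (fun t => f (tuple_cons (y, ins i' (x, t)))).
  apply: (measurableT_comp (mfc y)).
  exact: (measurableT_comp (measurable_ins i') (measurable_pair1 x)).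
pose H (z : T * T) := (\int[LT d]_t f (tuple_cons (z.1, ins i' (z.2, t))))%E.
have mH : measurable_fun setT H.
  apply: (measurable_fun_fubini_tonelli_F (m2 := LT d)
    (fun w : (T * T) * d.-tuple T => f (tuple_cons (w.1.1, ins i' (w.1.2, w.2))))) => //.
  apply: (measurableT_comp mf).
  apply: (measurableT_comp (measurable_tuple_cons (R:=R) (d:=d.+1))).
  apply/measurable_fun_pairP; split => /=.
    exact: (measurableT_comp measurable_fst measurable_fst).
  apply: (measurableT_comp (measurable_ins i')).
  apply/measurable_fun_pairP; split => /=; last exact: measurable_snd.
  exact: (measurableT_comp measurable_snd measurable_fst).
have H0 z : (0 <= H z)%E by apply: integral_ge0 => t _.
rewrite (fubini_tonelli H)//; apply: eq_integral => x _.
rewrite ge0_integral_cons//.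
  apply: eq_integral => y _; rewrite /H/=.
  by apply: eq_integral => t _; rewrite ins_cons.
apply: (measurableT_comp mf).
exact: (measurableT_comp (measurable_ins _) (measurable_pair1 x)).
Qed.

(** On indicators the Tonelli form says that the measure is the pushforward by [ins i] of the
    product measure; the integrable case is then a change of variables. *)
Lemma cint_ins d (i : 'I_d.+1) (F : d.+1.-tuple T -> R[i]) : cintble (LT d.+1) F ->
  cintble (leb \x LT d)%E (F \o ins i) /\
  cint (LT d.+1) F = cint (leb \x LT d)%E (F \o ins i).
Proof.
move=> iF; have mF := cintble_meas iF; have [m1 m2] := mF; have mi := measurable_ins i.
have iFi : cintble (leb \x LT d)%E (F \o ins i).
  apply: cintble_lty12; first exact: (cmeas_comp mF mi).
  rewrite -(@ge0_integral_ins d i (fun t => (normc (F t))%:E)).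
  - exact: normc_lty.
  - by apply/measurable_EFinP; exact: measurable_normc.
  - by move=> t; rewrite lee_fin normc_ge0.
split=> //; have [i1 i2] := iFi.
have mE (A : set (d.+1.-tuple T)) : measurable A -> A `<=` setT ->
    LT d.+1 A = pushm (leb \x LT d)%E mi A.
  move=> mA _; transitivity (\int[LT d.+1]_t (\1_A t)%:E)%E.
    by rewrite integral_indic// setIT.
  rewrite (ge0_integral_ins i)//; last by apply/measurable_EFinP; exact: measurable_indic.
  rewrite -(fubini_tonelli1 (fun z => (\1_A (ins i z))%:E))//.
    transitivity (\int[(leb \x LT d)%E]_z (\1_(ins i @^-1` A) z)%:E)%E; first by [].
    rewrite integral_indic// ?setIT//.
    by rewrite -[X in measurable X]setTI; exact: mi.
  apply/measurable_EFinP; apply: (measurableT_comp _ mi); exact: measurable_indic.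
have e1 : measurable_fun setT (EFin \o (fun t => Re (F t))) by exact/measurable_EFinP.
have e2 : measurable_fun setT (EFin \o (fun t => Im (F t))) by exact/measurable_EFinP.
apply: complex_eq => /=; rewrite /Rintegral; congr fine; rewrite (eq_measure_integral _ mE).
  exact: (integral_pushforward mi e1 i1 measurableT).
exact: (integral_pushforward mi e2 i2 measurableT).
Qed.

End tuple_integrals.

(** * Functions of a linear form *)

Section frequency_slabs.
Local Open Scope complex_scope.
Context {R : realType}.
Local Notation leb := (@lebesgue_measure R).
Local Notation T := (measurableTypeR R).

(** Half-period shift: translating by [h = 1 / (2 x)] changes the sign of the transform at [x], so
    twice the transform is that of [u - u (. + h)]. This difference lives within [|h|] of the two
    endpoints, so its L1 norm is at most [4 |h|]. *)
Lemma fhat_indic_decay (b c x : R) :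
  `|x| * normc (fhat (fun xi : T => (\1_(`[b, c[%classic) xi : R)%:C) x) <= 1.
Proof.
have [->|x0] := eqVneq x 0; first by rewrite normr0 mul0r.
have ax0 : 0 < `|x| by rewrite normr_gt0.
set u := fun xi : T => _.
pose h := (2 * x)^-1.
have h2 : 2 * h * x = 1 by rewrite /h; field.
have iind (s t : R) (b0 b1 : bool) :
    leb.-integrable setT (EFin \o (\1_([set` Interval (BSide b0 s) (BSide b1 t)]) : T -> R)).
  exact: integrable_indic_itv.
have cu : cintble leb u.
  have h0 := iind b c true true.
  split; first exact: h0.
  exact: integrable0.
have cv : cintble leb (fun xi => u (xi + h)) by exact: cintble_shift.
have mG : cmeas (fun xi : T => u xi * cexpi (- (2 * pi * xi * x))).
  exact/cintble_meas/cintble_fhat.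
have e1 : fhat (fun xi => u (xi + h)) x = - fhat u x.
  rewrite /fhat -(cint_shift h mG) -[RHS]mulN1r -cintZ; last first.
    exact: (cintble_shift h (cintble_fhat x cu)).
  apply: eq_cint => xi.
  have -> : - (2 * pi * (xi + h) * x) = - (2 * pi * xi * x) + - pi :> R.
    have -> : - pi = - (2 * h * x * pi) :> R by rewrite h2 mul1r.
    by ring.
  rewrite cexpiD.
  have -> : cexpi (- pi) = -1 :> R[i].
    by apply: complex_eq; rewrite /= ?cosN ?sinN ?cospi ?sinpi ?oppr0.
  by rewrite mulrN1 mulrN mulN1r opprK.
have nh : 0 <= `|h| by [].
have e2 : normc (fhat (fun xi => u xi - u (xi + h)) x) <= 4 * `|h|.
  have cuv : cintble leb (fun xi : T => u xi - u (xi + h)).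
    apply: cintbleD => //; under eq_fun do rewrite -mulN1r; exact: cintbleZ.
  apply: le_trans (normc_fhat x cuv) _.
  have -> : 4 * `|h| = \int[leb]_xi (\1_(`[b - `|h|, b + `|h|]%classic) xi +
      \1_(`[c - `|h|, c + `|h|]%classic) xi).
    rewrite (RintegralD measurableT (iind _ _ _ _) (iind _ _ _ _)).
    have h0 : 0 < `|h|.
      rewrite normr_gt0; apply/eqP => h0; move: h2.
      by rewrite h0 mulr0 mul0r => /esym/eqP; rewrite oner_eq0.
    have E s : \int[leb]_xi (\1_(`[s - `|h|, s + `|h|]%classic) xi : R) = 2 * `|h|.
      have E : leb `[s - `|h|, s + `|h|]%classic = (2 * `|h|)%:E.
        rewrite lebesgue_measure_itv/= lte_fin; have -> : s - `|h| < s + `|h| by lra.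
        by rewrite -EFinB; congr (_%:E); ring.
      by rewrite /Rintegral integral_indic// setIT; exact: (congr1 fine E).
    by rewrite !E; ring.
  apply: le_Rintegral => //.
  - exact: cintble_normc cuv.
  - exact: (integrableD measurableT (iind _ _ _ _) (iind _ _ _ _)).
  move=> xi _; rewrite /u -rmorphB normc_real !indicE !mem_setE !in_itv/=.
  have := ler_norm h; have := ler_norm (- h); rewrite normrN.
  move: (`|h|) => k hk1 hk2.
  have [p1|p1] := leP b xi; have [p2|p2] := ltP xi c;
    have [p3|p3] := leP b (xi + h); have [p4|p4] := ltP (xi + h) c => /=;
    rewrite ?subrr ?subr0 ?sub0r ?normrN ?normr1 ?normr0 ?addr_ge0//.
  all: try (have q1 : b - k <= xi by lra); try (have q2 : xi <= b + k by lra);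
    try (have q3 : c - k <= xi by lra); try (have q4 : xi <= c + k by lra).
  all: rewrite ?q1 ?q2 ?q3 ?q4 /= ?lerDl ?lerDr ?ler0n//.
have e3 : fhat (fun xi => u xi - u (xi + h)) x = 2 * fhat u x.
  rewrite -[RHS]/((1 + 1) * fhat u x) mulrDl mul1r -[X in _ + X]opprK -e1 /fhat.
  rewrite -[X in _ = _ + X]mulN1r -cintZ; last exact: cintble_fhat.
  rewrite -cintD; [|exact: cintble_fhat|exact/cintbleZ/cintble_fhat].
  by apply: eq_cint => xi; rewrite mulrBl mulN1r.
rewrite e3 normcM in e2.
have n2 : normc (2 : R[i]) = 2 by rewrite -[2 in LHS](rmorph_nat (real_complex R)) normc_real ger0_norm.
rewrite n2 in e2.
have hx : `|h| * `|x| = 1 / 2.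
  have hx' : h * x = 1 / 2 by lra.
  by rewrite -normrM hx' ger0_norm.
have e4 : normc (fhat u x) <= 2 * `|h| by lra.
by apply: le_trans (ler_wpM2l (ltW ax0) e4) _; nra.
Qed.

(** This decay makes pairings with a Lipschitz function absolutely convergent. *)
Lemma bt_decay (a del : R) (n : nat) : exists C : R, forall x,
  (1 + `|x|) * normc (bt a del n x) <= C.
Proof.
pose M := \int[leb]_xi normc ((\1_(cell a del n) xi : R)%:C).
exists (Num.sqrt del^-1 * (M + 1)) => x.
rewrite /bt normcM normc_real (ger0_norm (sqrtr_ge0 _)) mulrCA.
apply: ler_wpM2l; first exact: sqrtr_ge0.
rewrite mulrDl mul1r lerD//; last exact: fhat_indic_decay.
exact: (normc_fhat x (cintble_cell a del n)).
Qed.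

Lemma cintble_mul_ifhat (u q : T -> R[i]) (mu nu : R) : cintble leb u -> cintble leb q ->
  cintble leb (fun y : T => u y * ifhat q (mu + nu * y)).
Proof.
move=> cu cq; apply: (@cintbleM_bd _ T _ leb _ _ (\int[leb]_xi normc (q xi))) => //.
  apply: (cmeas_comp (cmeas_ifhat cq)).
  by apply: measurable_funD => //; exact: measurable_funM.
by move=> x; exact: normc_ifhat.
Qed.

(** Convolution theorem for a factor in an affine variable: the spectrum of [u] is averaged over the
    shifts [nu * t], with [t] in the support of [q]. Iterating it tracks the spectrum of a product
    of several such factors. *)
Lemma fhat_mul_ifhat (u q : T -> R[i]) (mu nu zeta : R) : cintble leb u -> cintble leb q ->
  fhat (fun y : T => u y * ifhat q (mu + nu * y)) zeta =
  cint leb (fun t => q t * cexpi (2 * pi * mu * t) * fhat u (zeta - nu * t)).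
Proof.
move=> cu cq.
pose F (z : T * T) := u z.1 * cexpi (- (2 * pi * z.1 * zeta)) *
  (q z.2 * (cexpi (2 * pi * mu * z.2) * cexpi (2 * pi * nu * z.1 * z.2))).
have iF : cintble (leb \x leb)%E F.
  apply: (@cintble_prod_le _ _ T T R leb leb _ (fun x => normc (u x)) (fun x => normc (q x))).
  - apply: cmeasM.
      apply: cmeasM; first exact: (cmeas_comp (cintble_meas cu) measurable_fst).
      exact: (cmeas_comp (cmeas_phase zeta) measurable_fst).
    apply: cmeasM; first exact: (cmeas_comp (cintble_meas cq) measurable_snd).
    apply: cmeasM; last exact: cmeas_phase2.
    apply: cmeas_cexpi; apply: measurable_funM => //; exact: measurable_snd.
  - exact: cintble_normc.
  - exact: cintble_normc.
  - by move=> x y; rewrite /F !normcM !normc_cexpi !mulr1.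
transitivity (cint leb (fun y => cint leb (fun t => F (y, t)))).
  apply: eq_cint => y; rewrite /F /= cintZ.
    rewrite -mulrA [X in _ * X]mulrC mulrA; congr (_ * _); apply: eq_cint => t.
    by rewrite -cexpiD; congr (_ * cexpi _); ring.
  rewrite (_ : (fun t => _) = (fun t => q t * cexpi (2 * pi * (mu + nu * y) * t))).
    exact: cintble_ifhat.
  by apply/funext => t; rewrite -cexpiD; congr (_ * cexpi _); ring.
rewrite cint_swap//; apply: eq_cint => t.
rewrite /fhat -cintZ; last exact: cintble_fhat.
apply: eq_cint => y; rewrite /F /=.
have -> : - (2 * pi * y * (zeta - nu * t)) = - (2 * pi * y * zeta) + 2 * pi * nu * y * t :> R by ring.
by rewrite cexpiD; ring.
Qed.

Lemma fhat_mul_ifhat_eq0 (u q : T -> R[i]) (mu nu zeta : R) : cintble leb u -> cintble leb q ->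
  (forall t, q t <> 0 -> fhat u (zeta - nu * t) = 0) ->
  fhat (fun y : T => u y * ifhat q (mu + nu * y)) zeta = 0.
Proof.
move=> cu cq h; rewrite fhat_mul_ifhat// -[RHS](cint0 leb); apply: eq_cint => t.
have [->|/eqP q0] := eqVneq (q t) 0; first by rewrite !mul0r.
by rewrite h// mulr0.
Qed.

(** Spectrum of [bt] up to a reflection; it gives [bt] the form of the second factor in
    [fhat_mul_ifhat]. *)
Definition btq (a del : R) (n : nat) (xi : T) : R[i] :=
  (Num.sqrt del^-1)%:C * (\1_(cell a del n) xi)%:C.

Lemma cintble_btq a del n : cintble leb (btq a del n).
Proof. exact/cintbleZ/cintble_cell. Qed.

Lemma bt_ifhat a del n x : bt a del n x = ifhat (btq a del n) (- x).
Proof.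
rewrite /bt /fhat -cintZ; last exact: (cintble_fhat x (cintble_cell a del n)).
apply: eq_cint => xi; by rewrite /btq -[RHS]mulrA; congr (_ * (_ * cexpi _)); ring.
Qed.

Lemma btq_neq0 a del n t : btq a del n t <> 0 -> a + n%:R * del <= t < a + n%:R * del + del.
Proof.
rewrite /btq indicE; case: (boolP (t \in cell a del n)) => [|_]; last by rewrite mulr0.
rewrite inE /cell/= in_itv/= -natr1 => /andP[-> h2] _ /=.
by rewrite (lt_le_trans h2)// mulrDl mul1r addrA.
Qed.

(** For fixed second variable the shear is a translation, so Tonelli with the first variable inside
    preserves the integral of the modulus. *)
Lemma cintble_shear (rho : R) (F : T * T -> R[i]) : cintble (leb \x leb)%E F ->
  cintble (leb \x leb)%E (fun z => F (z.1 - rho * z.2, z.2)).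
Proof.
move=> iF.
have mF := cintble_meas iF.
have mn := measurable_normc mF.
apply: cintble_lty21.
  apply: (cmeas_comp mF); apply/measurable_fun_pairP; split => /=.
    apply: measurable_funB; first exact: measurable_fst.
    apply: measurable_funM => //; exact: measurable_snd.
  exact: measurable_snd.
have := normc_lty iF; rewrite fubini_tonelli2; last 2 first.
- exact/measurable_EFinP.
- by move=> z; rewrite lee_fin normc_ge0.
apply: le_lt_trans; rewrite le_eqVlt; apply/orP; left; apply/eqP.
apply: eq_integral => y _.
rewrite /fubini_G -[RHS](integral_shift (- (rho * y))) //=.
apply: (measurableT_comp (proj2 (measurable_EFinP _ _) mn)).
exact: measurable_pair2.
Qed.

Lemma lipschitz1_measurable (sigma : R -> R) : (forall x y, `|sigma x - sigma y| <= `|x - y|) ->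
  measurable_fun [set: T] (sigma : T -> T).
Proof.
move=> lip; apply: continuous_measurable_fun.
by apply: (@lip_continuous _ _ 1) => x y; rewrite mul1r.
Qed.

(** The Lipschitz bound and [|rho| <= 1] give [|sigma| <= B (1 + |x|) (1 + |y|)]; each factor is
    absorbed by the decay of one [bt], which leaves the integrable [f] and [g]. *)
Lemma cintble_slab (f g : T -> R[i]) (a del al rho c : R) (n m : nat) (sigma : R -> R) :
  cintble leb f -> cintble leb g -> `|rho| <= 1 ->
  (forall x y, `|sigma x - sigma y| <= `|x - y|) ->
  cintble (leb \x leb)%E (fun z : T * T => (sigma (al * (z.1 + rho * z.2) + c))%:C *
    (f z.1 * bt a del n z.1) * (g z.2 * bt a del m z.2)).
Proof.
move=> cf cg rho1 lip.
set H := fun z : T * T => _.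
have msig := lipschitz1_measurable lip.
have mb k := cmeas_bt a del k.
have mH : cmeas H.
  apply: cmeasM.
    apply: cmeasM.
      apply: cmeas_real; apply: (measurableT_comp msig).
      apply: measurable_funD => //; apply: measurable_funM => //.
      apply: measurable_funD; first exact: measurable_fst.
      by apply: measurable_funM => //; exact: measurable_snd.
    exact: (cmeas_comp (cmeasM (cintble_meas cf) (mb n)) measurable_fst).
  exact: (cmeas_comp (cmeasM (cintble_meas cg) (mb m)) measurable_snd).
have [Cn hn] := bt_decay a del n; have [Cm hm] := bt_decay a del m.
pose B := `|sigma c| + `|al|.
apply: (@cintble_prod_le _ _ T T R leb leb _ (fun x => B * Cn * normc (f x))
    (fun y => Cm * normc (g y))) => //.
- exact: (integrableZl _ _ (cintble_normc cf)).
- exact: (integrableZl _ _ (cintble_normc cg)).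
move=> x y.
have -> : H (x, y) = (sigma (al * (x + rho * y) + c))%:C * (f x * bt a del n x) *
  (g y * bt a del m y) by [].
rewrite 2!normcM (normcM (f x)) (normcM (g y)) !normc_real.
have := normc_ge0 (g y); have := normc_ge0 (f x); have := normc_ge0 (bt a del n x); have := normc_ge0 (bt a del m y).
move: (hn x) (hm y); move: (normc (f x)) (normc (g y)) (normc (bt a del n x)) (normc (bt a del m y)) => P Q N M hN hM M0 N0 P0 Q0.
have hs : `|sigma (al * (x + rho * y) + c)| <= B * ((1 + `|x|) * (1 + `|y|)).
  have l1 := lip (al * (x + rho * y) + c) c; rewrite addrK normrM in l1.
  have l2 := ler_normD (sigma (al * (x + rho * y) + c) - sigma c) (sigma c).
  rewrite subrK in l2; rewrite /B.
  have l3 : `|x + rho * y| <= `|x| + `|y|.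
    rewrite (le_trans (ler_normD _ _))// lerD2l normrM -[leRHS]mul1r ler_wpM2r//.
  have l4 : `|al| * `|x + rho * y| <= `|al| * (`|x| + `|y|) by rewrite ler_wpM2l.
  have := normr_ge0 x; have := normr_ge0 y; have := normr_ge0 al; have := normr_ge0 (sigma c).
  move: l1 l2 l3 l4.
  move: (`|x + _|) (`|x|) (`|y|) (`|al|) (`|sigma c|) (`|sigma _ - _|) (`|sigma _|).
  move=> q1 q2 q3 q4 q5 q6 q7 l1 l2 l3 l4 z1 z2 z3 z4.
  have : 0 <= q5 * (q2 + q3 + q2 * q3) by rewrite mulr_ge0// !addr_ge0// mulr_ge0.
  have : 0 <= q4 * (1 + q2 * q3) by rewrite mulr_ge0// addr_ge0// mulr_ge0.
  nra.
have B0 : 0 <= B by rewrite addr_ge0.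
have -> : B * Cn * P * (Cm * Q) = B * (Cn * Cm) * (P * Q) by ring.
have e1 : `|sigma (al * (x + rho * y) + c)| * (P * N) * (Q * M) <=
   B * ((1 + `|x|) * (1 + `|y|)) * (P * N) * (Q * M).
  apply: ler_wpM2r; first by rewrite mulr_ge0.
  by apply: ler_wpM2r => //; rewrite mulr_ge0.
apply: le_trans e1 _.
have -> : B * ((1 + `|x|) * (1 + `|y|)) * (P * N) * (Q * M) =
  B * (((1 + `|x|) * N) * ((1 + `|y|) * M)) * (P * Q) by ring.
apply: ler_wpM2r; first by rewrite mulr_ge0.
apply: ler_wpM2l => //; apply: ler_pM => //; by rewrite mulr_ge0// addr_ge0.
Qed.

Section slab.
Variables (psi : T -> R) (K : R).
Hypothesis ipsi : leb.-integrable setT (EFin \o psi).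
Local Notation psiC := (fun x : T => (psi x)%:C).
Hypothesis psiK : forall xi, K < `|xi| -> fhat psiC xi = 0.
Local Notation p0 := (psi0 psi).

Let cpsi : cintble leb psiC.
Proof. by split => //; exact: integrable0. Qed.

Lemma cintble_psi0 : cintble leb (p0 : T -> R[i]).
Proof.
have m0 := cmeas_psi0 ipsi psiK.
apply: cintble_lty => //.
apply: le_lt_trans (normc_lty cpsi); rewrite le_eqVlt; apply/orP; left; apply/eqP.
apply: ae_eq_integral => //.
- exact/measurable_EFinP/measurable_normc.
- apply/measurable_EFinP/measurable_normc; exact: cintble_meas cpsi.
- by move: (psi0_ae ipsi psiK); apply: filterS => x h _; rewrite -h.
Qed.

(* Along the line [x + rho y = s] the integrand has its spectrum in a union of bands that
   misses the frequency 0 as soon as the cells [m] and [n] are at distance [> 3K] from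
   the direction [(rho, 1)]. *)
Lemma fhat_slab_eq0 (a del s rho : R) (n m : nat) : 2 * del <= K -> `|rho| <= 1 ->
  3 * K < `|(a + m%:R * del) - rho * (a + n%:R * del)| ->
  let F (y : T) := psiC y * bt a del m y * p0 (s - rho * y) * bt a del n (s - rho * y) in
  cintble leb F /\ cint leb F = 0.
Proof.
move=> delK rho1 far F.
pose u1 y := psiC y * ifhat (btq a del m) (0 + -1 * y).
pose u2 y := u1 y * ifhat (fhat psiC) (s + - rho * y).
have c1 : cintble leb u1 by apply: cintble_mul_ifhat => //; exact: cintble_btq.
have c2 : cintble leb u2 by apply: cintble_mul_ifhat => //; exact: (cintble_fhat_psi ipsi psiK).
have FE : F = fun y => u2 y * ifhat (btq a del n) (- s + rho * y).
  apply/funext => y; rewrite /F /u2 /u1 !bt_ifhat add0r mulN1r mulNr /psi0.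
  by have -> : - (s - rho * y) = - s + rho * y by ring.
split; first by rewrite FE; apply: cintble_mul_ifhat => //; exact: cintble_btq.
(* An integral is a transform at frequency 0; the three factors can now be peeled off by the
   convolution theorem. *)
transitivity (fhat F 0).
  by apply: eq_cint => y; rewrite mulr0 oppr0 cexpi0 mulr1.
rewrite FE.
apply: fhat_mul_ifhat_eq0 => //; first exact: cintble_btq.
move=> t /btq_neq0/andP[t1 t2].
apply: fhat_mul_ifhat_eq0 => //; first exact: (cintble_fhat_psi ipsi psiK).
move=> t' ht'.
have tK : `|t'| <= K by rewrite leNgt; apply/negP => /psiK.
apply: fhat_mul_ifhat_eq0 => //; first exact: cintble_btq.
move=> t'' /btq_neq0/andP[t3 t4]; apply: psiK.
move: t1 t2 t3 t4 far; move: (a + m%:R * del) (a + n%:R * del) => xm xn t1 t2 t3 t4 far.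
have h1 : `|rho * (t - xn)| <= del.
  rewrite normrM -[leRHS]mul1r ler_pM//; first by rewrite ger0_norm; lra.
have h2 : `|rho * t'| <= K by rewrite normrM -[leRHS]mul1r ler_pM.
have h3 : `|t'' - xm| <= del by rewrite ger0_norm; lra.
(* The first bracket exceeds [3 K] in modulus. The positions inside the two cells cost [del] each
   and the band of [p0] costs [K]; as [2 del <= K], the frequency stays beyond [K], outside the band
   of [psi]. *)
have -> : 0 - rho * t - - rho * t' - -1 * t'' =
  (xm - rho * xn) - (rho * (t - xn) - rho * t' - (t'' - xm)) by ring.
move: far h1 h2 h3; move: (xm - _) (rho * (t - xn)) (rho * t') (t'' - xm) => A B C D far h1 h2 h3.
have := lerB_dist A (B - C - D).
have := ler_normB (B - C) D; have := ler_normB B C.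
lra.
Qed.

(** In the variable [s = x + rho y] the factor [sigma] no longer depends on [y] and comes out of the
    inner integral, which vanishes by [fhat_slab_eq0]. The copy of [psi] evaluated at [s - rho y] is
    first replaced by [p0], an inverse transform. *)
Lemma slab_orthogonal (a del al rho c : R) (n m : nat) (sigma : R -> R) :
  2 * del <= K -> `|rho| <= 1 ->
  3 * K < `|(a + m%:R * del) - rho * (a + n%:R * del)| ->
  (forall x y, `|sigma x - sigma y| <= `|x - y|) ->
  cint leb (fun y : T => cint leb (fun x : T =>
    (sigma (al * (x + rho * y) + c))%:C * (psiC x * bt a del n x) * (psiC y * bt a del m y))) = 0.
Proof.
move=> delK rho1 far lip.
have msig := lipschitz1_measurable lip.
have m0 := cmeas_psi0 ipsi psiK.
have mb k := cmeas_bt a del k.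
pose H (z : T * T) := (sigma (al * (z.1 + rho * z.2) + c))%:C *
   (p0 z.1 * bt a del n z.1) * (psiC z.2 * bt a del m z.2).
pose G (z : T * T) := H (z.1 - rho * z.2, z.2).
have iH : cintble (leb \x leb)%E H by exact: (cintble_slab _ _ _ _ _ _ cintble_psi0 cpsi).
have mH := cintble_meas iH.
have iG : cintble (leb \x leb)%E G by exact: cintble_shear.
transitivity (cint leb (fun y => cint leb (fun s => G (s, y)))).
  apply: eq_cint => y.
  have mHy : cmeas (fun x : T => H (x, y)) by exact: (cmeas_comp mH (measurable_pair2 y)).
  rewrite (cint_shift (- (rho * y)) mHy).
  apply: cint_ae.
  - apply: cmeasM; last exact: cmeas_cst.
    apply: cmeasM; last exact: (cmeasM (cintble_meas cpsi) (mb n)).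
    apply: cmeas_real; apply: (measurableT_comp msig).
    by apply: measurable_funD => //; apply: measurable_funM => //; exact: measurable_funD.
  - exact: mHy.
  - by move: (psi0_ae ipsi psiK); apply: filterS => x h;
    congr (_ * (_ * bt a del n x) * (psiC y * bt a del m y)); exact: h.
rewrite -(cint_swap iG) -[RHS](cint0 leb); apply: eq_cint => s.
have [iK K_eq0] := fhat_slab_eq0 s delK rho1 far.
transitivity ((sigma (al * s + c))%:C *
   cint leb (fun y : T => psiC y * bt a del m y * p0 (s - rho * y) * bt a del n (s - rho * y))).
  rewrite -(cintZ _ iK); apply: eq_cint => y.
  have -> : G (s, y) = (sigma (al * (s - rho * y + rho * y) + c))%:C *
    (p0 (s - rho * y) * bt a del n (s - rho * y)) * (psiC y * bt a del m y) by [].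
  rewrite subrK; move: (sigma _)%:C (p0 _) (bt _ _ _ _) (bt _ _ _ _) (psiC y) => A1 A2 A3 A4 A5.
  by ring.
by rewrite K_eq0 mulr0.
Qed.

End slab.
End frequency_slabs.

(** * Orthogonality of a unit to the product functions off its tube *)

Section ridge.
Local Open Scope complex_scope.
Context {R : realType}.
Local Notation leb := (@lebesgue_measure R).
Local Notation T := (measurableTypeR R).
Local Notation LT := (lebesgue_tuple R).

Variables (psi : T -> R) (K : R).
Hypothesis ipsi : leb.-integrable setT (EFin \o psi).
Local Notation psiC := (fun x : T => (psi x)%:C).
Hypothesis psiK : forall xi, K < `|xi| -> fhat psiC xi = 0.
Variables (a0 del : R).

Definition ridge d (a : 'I_d -> R) (sigma : R -> R) (Q : 'I_d -> nat) (t : d.-tuple T) : R[i] :=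
  (sigma (\sum_(j < d) a j * tnth t j))%:C *
  \prod_(j < d) ((psi (tnth t j))%:C * bt a0 del (Q j) (tnth t j)).

Let cpsi : cintble leb psiC.
Proof. by split => //; exact: integrable0. Qed.

Lemma le_prod_1norm d (t : d.-tuple T) (j : 'I_d) :
  `|tnth t j| <= \prod_(i < d) (1 + `|tnth t i|).
Proof.
rewrite (bigD1 j)//= -[leLHS]mulr1; apply: ler_pM => //; first by rewrite lerDr.
have h : \prod_(i < d | i != j) (1 : R) = 1 by rewrite big1_eq.
by rewrite -[leLHS]h; apply: ler_prod => i _; rewrite ler01 lerDl normr_ge0.
Qed.

(** Majorant as in two variables: the product of all [1 + |t_j|] dominates the linear growth of
    [sigma], and each of its factors is absorbed by the [bt] of the same coordinate. *)
Lemma cintble_ridge d (a : 'I_d -> R) sigma (Q : 'I_d -> nat) :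
  (forall x y, `|sigma x - sigma y| <= `|x - y|) -> cintble (LT d) (ridge a sigma Q).
Proof.
move=> lip.
have msig := lipschitz1_measurable lip.
have mx (j : 'I_d) : measurable_fun [set: d.-tuple T] (fun t => tnth t j : T) by exact: measurable_tnth.
have [C hC] : exists C : 'I_d -> R, forall j x, (1 + `|x|) * normc (bt a0 del (Q j) x) <= C j.
  have /choice[C hC] : forall j : 'I_d, exists c, forall x, (1 + `|x|) * normc (bt a0 del (Q j) x) <= c.
    by move=> j; exact: bt_decay.
  by exists C.
pose B := `|sigma 0| + \sum_(j < d) `|a j|.
have B0 : 0 <= B by rewrite addr_ge0// sumr_ge0.
have cu (j : 'I_d) : cintble leb (fun x => (C j)%:C * psiC x) by exact: cintbleZ.
have [cP _] := cint_prod cu.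
apply: (@cintble_le _ _ _ (LT d) _ (fun t => B * normc (\prod_(j < d) ((C j)%:C * psiC (tnth t j))))).
- apply: cmeasM.
    apply: cmeas_real; apply: (measurableT_comp msig).
    by apply: measurable_sum => j; apply: measurable_funM; [exact: measurable_cst|exact: mx].
  by apply: cmeas_prod => j; exact: (cmeas_comp (cmeasM (cintble_meas cpsi) (cmeas_bt a0 del (Q j))) (mx j)).
- exact: (integrableZl _ _ (cintble_normc cP)).
move=> t; rewrite /ridge normcM normc_real.
have hs : `|sigma (\sum_(j < d) a j * tnth t j)| <= B * \prod_(j < d) (1 + `|tnth t j|).
  set z := \sum_(j < d) _.
  have l1 := lip z 0; rewrite subr0 in l1.
  have l2 := ler_normD (sigma z - sigma 0) (sigma 0); rewrite subrK in l2.
  set P := \prod_(j < d) _.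
  have P1 : 1 <= P.
    have h : \prod_(i < d) (1 : R) = 1 by rewrite big1_eq.
    by rewrite -[leLHS]h; apply: ler_prod => i _; rewrite ler01 lerDl normr_ge0.
  have l3 : `|z| <= (\sum_(j < d) `|a j|) * P.
    rewrite mulr_suml (le_trans (ler_norm_sum _ _ _))//; apply: ler_sum => j _.
    by rewrite normrM ler_wpM2l//; exact: le_prod_1norm.
  have l4 : `|sigma 0| * 1 <= `|sigma 0| * P by rewrite ler_wpM2l.
  by rewrite /B mulrDl; lra.
apply: (@le_trans _ _ (B * (\prod_(j < d) (1 + `|tnth t j|)) *
    normc (\prod_(j < d) (psiC (tnth t j) * bt a0 del (Q j) (tnth t j))))).
  by apply: ler_wpM2r => //; exact: normc_ge0.
rewrite -mulrA; apply: ler_wpM2l => //.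
rewrite !normc_prod -big_split; apply: ler_prod => j _.
have b0 := normc_ge0 (bt a0 del (Q j) (tnth t j)).
have p0 := normr_ge0 (psi (tnth t j)).
have h := hC j (tnth t j).
rewrite (normcM (psi (tnth t j))%:C (bt _ _ _ _)) (normcM (C j)%:C (psi (tnth t j))%:C) !normc_real.
have x0 : 0 <= 1 + `|tnth t j| by rewrite addr_ge0.
apply/andP; split; first by do !apply: mulr_ge0 => //.
suff : (1 + `|tnth t j|) * (`|psi (tnth t j)| * normc (bt a0 del (Q j) (tnth t j))) <=
   `|C j| * `|psi (tnth t j)| by [].
rewrite mulrCA [leRHS]mulrC; apply: ler_wpM2l => //.
exact: le_trans h (ler_norm _).
Qed.

(** With the other coordinates frozen, the linear form is [a i * (x + rho_j * y) + c], and their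
    factors gather in the constant [w]: this is the two-variable situation of [slab_orthogonal]. *)
Lemma ridge_ins2 d (a rho : 'I_d.+2 -> R) sigma (Q : 'I_d.+2 -> nat) (i : 'I_d.+2) (j : 'I_d.+1)
    (x y : R) (t : d.-tuple T) : (forall k, a k = rho k * a i) ->
  exists c w, forall x y : T, ridge a sigma Q (ins i (x, ins j (y, t))) =
   w * ((sigma (a i * (x + rho (lift i j) * y) + c))%:C * ((psi x)%:C * bt a0 del (Q i) x)
   * ((psi y)%:C * bt a0 del (Q (lift i j)) y)).
Proof.
move=> ha.
exists (\sum_(k < d) a (lift i (lift j k)) * tnth t k),
  (\prod_(k < d) ((psi (tnth t k))%:C * bt a0 del (Q (lift i (lift j k))) (tnth t k))) => {}x {}y.
rewrite /ridge; set s := ins i _.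
have si : tnth s i = x by exact: ins_id.
have sj : tnth s (lift i j) = y by rewrite /s ins_lift ins_id.
have sk k : tnth s (lift i (lift j k)) = tnth t k by rewrite /s !ins_lift.
have -> : \sum_(k < d.+2) a k * tnth s k =
    a i * (x + rho (lift i j) * y) + \sum_(k < d) a (lift i (lift j k)) * tnth t k.
  rewrite (bigD1_ord i)//= (bigD1_ord j)//= si sj (ha (lift i j)).
  under eq_bigr do rewrite sk.
  by rewrite addrA; congr (_ + _); ring.
have -> : \prod_(k < d.+2) ((psi (tnth s k))%:C * bt a0 del (Q k) (tnth s k)) =
    ((psi x)%:C * bt a0 del (Q i) x) * (((psi y)%:C * bt a0 del (Q (lift i j)) y) *
    \prod_(k < d) ((psi (tnth t k))%:C * bt a0 del (Q (lift i (lift j k))) (tnth t k))).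
  rewrite (bigD1_ord i)// (bigD1_ord j)// si sj; congr (_ * (_ * _)).
  by apply: eq_bigr => k _; rewrite sk.
set P := \prod_(_ < d) _; set S := (sigma _)%:C.
by move: P S ((psi x)%:C * _) ((psi y)%:C * _) => P S X Y; ring.
Qed.

(** One coordinate far from the direction is enough: Fubini puts the integrals over coordinates [i]
    and [j] inside, and these already vanish. The form [a k = rho k * a i] includes the direction
    0. *)
Lemma ridge_orthogonal d (a rho : 'I_d -> R) sigma (Q : 'I_d -> nat) (i j : 'I_d) :
  2 * del <= K -> (forall x y, `|sigma x - sigma y| <= `|x - y|) ->
  (forall k, a k = rho k * a i) -> `|rho j| <= 1 -> j != i ->
  3 * K < `|(a0 + (Q j)%:R * del) - rho j * (a0 + (Q i)%:R * del)| ->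
  cint (LT d) (ridge a sigma Q) = 0.
Proof.
move=> delK lip ha rho1; case: d a rho Q i j ha rho1 => [|d] a rho Q i j ha rho1; first by case: (i).
case: (unliftP i j) => [j' jE|->]; last by rewrite eqxx.
subst j => _.
case: d a rho Q i j' ha rho1 => [|d] a rho Q i j ha rho1; first by case: (j).
move=> far.
have cF := @cintble_ridge _ a sigma Q lip.
have [c1 ->] := cint_ins i cF.
rewrite -cint21//.
have [c2 ->] := cint_ins j (cintble_cint2 c1).
rewrite -cint21// -[RHS](cint0 (LT d)); apply: eq_cint => t /=.
have [c [w hw]] := @ridge_ins2 d a rho sigma Q i j 0 0 t ha.
under eq_cint => y do under eq_cint => x do rewrite hw.
have cS := cintble_slab a0 del (a i) c (Q i) (Q (lift i j)) cpsi cpsi rho1 lip.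
transitivity (w * cint leb (fun y : T => cint leb (fun x : T =>
   (sigma (a i * (x + rho (lift i j) * y) + c))%:C * ((psi x)%:C * bt a0 del (Q i) x)
   * ((psi y)%:C * bt a0 del (Q (lift i j)) y)))).
  rewrite (cint21 cS) -(cintZ w cS) -(cint21 (cintbleZ w cS)).
  by [].
by rewrite (slab_orthogonal ipsi psiK)// mulr0.
Qed.

End ridge.

(** * Bessel's inequality and counting *)

Section bessel.
Local Open Scope complex_scope.
Context {R : realType}.
Local Notation leb := (@lebesgue_measure R).
Local Notation T := (measurableTypeR R).
Local Notation LT := (lebesgue_tuple R).

Definition fcons (X : Type) d (i : X) (Q : {ffun 'I_d -> X}) : {ffun 'I_d.+1 -> X} :=
  [ffun k => if unlift ord0 k is Some k' then Q k' else i].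

Lemma sum_ffun_cons (V : nmodType) (X : finType) d (F : {ffun 'I_d.+1 -> X} -> V) :
  \sum_Q F Q = \sum_i \sum_Q' F (fcons i Q').
Proof.
rewrite pair_big /= (reindex (fun p : X * {ffun 'I_d -> X} => fcons p.1 p.2)) //=.
exists (fun f => (f ord0, [ffun k => f (lift ord0 k)])) => [[i Q]|f] _ /=.
  congr pair; first by rewrite ffunE unlift_none.
  by apply/ffunP => k; rewrite !ffunE liftK.
apply/ffunP => k; rewrite ffunE; case: unliftP => [k' ->|->] //.
by rewrite ffunE.
Qed.

Variables (a del : R).
Hypothesis del0 : 0 < del.

Definition btensor d m (Q : {ffun 'I_d -> 'I_m}) (t : d.-tuple T) : R[i] :=
  \prod_(j < d) bt a del (Q j) (tnth t j).

Lemma cmeas_btensor d m (Q : {ffun 'I_d -> 'I_m}) : cmeas (btensor Q).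
Proof. by apply: cmeas_prod => j; apply: cmeas_tnth; exact: cmeas_bt. Qed.

Lemma btensor_cons d m (i : 'I_m) (Q : {ffun 'I_d -> 'I_m}) x t :
  btensor (fcons i Q) (tuple_cons (x, t)) = bt a del i x * btensor Q t.
Proof.
rewrite /btensor big_ord_recl; congr (_ * _).
  by rewrite ffunE unlift_none tnth0.
by apply: eq_bigr => j _; rewrite ffunE liftK tnthS.
Qed.

(** Induction on [d]: with the other coordinates fixed, [bt_contraction] bounds the integral over
    the first one, and the induction hypothesis bounds what is left for each cell [i]. *)
Lemma btensor_contraction d m (c : {ffun 'I_d -> 'I_m} -> R[i]) :
  (sqint (LT d) (fun t => (\sum_Q c Q * btensor Q t)%R) <= (\sum_Q normc (c Q) ^+ 2)%:E)%E.
Proof.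
elim: d c => [|d ih] c.
  pose Q0 : {ffun 'I_0 -> 'I_m} := ffun0 (card_ord 0).
  have QE : xpredT =1 pred1 Q0 by move=> Q; apply/esym/eqP/ffunP => -[].
  rewrite (big_pred1 Q0)// /sqint.
  under eq_integral => t _ do rewrite (big_pred1 Q0)// /btensor big_ord0 mulr1.
  by rewrite integral_cst//; rewrite [X in (_ * X)%E](@lebesgue_tuple0_setT R) mule1.
pose D (i : 'I_m) t := \sum_Q' c (fcons i Q') * btensor Q' t.
pose G (z : T * d.-tuple T) := \sum_(i < m) D i z.2 * bt a del i z.1.
have mD i : cmeas (D i).
  by apply: cmeas_sum => Q; apply: cmeasM; [exact: cmeas_cst|exact: cmeas_btensor].
have mG : cmeas G.
  apply: cmeas_sum => i; apply: cmeasM.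
    exact: (cmeas_comp (mD i) measurable_snd).
  exact: (cmeas_comp (cmeas_bt a del i) measurable_fst).
rewrite /sqint ge0_integral_cons; last 2 first.
- by apply: measurable_sq; apply: cmeas_sum => Q; apply: cmeasM; [exact: cmeas_cst|exact: cmeas_btensor].
- by move=> t; rewrite lee_fin sqr_ge0.
have E x t : \sum_Q c Q * btensor Q (tuple_cons (x, t)) = G (x, t).
  rewrite sum_ffun_cons; apply: eq_bigr => i _; rewrite /D mulr_suml.
  by apply: eq_bigr => Q _; rewrite btensor_cons mulrCA mulrC mulrA.
under eq_integral => x _ do under eq_integral => t _ do rewrite E.
have := @fubini_tonelli _ _ T (d.-tuple T) R leb (LT d) (fun z => (normc (G z) ^+ 2)%:E).
move=> -> //; [|exact: measurable_sq|by move=> z; rewrite lee_fin sqr_ge0].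
apply: (@le_trans _ _ (\int[LT d]_t (\sum_(i < m) (normc (D i t) ^+ 2)%:E))%E).
  apply: ge0_le_integral => //.
  - by move=> t _; apply: integral_ge0 => x _; rewrite lee_fin sqr_ge0.
  - apply: (@measurable_fun_fubini_tonelli_G _ _ T (d.-tuple T) R leb (fun z => (normc (G z) ^+ 2)%:E)).
      exact: measurable_sq.
    by move=> z; rewrite lee_fin sqr_ge0.
  - by apply: emeasurable_sum => i; exact: measurable_sq.
  move=> t _; rewrite sumEFin; exact: (bt_contraction a del0 (fun i => D i t)).
rewrite ge0_integral_sum//; last 2 first.
- by move=> i; exact: measurable_sq.
- by move=> i t _; rewrite lee_fin sqr_ge0.
rewrite sum_ffun_cons -sumEFin; apply: lee_sum => i _; exact: (ih (fun Q => c (fcons i Q))).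
Qed.

(** Duality: for [G] the combination with conjugated coefficients, the integral of [H * G] is the
    sum [S], and [G] has squared norm at most [S] by contraction. So
    [2 S <= |H|^2 + |G|^2 <= |H|^2 + S]. *)
Lemma bessel d m (P : pred {ffun 'I_d -> 'I_m}) (H : d.-tuple T -> R[i]) : cmeas H ->
  (forall Q : {ffun 'I_d -> 'I_m}, cintble (LT d) (fun t => H t * btensor Q t)) ->
  ((\sum_(Q : {ffun 'I_d -> 'I_m} | P Q) normc (cint (LT d) (fun t => H t * btensor Q t)) ^+ 2)%:E
    <= sqint (LT d) H)%E.
Proof.
move=> mH iH.
pose h (Q : {ffun 'I_d -> 'I_m}) := cint (LT d) (fun t => H t * btensor Q t).
pose c (Q : {ffun 'I_d -> 'I_m}) := if P Q then conjc (h Q) else 0.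
set S := (\sum_(Q | _) _).
pose G t := \sum_Q c Q * btensor Q t.
have mG : cmeas G.
  by apply: cmeas_sum => Q; apply: cmeasM; [exact: cmeas_cst|exact: cmeas_btensor].
have HGE t : H t * G t = \sum_Q c Q * (H t * btensor Q t).
  by rewrite mulr_sumr; apply: eq_bigr => Q _; rewrite mulrCA.
have iHG : cintble (LT d) (fun t => H t * G t).
  rewrite (_ : (fun t => _) = (fun t => \sum_Q c Q * (H t * btensor Q t))); last exact/funext.
  by apply: cintble_sum => Q _; exact: cintbleZ.
have SE : cint (LT d) (fun t => H t * G t) = S%:C.
  rewrite (eq_cint (LT d) HGE) cint_sum; last by move=> Q _; exact: cintbleZ.
  rewrite /S rmorph_sum [RHS]big_mkcond; apply: eq_bigr => Q _; rewrite cintZ// /c -/(h Q).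
  by case: ifP => _; rewrite ?mul0r// mulrC mulcJ.
have cS : \sum_Q normc (c Q) ^+ 2 = S.
  rewrite /S [RHS]big_mkcond; apply: eq_bigr => Q _; rewrite /c; case: ifP => _.
    by rewrite normcJ.
  by rewrite normc0 expr0n.
have S0 : 0 <= S by apply: sumr_ge0 => Q _; exact: sqr_ge0.
have h1 : ((2 * S)%:E <= sqint (LT d) H + sqint (LT d) G)%E.
  rewrite -ge0_integralD//; last 4 first.
  - by move=> t _; rewrite lee_fin sqr_ge0.
  - exact: measurable_sq.
  - by move=> t _; rewrite lee_fin sqr_ge0.
  - exact: measurable_sq.
  have iN := cintble_normc iHG.
  apply: (@le_trans _ _ (\int[LT d]_t (2 * normc (H t * G t))%:E)%E).
    under eq_integral do rewrite EFinM.
    rewrite integralZl// EFinM; apply: lee_wpmul2l; first by rewrite lee_fin.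
    have -> : S = normc (cint (LT d) (fun t => H t * G t)) by rewrite SE normc_real ger0_norm.
    have := normc_cint iHG; rewrite -lee_fin => /le_trans; apply.
    by rewrite /Rintegral fineK//; exact: integrable_fin_num.
  apply: ge0_le_integral => //.
  - by move=> t _; rewrite lee_fin mulr_ge0// normc_ge0.
  - by apply/measurable_EFinP; apply: measurable_funM => //; exact: measurable_normc (cintble_meas iHG).
  - apply: emeasurable_funD; exact: measurable_sq.
  move=> t _; rewrite -EFinD lee_fin normcM.
  by have := sqr_ge0 (normc (H t) - normc (G t)); rewrite sqrrB; lra.
have h2 : (sqint (LT d) G <= S%:E)%E by rewrite -cS; exact: btensor_contraction.
move: h1 h2 (sqint_ge0 (LT d) H) (sqint_ge0 (LT d) G).
case: (sqint (LT d) H) => [x| |]; case: (sqint (LT d) G) => [y| |] //.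
  by rewrite -EFinD !lee_fin => h1 h2 _ _; lra.
all: by move=> h1 h2 h3 h4; rewrite ?leey.
Qed.

End bessel.

(* Once [Q i0] is fixed the condition decouples over the other coordinates, and each
   coordinate in [A] contributes a factor at most [c]. *)
Lemma sum_tube_le (R : realFieldType) d m (w : 'I_d -> 'I_m -> R) (ok : 'I_d -> 'I_m -> 'I_m -> bool)
    (i0 : 'I_d) (A : {set 'I_d}) (c : R) :
  (forall j i, 0 <= w j i) -> (forall j, \sum_i w j i <= 1) -> 0 <= c <= 1 ->
  (forall j i, j \in A -> j != i0 -> \sum_(q | ok j q i) w j q <= c) ->
  \sum_(Q : {ffun 'I_d -> 'I_m} | [forall j, (j != i0) ==> ok j (Q j) (Q i0)])
    \prod_(j < d) w j (Q j) <= c ^+ #|A|.-1.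
Proof.
move=> w0 w1 /andP[c0 c1] wc.
(* Here [i] is a candidate for [Q i0]. In the added sum over [i] only the term [i = Q i0] is
   nonzero; after an exchange of sums, the sum over [Q] of products is a product of sums. *)
pose g (i : 'I_m) (j : 'I_d) (q : 'I_m) : R :=
  w j q * (if j == i0 then (q == i)%:R else (ok j q i)%:R).
have g0 i j q : 0 <= g i j q by rewrite /g mulr_ge0//; case: ifP.
apply: (@le_trans _ _ (\sum_(Q : {ffun 'I_d -> 'I_m}) \sum_i \prod_j g i j (Q j))).
  rewrite big_mkcond; apply: ler_sum => Q _; case: ifP => [/forallP ok_Q|_]; last first.
    by apply: sumr_ge0 => i _; exact: prodr_ge0.
  rewrite (bigD1 (Q i0))//= -[leLHS]addr0 lerD//; last first.
    by apply: sumr_ge0 => i _; exact: prodr_ge0.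
  apply: ler_prod => j _; rewrite w0 /g; case: eqVneq => [->|ji]; first by rewrite eqxx mulr1 lexx.
  by have := ok_Q j; rewrite ji /= => ->; rewrite mulr1 lexx.
rewrite exchange_big /=.
apply: (@le_trans _ _ (\sum_i w i0 i * c ^+ #|A|.-1)); last first.
  by rewrite -mulr_suml -[leRHS]mul1r ler_wpM2r// exprn_ge0.
apply: ler_sum => i _; rewrite -(bigA_distr_bigA (g i)) (bigD1 i0)//=.
have -> : \sum_q g i i0 q = w i0 i.
  rewrite (bigD1 i)//= /g eqxx eqxx mulr1 big1 ?addr0// => q /negbTE ->.
  by rewrite mulr0.
apply: ler_wpM2l => //.
apply: (@le_trans _ _ (\prod_(j | j != i0) (if j \in A then c else 1))).
  apply: ler_prod => j ji; rewrite sumr_ge0//=.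
  have -> : \sum_q g i j q = \sum_(q | ok j q i) w j q.
    rewrite [RHS]big_mkcond; apply: eq_bigr => q _; rewrite /g (negbTE ji).
    by case: (ok j q i); rewrite ?mulr1 ?mulr0.
  case: ifP => [jA|_]; first exact: wc.
  apply: le_trans (w1 j); rewrite [leRHS](bigID (fun q => ok j q i))/= lerDl.
  exact: sumr_ge0.
rewrite -big_mkcondr /= prodr_const.
(* The predecessor pays for [i0], which may belong to [A]; larger exponents only help as
   [0 <= c <= 1]. *)
apply: ler_wiXn2l => //.
rewrite (cardD1 i0 A) (eq_card (B := [predD1 A & i0])); last by move=> j; rewrite !inE.
by case: (i0 \in A) => //=; rewrite add0n leq_pred.
Qed.

(** * The lower bound *)

Lemma bernoulli_ge (R : realFieldType) (e : R) n : 0 <= e <= 1 -> 1 - n%:R * e <= (1 - e) ^+ n.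
Proof.
move=> /andP[e0 e1]; elim: n => [|n ih]; first by rewrite mul0r subr0 expr0.
rewrite exprS -natr1.
have h : (1 - e) * (1 - n%:R * e) <= (1 - e) * (1 - e) ^+ n by apply: ler_wpM2l => //; lra.
have : 0 <= n%:R * e * e by rewrite !mulr_ge0.
by lra.
Qed.

Section lower_bound.
Local Open Scope complex_scope.
Context {R : realType}.
Local Notation leb := (@lebesgue_measure R).
Local Notation T := (measurableTypeR R).
Local Notation LT := (lebesgue_tuple R).
Variables (psi : T -> R) (K : R).
Hypothesis K0 : 0 < K.
Hypothesis ipsi : leb.-integrable setT (EFin \o psi).
Local Notation psiC := (fun x : T => (psi x)%:C).
Hypothesis psi1 : sqint leb psiC = 1%E.
Hypothesis psiK : forall xi, K < `|xi| -> fhat psiC xi = 0.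

Let cpsi : cintble leb psiC.
Proof. by split => //; exact: integrable0. Qed.

(** The approximation error times [phi]: its plain L2 norm is the weighted norm of the error. *)
Definition residual d N (al be : 'I_d -> R) (u : 'I_N -> R[i]) (a : 'I_N -> 'I_d -> R)
    (sigma : 'I_N -> R -> R) (t : d.-tuple T) : R[i] :=
  \prod_(j < d) fj psi (al j) (be j) (tnth t j) -
  \sum_(k < N) u k * ((sigma k (\sum_(j < d) a k j * tnth t j))%:C *
    \prod_(j < d) psiC (tnth t j)).

Lemma cmeas_residual d N (al be : 'I_d -> R) (u : 'I_N -> R[i]) (a : 'I_N -> 'I_d -> R)
    (sigma : 'I_N -> R -> R) :
  (forall k x y, `|sigma k x - sigma k y| <= `|x - y|) ->
  cmeas (residual al be u a sigma).
Proof.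
move=> lip; apply: cmeasB.
  apply: cmeas_prod => j; apply: cmeas_tnth; exact: (cintble_meas (cintble_fj ipsi (al j) (be j))).
apply: cmeas_sum => k; apply: cmeasM; first exact: cmeas_cst.
apply: cmeasM; last by apply: cmeas_prod => j; exact: (cmeas_tnth (u := psiC) j (cintble_meas cpsi)).
apply: cmeas_real; apply: (measurableT_comp (lipschitz1_measurable (lip k))).
apply: measurable_sum => j; apply: measurable_funM; [exact: measurable_cst|exact: measurable_tnth].
Qed.

Lemma residual_btensor d N (al be : 'I_d -> R) (u : 'I_N -> R[i]) (a : 'I_N -> 'I_d -> R)
    (sigma : 'I_N -> R -> R) (a0 del : R) m (Q : {ffun 'I_d -> 'I_m}) (t : d.-tuple T) :
  residual al be u a sigma t * btensor a0 del Q t =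
  \prod_(j < d) (fj psi (al j) (be j) (tnth t j) * bt a0 del (Q j) (tnth t j)) -
  \sum_(k < N) u k * ridge psi a0 del (a k) (sigma k) (fun j => Q j) t.
Proof.
rewrite /residual /btensor mulrBl -big_split; congr (_ - _).
rewrite mulr_suml; apply: eq_bigr => k _; rewrite /ridge -!mulrA; congr (_ * (_ * _)).
by rewrite -big_split.
Qed.

Lemma cintble_fj_bt al be a0 del n : cintble leb (fun x => fj psi al be x * bt a0 del n x).
Proof.
have [C hC] := bt_decay a0 del n.
apply: (cintbleM_bd (cintble_fj ipsi al be) (cmeas_bt a0 del n) (M := C)) => x.
apply: le_trans (hC x); rewrite -[leLHS]mul1r; apply: ler_wpM2r; first exact: normc_ge0.
by rewrite lerDl.
Qed.

Lemma cintble_residual_btensor d N (al be : 'I_d -> R) (u : 'I_N -> R[i]) (a : 'I_N -> 'I_d -> R)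
    (sigma : 'I_N -> R -> R) (a0 del : R) m (Q : {ffun 'I_d -> 'I_m}) :
  (forall k x y, `|sigma k x - sigma k y| <= `|x - y|) ->
  cintble (LT d) (fun t => residual al be u a sigma t * btensor a0 del Q t) /\
  cint (LT d) (fun t => residual al be u a sigma t * btensor a0 del Q t) =
  \prod_(j < d) coef a0 del (fj psi (al j) (be j)) (Q j) -
  \sum_(k < N) u k * cint (LT d) (ridge psi a0 del (a k) (sigma k) (fun j => Q j)).
Proof.
move=> lip.
have [cP PE] := cint_prod (fun j => cintble_fj_bt (al j) (be j) a0 del (Q j)).
have cR k := cintble_ridge ipsi a0 del (a k) (fun j => Q j) (lip k).
have cS : cintble (LT d) (fun t => \sum_(k < N) u k * ridge psi a0 del (a k) (sigma k) (fun j => Q j) t).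
  by apply: cintble_sum => k _; exact: cintbleZ.
rewrite (_ : (fun t => _) = fun t =>
    \prod_(j < d) (fj psi (al j) (be j) (tnth t j) * bt a0 del (Q j) (tnth t j)) +
    (-1) * \sum_(k < N) u k * ridge psi a0 del (a k) (sigma k) (fun j => Q j) t); last first.
  by apply/funext => t; rewrite residual_btensor mulN1r.
split; first by apply: cintbleD => //; exact: cintbleZ.
rewrite cintD//; last exact: cintbleZ.
rewrite cintZ// mulN1r PE; congr (_ - _).
rewrite cint_sum; last by move=> k _; exact: cintbleZ.
by apply: eq_bigr => k _; rewrite cintZ.
Qed.

(** Reference coordinate of a tube. If all entries are 0, division by 0 returns 0 and [rho = 0]
    still fits. *)
Lemma exists_argmax d (a : 'I_d -> R) : (0 < d)%N ->
  exists i (rho : 'I_d -> R), forall j, a j = rho j * a i /\ `|rho j| <= 1.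
Proof.
case: d a => // d a _.
have [i _ hi] := @arg_maxP _ _ _ (ord0 : 'I_d.+1) xpredT (fun j => `|a j|) isT.
exists i, (fun j => a j / a i) => j; have h : `|a j| <= `|a i| := hi j isT.
have [ai0|ai0] := eqVneq (a i) 0; last first.
  by rewrite divfK// normrM normfV ler_pdivrMr ?normr_gt0// mul1r.
by move: h; rewrite ai0 normr0 normr_le0 => /eqP ->; rewrite invr0 !mulr0 normr0.
Qed.

(** The constants [c] and [D] come from the window estimate and precede [d], [N], the frequencies
    and the network, hence the uniformity of the final bound. *)
Lemma residual_lower_bound : exists c : R, [/\ 0 < c, c < 1 & exists D : R,
  forall d N (al be : 'I_d -> R) (u : 'I_N -> R[i]) (a : 'I_N -> 'I_d -> R)
    (sigma : 'I_N -> R -> R), (0 < d)%N ->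
  (forall k x y, `|sigma k x - sigma k y| <= `|x - y|) ->
  ((1 - N%:R * c ^+ #|[set j | D <= `|be j|]%SET|.-1)%:E <= sqint (LT d) (residual al be u a sigma))%E].
Proof.
have [c [c0 c1 [D hD]]] := fhat_fj_window K0 ipsi psi1 psiK.
exists c; split => //; exists D => d N al be u a sigma d0 lip.
set A := [set j | _]%SET.
(* Finitely many cells miss some mass; it is enough to lose an arbitrary [e > 0]. *)
apply/lee_subgt0Pr => e e0; rewrite -EFinB.
(* Each coordinate may lose [ep], since [(1 - ep) ^+ d >= 1 - d * ep >= 1 - e] by Bernoulli. *)
pose ep := Num.min 1 (e / d%:R).
have dr0 : 0 < d%:R :> R by rewrite ltr0n.
have ep0 : 0 < ep by rewrite lt_min ltr01 divr_gt0.
have ep1 : ep <= 1 by rewrite ge_min lexx.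
have epd : d%:R * ep <= e.
  have : ep <= e / d%:R by rewrite ge_min lexx orbT.
  by rewrite ler_pdivlMr// mulrC.
pose U j := fj psi (al j) (be j).
have cU j : cintble leb (U j) := cintble_fj ipsi (al j) (be j).
have sU j : sqint leb (fhat (U j)) = 1%E := sqint_fhat_fj ipsi psi1 psiK (al j) (be j).
have /choice[L0 hL0] := fun j => coef_total_ge (cU j) (sU j) ep0.
pose L := (\max_(j < d) L0 j)%N.
have /choice[p0 hp0] := fun j => hL0 j L (leq_bigmax j).
(* The second entry makes the cells so narrow that [2 * del <= K], as orthogonality requires. *)
pose p := maxn (\max_(j < d) p0 j) (Num.truncn (2 / K)).+1.
pose a0 : R := - L%:R; pose del : R := p.+1%:R^-1; pose m := (2 * L * p.+1)%N.
have del0 : 0 < del by rewrite invr_gt0.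
have delK : 2 * del <= K.
  rewrite /del ler_pdivrMr// mulrC -ler_pdivrMr//.
  apply: (@le_trans _ _ p%:R); last by rewrite ler_nat.
  apply: (@le_trans _ _ (Num.truncn (2 / K)).+1%:R); last by rewrite ler_nat leq_maxr.
  by apply: ltW; exact: truncnS_gt.
pose w (j : 'I_d) (i : 'I_m) : R := normc (coef a0 del (U j) i) ^+ 2.
have w0 j i : 0 <= w j i by exact: sqr_ge0.
have wle j : \sum_i w j i <= 1 := coef_total_le a0 m (cU j) (sU j) del0.
have wge j : 1 - ep <= \sum_i w j i.
  by apply: hp0; rewrite leq_max leq_bigmax.
have /choice[i0 /choice[rho hrho]] := fun k => exists_argmax (a k) d0.
pose xi (q : 'I_m) : R := a0 + q%:R * del.
pose ok k (j : 'I_d) (q i : 'I_m) := `|xi q - rho k j * xi i| <= 3 * K.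
(* The tube of unit [k], read off from the left ends of the chosen cells; [P] keeps the choices
   outside all tubes. *)
pose bad k (Q : {ffun 'I_d -> 'I_m}) := [forall j, (j != i0 k) ==> ok k j (Q j) (Q (i0 k))].
pose P Q := ~~ [exists k, bad k Q].
have win k j i : j \in A -> j != i0 k -> \sum_(q | ok k j q i) w j q <= c.
  rewrite inE => jA _; rewrite -lee_fin.
  pose y := rho k j * xi i.
  apply: le_trans (hD (al j) (be j) y jA).
  apply: (sum_coef_le del0 (cU j)) => // q; rewrite /ok -/y ler_distl => /andP[q1 q2] z.
  rewrite /cell /= !in_itv /= -natr1 mulrDl mul1r => /andP[z1 z2].
  move: q1 q2 z1 z2; rewrite /xi => q1 q2 z1 z2; apply/andP; split; lra.
have badle k : \sum_(Q | bad k Q) \prod_(j < d) w j (Q j) <= c ^+ #|A|.-1.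
  by apply: (sum_tube_le (ok := ok k)) => //; [rewrite !ltW|exact: win].
(* Outside the tubes every unit pairs to 0, so the residual has the same coefficient as the target
   alone, a product over the coordinates. *)
have good (Q : {ffun 'I_d -> 'I_m}) : P Q ->
    normc (cint (LT d) (fun t => residual al be u a sigma t * btensor a0 del Q t)) ^+ 2 =
    \prod_(j < d) w j (Q j).
  rewrite /P negb_exists => /forallP nb.
  rewrite (cintble_residual_btensor al be u a a0 del Q lip).2.
  rewrite [X in _ - X]big1 ?subr0; first by rewrite normc_prod -prodrXl.
  move=> k _; have := nb k; rewrite /bad negb_forall => /existsP[j].
  rewrite negb_imply => /andP[ji]; rewrite /ok -ltNge => far.
  rewrite (@ridge_orthogonal _ psi K ipsi psiK a0 del d (a k) (rho k) (sigma k) (fun j => Q j) (i0 k) j)//.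
  - by rewrite mulr0.
  - by move=> k'; exact: (hrho k k').1.
  - exact: (hrho k j).2.
have := bessel del0 P (cmeas_residual al be u a lip)
  (fun Q => (cintble_residual_btensor al be u a a0 del Q lip).1).
apply: le_trans; rewrite lee_fin.
rewrite (eq_bigr _ good).
have split_good : \sum_(Q : {ffun 'I_d -> 'I_m}) \prod_(j < d) w j (Q j) <=
    \sum_(Q | P Q) \prod_(j < d) w j (Q j) + \sum_k \sum_(Q | bad k Q) \prod_(j < d) w j (Q j).
  under [X in _ + X]eq_bigr do rewrite big_mkcond.
  rewrite exchange_big /= [X in X + _]big_mkcond -big_split /=; apply: ler_sum => Q _.
  have pr0 : 0 <= \prod_(j < d) w j (Q j) by exact: prodr_ge0.
  rewrite /P; case: existsP => [[k bk]|_] /=.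
    rewrite add0r (bigD1 k)//= bk lerDl; apply: sumr_ge0 => k' _; by case: ifP.
  by rewrite lerDl; apply: sumr_ge0 => k' _; case: ifP.
have tot : 1 - e <= \sum_(Q : {ffun 'I_d -> 'I_m}) \prod_(j < d) w j (Q j).
  rewrite -(bigA_distr_bigA w).
  apply: (@le_trans _ _ ((1 - ep) ^+ d)).
    by have := @bernoulli_ge R ep d; rewrite (ltW ep0) ep1 => /(_ isT); lra.
  rewrite -[X in _ ^+ X]card_ord -prodr_const; apply: ler_prod => j _.
  by rewrite wge subr_ge0 ep1.
have sbad : \sum_k \sum_(Q | bad k Q) \prod_(j < d) w j (Q j) <= N%:R * c ^+ #|A|.-1.
  apply: (@le_trans _ _ (\sum_(k < N) c ^+ #|A|.-1)); first by apply: ler_sum => k _; exact: badle.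
  by rewrite sumr_const card_ord mulr_natl.
lra.
Qed.

End lower_bound.

(** * From the weighted norm and the set [Omega] to the coordinate form *)

Section reduction.
Local Open Scope complex_scope.
Context {R : realType}.
Local Notation leb := (@lebesgue_measure R).
Local Notation T := (measurableTypeR R).
Local Notation LT := (lebesgue_tuple R).

Lemma sqint_Lnorm2 (psi : T -> R) : ('N[leb]_2%:E [EFin \o psi] = 1)%E ->
  sqint leb (fun x : T => (psi x)%:C) = 1%E.
Proof.
move=> n2; have := @poweR_Lnorm _ T R leb (EFin \o psi) 2.
rewrite n2 poweR_EFin powR1 => -> //; apply: eq_integral => x _.
by rewrite normc_real /= powR_mulrn.
Qed.

Lemma cexpi_sum d (f : 'I_d -> R) : cexpi (\sum_(j < d) f j) = \prod_(j < d) cexpi (f j).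
Proof. by apply: big_morph; [exact: cexpiD|exact: cexpi0]. Qed.

(** Both [dot v x] and [dot w (pos_part x)] are sums over coordinates, so [target * phi] splits into
    the factors [fj]. *)
Lemma sqnormE (psi : R -> R) d N (r : R) (v w : 'rV[R]_d) (u : 'I_N -> R[i])
    (a : 'I_N -> 'rV[R]_d) (sigma : 'I_N -> R -> R) :
  sqnorm psi (fun x => target r v w x - \sum_(k < N) u k * (sigma k (dot (a k) x))%:C) =
  sqint (LT d) (residual psi (fun j => r * v ord0 j) (fun j => r * w ord0 j) u
    (fun k j => a k ord0 j) sigma).
Proof.
apply: eq_integral => t _; congr (_%:E).
set x := \row_j tnth t j.
have phiE : \prod_(j < d) (psi (tnth t j))%:C = (phi psi x)%:C.
  by rewrite /phi rmorph_prod; apply: eq_bigr => j _; rewrite mxE.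
have -> : residual psi (fun j => r * v ord0 j) (fun j => r * w ord0 j) u
    (fun k j => a k ord0 j) sigma t =
    (target r v w x - \sum_(k < N) u k * (sigma k (dot (a k) x))%:C) * (phi psi x)%:C.
  rewrite /residual mulrBl; congr (_ - _).
    rewrite /fj big_split phiE; congr (_ * _).
    rewrite -cexpi_sum /target; congr cexpi.
    rewrite /dot /pos_part -big_split mulr_sumr; apply: eq_bigr => j _.
    by rewrite !mxE /=; ring.
  rewrite mulr_suml; apply: eq_bigr => k _; rewrite phiE mulrA; congr (_ * (sigma k _)%:C * _).
  by apply: eq_bigr => j _; rewrite mxE.
by rewrite normcM exprMn normc_real real_normK// num_real.
Qed.

(** [C] has two parts: [(al ^+ d0)^-1] covers the small [d], where the left side is merely at most
    1, and [c^-1] pays for the predecessor in the exponent. For [d > d0] one has [gamma d^2 >= D],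
    so the lower bound on [n] is available. *)
Lemma decay_rate (c D gamma eta : R) : 0 < c < 1 -> 0 < gamma -> 0 < eta ->
  exists C : R, 0 < C /\ forall d n : nat, (0 < d)%N ->
    (D <= gamma * d%:R ^+ 2 -> eta * d%:R <= n%:R) ->
    c ^+ n.-1 <= C * (c `^ eta) ^+ d.
Proof.
move=> /andP[c0 c1] g0 e0; set al := c `^ eta.
have al0 : 0 < al by exact: powR_gt0.
have al1 : al <= 1.
  by rewrite -[leRHS](powRr0 c); apply: ger_powR; rewrite ?c0 ?ltW.
pose d0 := (Num.truncn (D / gamma)).+1.
have C1 : 0 < (al ^+ d0)^-1 by rewrite invr_gt0 exprn_gt0.
have C2 : 0 < c^-1 by rewrite invr_gt0.
exists (c^-1 + (al ^+ d0)^-1); split; first exact: addr_gt0.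
move=> d n dpos hn.
have ad : 0 < al ^+ d by exact: exprn_gt0.
rewrite mulrDl.
have [dd0|d0d] := leqP d d0.
  have h1 : c ^+ n.-1 <= 1 by rewrite exprn_ile1// ltW.
  have h2 : 1 <= (al ^+ d0)^-1 * al ^+ d.
    by rewrite mulrC ler_pdivlMr ?exprn_gt0// mul1r ler_wiXn2l// ltW.
  have := mulr_gt0 C2 ad; lra.
have hD : D <= gamma * d%:R ^+ 2.
  rewrite mulrC -ler_pdivrMr//.
  have t1 : D / gamma <= d0%:R by apply: ltW; exact: truncnS_gt.
  have t2 : d0%:R <= d%:R :> R by rewrite ler_nat ltnW.
  have t3 : 1 <= d%:R :> R by rewrite ler1n.
  by rewrite expr2; nra.
have h1 : c ^+ n <= al ^+ d.
  rewrite -!powR_mulrn ?(ltW c0) ?(ltW al0)// -powRrM.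
  by apply: ger_powR; [rewrite c0 ltW|exact: hn].
(* For [n = 0] the predecessor is 0 and the claim reads [1 <= c^-1]. *)
have h2 : c ^+ n.-1 <= c^-1 * c ^+ n.
  case: n {hn h1} => [|n] /=; last by rewrite exprS mulKf ?gt_eqF.
  by rewrite expr0 mulr1 invf_ge1// ltW.
have h3 : c^-1 * c ^+ n <= c^-1 * al ^+ d by rewrite ler_wpM2l// ltW.
have := mulr_gt0 C1 ad; lra.
Qed.

End reduction.

Theorem theorem5 (R : realType) (K : R) (psi : R -> R)
    (r : nat -> R) (v w : forall d : nat, 'rV[R]_d)
    (gamma k eta : R)
    (K_gt0 : 0 < K)
    (psi_L1 : psi \in Lfun (@lebesgue_measure R) 1%E)
    (psi_L2 : psi \in Lfun (@lebesgue_measure R) 2%:E)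
    (psi_norm2 : ('N[@lebesgue_measure R]_2%:E [EFin \o psi] = 1)%E)
    (psi_hat_supp : [set xi | fourier psi xi != 0] `<=` `[- K, K])
    (psi_norm1 : ('N[@lebesgue_measure R]_1 [EFin \o psi]
                    < (Num.sqrt (2 / K))%:E)%E)
    (gamma_gt0 : 0 < gamma)
    (k_gt0 : 0 < k)
    (tau_r : (fun d => tau (v d) (w d) * r d)
               =Theta_\oo (fun d => (d%:R : R) `^ k))
    (eta_gt0 : 0 < eta)
    (eta_le : forall d : nat, (0 < d)%N ->
       eta <= eta_ratio gamma (r d) (w d))
    (norm1_eta : ((2 * K)%:E * 'N[@lebesgue_measure R]_1 [EFin \o psi] ^+ 2
                    < (2 `^ (2 * eta))%:E)%E) :
  exists alpha : R, 0 < alpha < 1 /\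
  exists C : R, 0 < C /\
  forall d N : nat, (0 < d)%N ->
    ((1 - N%:R * alpha ^+ d * (C * d%:R `^ (k + 1)))%:E <=
     ereal_inf [set sqnorm psi (fun x => (target (r d) (v d) (w d) x - g x)%R)
               | g in networks R N d])%E.
Proof.
have ipsi := (Lfun1_integrable (@lebesgue_measure R) psi).1 psi_L1.
have psi1 := sqint_Lnorm2 psi_norm2.
have psiK xi : K < `|xi| -> fhat (fun x => real_complex R (psi x)) xi = 0.
  move=> Kxi; apply/eqP; apply: contraTT Kxi => xi0; rewrite -leNgt ler_norml.
  have := psi_hat_supp xi xi0; by rewrite /= in_itv.
have [c [c0 c1 [D hD]]] := residual_lower_bound K_gt0 ipsi psi1 psiK.
have c01 : 0 < c < 1 by rewrite c0.
have [C [C0 hC]] := decay_rate D c01 gamma_gt0 eta_gt0.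
exists (c `^ eta); split.
  rewrite powR_gt0//= -[ltRHS](congr1 (fun f => f eta) (@powR1 R)).
  by apply: gt0_ltr_powR => //; rewrite nnegrE ltW.
exists C; split => // d N d0.
apply: le_ereal_inf_tmp => _ [_ [u [a [sigma [lip ->]]]] <-].
rewrite sqnormE.
have lip' k' x y : `|sigma k' x - sigma k' y| <= `|x - y|.
  by have /= := lip k' (x, y) (conj I I); rewrite mul1r.
apply: le_trans (hD d N _ _ u _ sigma d0 lip').
rewrite lee_fin lerD2l lerN2 -mulrA; apply: ler_wpM2l => //.
set A := [set j | _]%SET.
have dr0 : 0 < d%:R :> R by rewrite ltr0n.
(* Once [gamma d^2] reaches [D], every index of [Omega] has [|r w_j| >= D] and lies in [A], which
   therefore has at least [eta d] elements. *)
have hA : D <= gamma * d%:R ^+ 2 -> eta * d%:R <= #|A|%:R.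
  move=> hd; have := eta_le d d0; rewrite /eta_ratio ler_pdivlMr// => /le_trans; apply.
  rewrite ler_nat subset_leq_card//; apply/fintype.subsetP => j; rewrite !inE => hj.
  rewrite (le_trans hd)// (le_trans hj)// normrM ler_wpM2r//; exact: ler_norm.
apply: le_trans (hC d #|A| d0 hA) _.
rewrite mulrA [X in _ <= X * _]mulrC -[leLHS]mulr1; apply: ler_wpM2l.
  by rewrite mulr_ge0 ?exprn_ge0 ?powR_ge0// ltW.
(* For [d >= 1] the factor [d ^ (k + 1)] is at least 1. *)
have := @ler_powR R d%:R _ 0 (k + 1); rewrite powRr0; apply; first by rewrite ler1n.
by rewrite addr_ge0// ltW.
Qed.
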